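(* Let $p\in(0,1)$ be fixed and let $m\geqslant 5$ be a fixed integer. Then with high probability $$ n+\frac{n}{4(m-1)\log_{\frac{1}{1-p}} n}(1-o(1))\leqslant\mathrm{sat}\left(G\left(n,p\right),C_m\right)\leqslant n + \frac{n}{2\log_{\frac{1}{1-p}} n}(1+o(1)). $$
   Context: $G(n,p)$ is the binomial random graph on vertex set $[n]=\{1,\dots,n\}$ in which each pair of vertices is adjacent independently with probability $p$. A property holds with high probability (whp) if its probability tends to $1$ as $n\to\infty$; the $o(1)$ terms denote functions of $n$ tending to $0$ as $n\to\infty$. $C_m$ is the cycle on $m$ vertices. For graphs $F$ and $G$, a spanning subgraph $H\subseteq G$ is $F$-saturated in $G$ if $H$ contains no copy of $F$ but adding to $H$ any edge of $G$ not in $H$ creates a copy of $F$; $\mathrm{sat}(G,F)$ is the minimum number of edges of an $F$-saturated graph in $G$. *)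

(* Defs.v *)
From HB Require Import structures.
From mathcomp Require Import all_boot all_order all_algebra.
From mathcomp Require Import all_classical all_reals all_analysis.
Set Implicit Arguments. Unset Strict Implicit. Unset Printing Implicit Defensive.
Import Order.TTheory GRing.Theory Num.Theory.
Local Open Scope ring_scope.

(* Graphs on vertex set 'I_n (= [n]) are encoded by edge sets E of ordered
   pairs (i,j) with i < j; the edge {i,j} is the pair (min,max). *)
Definition pairs (n : nat) : {set 'I_n * 'I_n} :=
  [set e : 'I_n * 'I_n | (e.1 < e.2)%N].

Definition graph_on (n : nat) (E : {set 'I_n * 'I_n}) : bool := E \subset pairs n.

Definition adj (n : nat) (E : {set 'I_n * 'I_n}) (x y : 'I_n) : bool :=
  ((x, y) \in E) || ((y, x) \in E).

Definition has_cycle (n m : nat) (E : {set 'I_n * 'I_n}) : Prop :=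
  exists f : 'I_m -> 'I_n, injective f /\ forall i : 'I_m, adj E (f i) (f (ordS i)).

Definition saturated (n m : nat) (G H : {set 'I_n * 'I_n}) : Prop :=
  [/\ H \subset G, ~ has_cycle m H &
      forall e, e \in G -> e \notin H -> has_cycle m (e |: H)].

(* sat(G, C_m): minimum number of edges of a C_m-saturated graph in G
   (such graphs always exist: any maximal C_m-free subgraph of G). *)
Definition satn (n m : nat) (G : {set 'I_n * 'I_n}) : nat :=
  \big[minn/#|G|]_(H : {set 'I_n * 'I_n} | `[< saturated m G H >]) #|H|.

Definition Gnp_prob (R : realType) (n : nat) (p : R)
    (P : {set 'I_n * 'I_n} -> Prop) : R :=
  \sum_(E : {set 'I_n * 'I_n} | graph_on E && `[< P E >])
     p ^+ #|E| * (1 - p) ^+ (#|pairs n| - #|E|).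

(* Main.v *)
Require Import Defs.
From mathcomp Require Import all_boot all_order all_algebra ring lra zify.
Set Implicit Arguments. Unset Strict Implicit. Unset Printing Implicit Defensive.

(** Write [M = m - 1], [q = 1 - p] and [L = log_(1/q) n].

    Lower bound. A first moment computation shows that whp every vertex set on which all edges
    of [G] have the form [{x, f x}] for some [f] has fewer than [s ~ 2 L] vertices. Let [H] be
    [C_m]-saturated in [G] and let [W] be the set of vertices on cycles of [H] of length at
    most [2 M]. Covering [W] greedily by such cycles, each new cycle having an edge at a new
    vertex, yields [|W| / (2 M)] edges whose removal does not disconnect anything, so [|H| >=
    n + |W| / (2 M) - s]. Off [W] the graph [H] has no cycle of length at most [2 M], hence
    two paths of length at most [M] sharing their ends agree: the vertices closer than [M / 2]
    to [W] and hanging from a given [w] are adjacent in [G] only to their parents, so there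
    are fewer than [s] of them, and the remaining vertices have polylogarithmic [G]-degree
    among themselves, so there are only polylogarithmically many. Thus [n] is at most [|W| s]
    up to lower order terms.

    Upper bound. Take a clique of [m - 2] vertices with two distinguished vertices [z1], [z2],
    a set [W] of common neighbours of [z1] and [z2], and make every other vertex a leaf
    attached to some [w] in [W], the leaves of each [w] being independent in [G]. This graph
    is [C_m]-saturated and has [n + |W| + O(1)] edges. Whp every set of [n / polylog n]
    vertices contains an independent set of size [k ~ 2 L]: the maximum number of independent
    [k]-sets pairwise sharing at most one vertex is a 1-Lipschitz function of the edges whose
    mean, for a set of [u] vertices, is at least [4 u sqrt n], so by the exponential Markov
    inequality it vanishes with probability at most [exp (- 2 n)]. Hence [|W| ~ n / (2 L)]
    suffices. *)

(** * Adjacency and walks *)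

(** The constant [4 * (m - 1)] is [2 * M] times 2: one removable edge pays for at most [2 * M]
    vertices of [W], and each of these, with the vertices hanging from it, makes at most [s ~ 2 L]
    vertices. Independent sets would not do in the first moment bound, because the vertices hanging
    from one root may span parent edges of [H], which are edges of [G]. Allowing a map [f] costs a
    factor [s ^ s] and at most [s] pairs, negligible against [n ^ s] and [s ^ 2 / 2] pairs. In the
    upper bound, carving off independent sets of size [k] stops when fewer than [u ~ n / k ^ 2]
    vertices remain, since nothing is known about small sets. A reserve [B] of order [u] vertices is
    therefore fixed in advance, and each leftover vertex is matched to a parent of its own in [B];
    this is of smaller order than [n / k]. The estimate for independent sets must survive a union
    over [2 ^ n] vertex sets, so a second moment bound is too weak and exponential concentration is
    required. Asymptotic statements are made for a real [l] tending to infinity and every [n] with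
    [n = exp l]; error sequences appear only at the end. *)

Section Adjacency.
Variable n : nat.
Implicit Types (x y a b v : 'I_n) (H : {set 'I_n * 'I_n}).

Definition epair x y : 'I_n * 'I_n := if (x < y)%N then (x, y) else (y, x).

Lemma epairC x y : epair x y = epair y x.
Proof.
by rewrite /epair; case: ltngtP => // xy; rewrite (val_inj xy).
Qed.

Lemma epair_inj x y a b :
  epair x y = epair a b -> (x = a /\ y = b) \/ (x = b /\ y = a).
Proof. by rewrite /epair; case: ifP; case: ifP => _ _ [-> ->]; auto. Qed.

Lemma mem_pairs_epair x y : (epair x y \in pairs n) = (x != y).
Proof.
rewrite /epair inE -(inj_eq val_inj) /=.
by case: (ltngtP x y) => [xy|xy|xy]; rewrite /= ?xy //; lia.
Qed.

Lemma adj_sym H : symmetric (adj H).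
Proof. by move=> x y; rewrite /adj orbC. Qed.

Lemma adjE H x y : H \subset pairs n -> adj H x y = (epair x y \in H).
Proof.
move=> /subsetP sH; rewrite /adj /epair.
case: (boolP ((x, y) \in H)) => [h|xyH] /=.
  by have := sH _ h; rewrite inE /= => ->; rewrite h.
case: (boolP ((y, x) \in H)) => [h|yxH] /=.
  by have := sH _ h; rewrite inE /=; case: ltngtP; rewrite ?h.
by case: ifP; rewrite ?(negbTE xyH) ?(negbTE yxH).
Qed.

Lemma adj_irr H x : H \subset pairs n -> adj H x x = false.
Proof.
move=> /subsetP sH; rewrite /adj orbb; apply/negP => /sH.
by rewrite inE /= ltnn.
Qed.

Lemma adj_neq H x y : H \subset pairs n -> adj H x y -> x != y.
Proof. by move=> sH; apply: contraTneq => ->; rewrite adj_irr. Qed.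

Lemma adj_set1U H e x y :
  adj (e |: H) x y = [|| adj H x y, e == (x, y) | e == (y, x)].
Proof.
rewrite /adj !in_setU1 [(x, y) == e]eq_sym [(y, x) == e]eq_sym.
by case: (e == (x, y)); case: (e == (y, x)); case: ((x, y) \in H); case: ((y, x) \in H).
Qed.

Lemma sub_setD1 H e : H \subset pairs n -> H :\ e \subset pairs n.
Proof. by apply: subset_trans; rewrite subD1set. Qed.

Lemma sub_setDD H R : H \subset pairs n -> H :\: R \subset pairs n.
Proof. by apply: subset_trans; rewrite subsetDl. Qed.

Lemma adj_setD1 H a b x y : H \subset pairs n ->
  adj (H :\ epair a b) x y = adj H x y && (epair x y != epair a b).
Proof. by move=> sH; rewrite !adjE ?sub_setD1 // in_setD1 andbC. Qed.

End Adjacency.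

Section Walks.
Variable T : finType.
Implicit Types (r : rel T) (x y z : T) (k l : nat).

Definition walk r k x y := exists2 s, path r x s & last x s = y /\ size s = k.

Definition spath r k x y :=
  exists2 s, path r x s & [/\ last x s = y, size s = k & uniq (x :: s)].

Lemma walk0 r x : walk r 0 x x. Proof. by exists [::]. Qed.

Lemma walk1 r x y : r x y -> walk r 1 x y.
Proof. by move=> xy; exists [:: y]; rewrite //= xy. Qed.

Lemma walk_cat r k l x y z : walk r k x y -> walk r l y z -> walk r (k + l) x z.
Proof.
move=> [s ps [ls <-]] [t pt [lt <-]]; exists (s ++ t).
  by rewrite cat_path ps ls.
by rewrite last_cat ls size_cat.
Qed.

Lemma walkS r k x y z : r x y -> walk r k y z -> walk r k.+1 x z.
Proof. by move=> xy w; rewrite -add1n; apply: walk_cat w; apply: walk1. Qed.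

Lemma walk_sym r k x y : symmetric r -> walk r k x y -> walk r k y x.
Proof.
move=> rs [s ps [<- <-]]; exists (rev (belast x s)).
  rewrite rev_path; apply: sub_path ps => a b; by rewrite /= rs.
split; last by rewrite size_rev size_belast.
by case: s ps => //= a s _; rewrite rev_cons last_rcons.
Qed.

Lemma walk_connect r k x y : walk r k x y -> connect r x y.
Proof. by move=> [s ps [ls _]]; apply/connectP; exists s. Qed.

Lemma walk_spath r k x y : walk r k x y -> exists2 l, l <= k & spath r l x y.
Proof.
move=> [s ps [ls <-]]; move: ls; case/shortenP: ps => s' ps' us' sub ls'.
exists (size s'); last by exists s'.
by apply: uniq_leq_size sub; move: us' => /= /andP[].
Qed.

Lemma spath_walk r k x y : spath r k x y -> walk r k x y.
Proof. by move=> [s ps [ls ss _]]; exists s. Qed.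

Lemma spath_sym r k x y : symmetric r -> spath r k x y -> spath r k y x.
Proof.
move=> rs [s ps [<- <- us]]; exists (rev (belast x s)).
  rewrite rev_path; apply: sub_path ps => a b; by rewrite /= rs.
split; first by case: s ps us => //= a s _ _; rewrite rev_cons last_rcons.
  by rewrite size_rev size_belast.
by rewrite -rev_rcons -lastI rev_uniq.
Qed.

Lemma spath1 r x y : x != y -> r x y -> spath r 1 x y.
Proof. by move=> xy rxy; exists [:: y]; rewrite //= ?rxy // inE xy. Qed.

End Walks.

(** * Breadth-first search and short cycles *)

Section BreadthFirst.
Variables (T : finType) (r : rel T) (S : {set T}) (N : nat).

(** Layers are cumulative: [layer i] is a ball around [S], not a sphere, so [sdist] is the first
    radius that works. *)
Fixpoint layer i : {set T} :=
  if i is j.+1 then layer j :|: [set y | [exists x in layer j, r x y]] else S.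

(* Truncated distance to [S]: the value [N] stands for any distance at least [N]. *)
Definition sdist v := find (fun i => v \in layer i) (iota 0 N).

(** Meaningful for [0 < sdist v < N] only. On [S] the predecessor of 0 is 0, so another vertex of
    [S] may be picked; [sroot] is unaffected, as it iterates [sdist v] times. *)
Definition sparent v := odflt v [pick x | r x v && (x \in layer (sdist v).-1)].

Definition sroot v := iter (sdist v) sparent v.

Lemma layer_walk i v :
  v \in layer i <-> exists2 x, x \in S & exists2 k, k <= i & walk r k x v.
Proof.
elim: i v => [|i IH] v /=.
  split=> [vS|[x xS [k]]]; first by exists v => //; exists 0 => //; apply: walk0.
  by rewrite leqn0 => /eqP-> [s _ [<- /size0nil->]].
rewrite in_setU in_set; split.
  move=> /orP[/IH[x xS [k ki w]]|/existsP[y /andP[/IH[x xS [k ki w]] yv]]].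
    by exists x => //; exists k => //; apply: leqW.
  exists x => //; exists (k + 1); first by rewrite addn1 ltnS.
  by apply: walk_cat w _; apply: walk1.
move=> [x xS [k]]; rewrite leq_eqVlt => /orP[/eqP->|ki] w; last first.
  by apply/orP; left; apply/IH; exists x => //; exists k.
case: w => s; case/lastP: s => [|s y]; first by move=> _ [].
rewrite rcons_path last_rcons size_rcons => /andP[ps yv] [yv'] [ss].
subst v; apply/orP; right; apply/existsP; exists (last x s); rewrite yv andbT.
by apply/IH; exists x => //; exists i => //; exists s.
Qed.

Lemma sdist_leN v : sdist v <= N.
Proof. by rewrite /sdist -{2}(size_iota 0 N) find_size. Qed.

Lemma sdist_le i v : v \in layer i -> sdist v <= i.
Proof.
move=> vi; case: (leqP N i) => [Ni|iN]; first exact: leq_trans (sdist_leN v) Ni.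
rewrite leqNgt; apply/negP => /(before_find 0).
by rewrite nth_iota // add0n vi.
Qed.

Lemma sdist_layer v : sdist v < N -> v \in layer (sdist v).
Proof.
move=> lt; have : has (fun i => v \in layer i) (iota 0 N).
  by rewrite has_find size_iota.
by move/(nth_find 0); rewrite nth_iota.
Qed.

Lemma sdist_walk x v k : x \in S -> walk r k x v -> sdist v <= k.
Proof. by move=> xS w; apply: sdist_le; apply/layer_walk; exists x => //; exists k. Qed.

Lemma sdist_eq0 v : 0 < N -> (sdist v == 0) = (v \in S).
Proof.
move=> N0; apply/eqP/idP => [d0|vS]; last by apply/eqP; rewrite -leqn0 sdist_le.
by have := @sdist_layer v; rewrite d0 => /(_ N0).
Qed.

Lemma sdist_lip x v : r x v -> sdist v <= (sdist x).+1.
Proof.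
move=> xv; case: (ltnP (sdist x) N) => [lt|ge]; last first.
  by apply: leq_trans (sdist_leN v) _; apply: leq_trans ge _.
apply: sdist_le; rewrite /= in_setU in_set; apply/orP; right.
by apply/existsP; exists x; rewrite sdist_layer.
Qed.

Lemma sparentP v : 0 < sdist v < N ->
  r (sparent v) v /\ sdist v = (sdist (sparent v)).+1.
Proof.
case/andP=> d0 dN; rewrite /sparent; case: pickP => [x /andP[xv xl]|none] /=.
  split=> //; apply/eqP; rewrite eqn_leq sdist_lip //=.
  by have := sdist_le xl; case: (sdist v) d0.
have := sdist_layer dN; case E: (sdist v) d0 none => [//|d] _ none /=.
rewrite in_setU in_set => /orP[/sdist_le|/existsP[x /andP[xl xv]]].
  by rewrite E ltnn.
by have := none x; rewrite xv xl.
Qed.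

Lemma sroot_sparent v : 0 < sdist v < N -> sroot (sparent v) = sroot v.
Proof. by move=> /sparentP[_ dE]; rewrite /sroot dE -iterSr. Qed.

Lemma sroot_mem v : sdist v < N -> sroot v \in S.
Proof.
have [d] := ubnP (sdist v); elim: d v => // d IH v.
case E : (sdist v) => [|d'] dd dN.
  by rewrite /sroot E /= -(sdist_eq0 _ dN) E.
have b : 0 < sdist v < N by rewrite E.
have [_ dE] := sparentP b; rewrite -sroot_sparent //; apply: IH.
  by move: dd; rewrite -E dE ltnS.
by apply: ltn_trans dN; rewrite -E dE.
Qed.

End BreadthFirst.

(** Each vertex outside [S] owns the edge to its parent in a breadth-first forest rooted at [S]. Two
    vertices cannot own the same edge: each would be one step farther from [S] than the other. *)
Lemma card_vertices_le n (E : {set 'I_n * 'I_n}) (S : {set 'I_n}) :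
  E \subset pairs n -> (forall v, exists2 x, x \in S & connect (adj E) x v) ->
  n <= #|E| + #|S|.
Proof.
(* A simple path has at most [n] edges, so truncation at [n.+1] never takes effect. *)
move=> sE cS; set N := n.+1; pose d := sdist (adj E) S N.
have dN v : d v < N.
  have [x xS /connectP[s ps ->]] := cS v.
  have [k kn w] : exists2 k, k <= n & walk (adj E) k x (last x s).
    case/shortenP: ps => s' ps' us' _; exists (size s'); last by exists s'.
    by apply: ltnW; have := card_uniqP us'; rewrite /= => <-;
      rewrite -[X in _ <= X](card_ord n) max_card.
  by rewrite ltnS; apply: leq_trans (sdist_walk _ xS w) kn.
pose q v := epair v (sparent (adj E) S N v).
have dS v : v \notin S -> 0 < d v < N.
  by move=> vS; rewrite dN andbT lt0n sdist_eq0.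
have inj : {in ~: S &, injective q}.
  move=> x y; rewrite !in_setC => xS yS /epair_inj[[]//|[xy yx]].
  have [_ dx] := sparentP (dS _ xS); have [_ dy] := sparentP (dS _ yS).
  by rewrite yx in dx; rewrite -xy in dy; lia.
have sub : q @: (~: S) \subset E.
  apply/subsetP => e /imsetP[v]; rewrite in_setC => vS ->.
  by rewrite -adjE // adj_sym; have [] := sparentP (dS _ vS).
rewrite -{1}(card_ord n) -(cardsC S) addnC leq_add2r -(card_in_imset inj).
exact: subset_leq_card.
Qed.

(** * Covering the short cycles at the price of few removable edges *)

Section ShortCycles.
Variables (n : nat) (H : {set 'I_n * 'I_n}) (N : nat).
Hypothesis sH : H \subset pairs n.

(** The test [2 < k] excludes an edge walked back and forth, which [cycle] accepts. *)
Definition short_cycle_set : {set 'I_n} :=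
  [set v | [exists k : 'I_N.+1, [exists t : k.-tuple 'I_n,
     [&& uniq t, cycle (adj H) t, 2 < k & v \in t]]]].
Local Notation W := short_cycle_set.

Lemma short_cycleP v : reflect
  (exists s, [/\ uniq s, cycle (adj H) s, 2 < size s <= N & v \in s]) (v \in W).
Proof.
rewrite in_set; apply: (iffP existsP) => [[k /existsP[t /and4P[ut ct k2 vt]]]|].
  by exists t; split; rewrite // size_tuple k2 -ltnS ltn_ord.
case=> s [us cs /andP[s2 sN] vs]; have sN' : size s < N.+1 by [].
exists (Ordinal sN'); apply/existsP; exists (in_tuple s).
by rewrite us cs s2 vs.
Qed.

(** The walk shortens to a simple path, which the edge [ab] closes to a cycle; the length exceeds 2
    because the path avoids [ab]. *)
Lemma edge_short a b k : adj H a b -> walk (adj (H :\ epair a b)) k a b -> k < N ->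
  a \in W /\ b \in W.
Proof.
move=> ab /walk_spath[l lk [s ps [ls ss us]]] kN.
have sub : subrel (adj (H :\ epair a b)) (adj H).
  by move=> x y; rewrite adj_setD1 // => /andP[].
have ab' := adj_neq sH ab.
have bs : b \in a :: s by rewrite -ls mem_last.
suff WW : forall v, v \in a :: s -> v \in W by split; apply: WW => //; rewrite mem_head.
move=> v vs; apply/short_cycleP; exists (a :: s); split=> //.
- by rewrite /= rcons_path ls (sub_path sub) //= adj_sym.
- rewrite /= ss; apply/andP; split; last by apply: leq_ltn_trans kN.
  case: s ls ps ss {us bs vs} => [/= E|x [|y s]] /=.
  + by rewrite E eqxx in ab'.
  + by move=> -> /andP[]; rewrite adj_setD1 // eqxx andbF.
  + by move=> _ _ <-.
Qed.

(** [C] holds the vertices covered so far and [R] the removed edges. The ends of a removed edge must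
    be linked by kept edges inside [C]: later removals touch a vertex outside [C] and cannot destroy
    this link. *)
Let inv (C : {set 'I_n}) (R : {set 'I_n * 'I_n}) :=
  [/\ R \subset H, forall x y, epair x y \in R -> x \in C,
      forall x y, epair x y \in R ->
        connect [rel u v | [&& adj (H :\: R) u v, u \in C & v \in C]] x y &
      #|C| <= N * #|R|].

(** The cycle through [v] gives up its edge [vx], which is new because [v] is outside [C]. The rest
    of the cycle still joins [x] to [v], and at most [N] vertices are added for this one edge. *)
Lemma cut_short_cycles_step C R v : inv C R -> v \in W -> v \notin C ->
  exists C' R', inv C' R' /\ v |: C \subset C'.
Proof.
move=> [RH RC Rc CR] /short_cycleP[s0 [us0 cs0 ss0 vs0]] vC.
have [i s' rs] := rot_to vs0.
have : uniq (v :: s') by rewrite -rs rot_uniq.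
have : cycle (adj H) (v :: s') by rewrite -rs rot_cycle.
have : 2 < size (v :: s') <= N by rewrite -rs size_rot.
case: s' {rs} => [|x [|y t]] //; set s := [:: v, x, y & t] => /andP[_ sN] cs us.
pose C' := C :|: [set z in s]; pose R' := epair v x |: R.
have sC' z : z \in s -> z \in C' by rewrite !inE => ->; rewrite orbT.
have CC' z : z \in C -> z \in C' by rewrite !inE => ->.
have vxR : epair v x \notin R by apply: contra vC; apply: RC.
have adjvx : adj H v x by case/andP: cs.
set r' : rel 'I_n := [rel u v | [&& adj (H :\: R') u v, u \in C' & v \in C']].
have old a b : epair a b \in R -> connect r' a b.
  move=> /Rc; apply: connect_sub => {a b} a b /= /and3P[ab aC bC].
  apply: connect1; rewrite /r' /= !CC' // !andbT.
  move: ab; rewrite !adjE ?sub_setDD // !in_setD in_setU1 negb_or => /andP[-> ->].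
  rewrite !andbT; apply/negP => /eqP /epair_inj[[av _]|[_ bv]].
    by rewrite -av aC in vC.
  by rewrite -bv bC in vC.
(* [q] allows every edge of [H] inside [C'] except [vx], also those in [R]; the latter are replaced
   by their links. *)
pose q : rel 'I_n := [rel a b | [&& adj H a b, a \in C', b \in C' & epair a b != epair v x]].
have qr : subrel q (connect r').
  move=> a b; rewrite /q /= => /and4P[ab aC bC ne]; case: (boolP (epair a b \in R)) => [/old //|abR].
  apply: connect1; rewrite /r' /= aC bC !andbT adjE ?sub_setDD //.
  by rewrite in_setD in_setU1 negb_or ne abR -adjE.
have xv : connect r' x v.
  apply: (connect_sub qr); apply/connectP; exists (rcons (y :: t) v); last by rewrite last_rcons.
  have : path (adj H) x (rcons (y :: t) v) by case/andP: cs.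
  rewrite !rcons_path => /andP[pt lt]; apply/andP; split.
    apply: (sub_in_path (P := [in [:: x, y & t]])) pt; last by apply/allP.
    move=> a b ax bx ab; rewrite /q /= ab /= !sC' ?[_ \in s]in_cons ?ax ?bx ?orbT //=.
    case/andP: us => vx _; apply/negP => /eqP/epair_inj[[av _]|[_ bv]].
      by rewrite -av ax in vx.
    by rewrite -bv bx in vx.
  have ls : last x (y :: t) \in s by rewrite in_cons mem_last orbT.
  rewrite /q /= in lt ls *.
  rewrite lt /= !sC' ?mem_head //=.
  case/and3P: us => vx xy _; apply/negP => /eqP/epair_inj[[av _]|[av _]].
    by have := mem_last y t; rewrite av => vt; move: vx; rewrite in_cons vt orbT.
  by have := mem_last y t; rewrite av => vt; move: xy; rewrite vt.
have csym : connect_sym r'.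
  by apply: sym_connect_sym => a b; rewrite /r' /= adj_sym; congr (_ && _); rewrite andbC.
exists C', R'; split; last first.
  by apply/subsetP => z; rewrite in_setU1 => /orP[/eqP->|/CC'//]; rewrite sC' // mem_head.
split.
- by rewrite subUset sub1set RH andbT -adjE.
- move=> a b; rewrite in_setU1 => /orP[/eqP/epair_inj[[-> _]|[-> _]]|/RC/CC'//];
  by rewrite sC' // !inE eqxx ?orbT.
- move=> a b; rewrite in_setU1 => /orP[/eqP/epair_inj[[-> ->]|[-> ->]]|/old//] //.
  by rewrite csym.
- rewrite /R' cardsU1 vxR mulnDr muln1 addnC.
  apply: leq_trans (leq_card_setU _ _) _; apply: leq_add => //.
  by rewrite cardsE; apply: leq_trans (card_size _) sN.
Qed.

Lemma cut_short_cycles : exists R : {set 'I_n * 'I_n}, [/\ R \subset H,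
  (forall x y, connect (adj H) x y -> connect (adj (H :\: R)) x y) & #|W| <= N * #|R|].
Proof.
suff [C [R [[RH RC Rc CR] WC]]] : exists C R, inv C R /\ W \subset C.
  exists R; split=> //; last by apply: leq_trans CR; apply: subset_leq_card.
  apply: connect_sub => x y xy; case: (boolP (epair x y \in R)) => [/Rc|xyR].
    by apply: connect_sub => a b /= /and3P[ab _ _]; apply: connect1.
  by apply: connect1; rewrite adjE ?sub_setDD // in_setD xyR -adjE.
have : inv set0 set0.
  by split; rewrite ?sub0set ?cards0 //; move=> x y; rewrite in_set0.
move: (set0 : {set 'I_n}) (set0 : {set 'I_n * 'I_n}) => C R; have [k] := ubnP #|W :\: C|.
elim: k C R => // k IH C R Wk I.
case: (boolP (W \subset C)) => [WC|/subsetPn[v vW vC]]; first by exists C, R.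
have [C' [R' [I' sC]]] := cut_short_cycles_step I vW vC.
apply: IH I'; rewrite ltnS in Wk; apply: leq_trans Wk; apply: proper_card.
apply/properP; split.
  by apply: setDS; apply: subset_trans sC; rewrite subsetUr.
exists v; first by rewrite in_setD vC.
by rewrite in_setD negb_and negbK (subsetP sC) // setU11.
Qed.

End ShortCycles.

(** * Lower bound: sparse saturated graphs *)

Lemma card_bigcup_leq (I T : finType) (A : {set I}) (F : I -> {set T}) k :
  (forall i, i \in A -> #|F i| <= k) -> #|\bigcup_(i in A) F i| <= #|A| * k.
Proof.
move=> Fk; apply: leq_trans (_ : \sum_(i in A) #|F i| <= _).
  elim/big_rec2: _ => [|i m U _ IH]; first by rewrite cards0.
  by apply: leq_trans (leq_card_setU _ _) _; rewrite leq_add2l.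
by rewrite -sum_nat_const; apply: leq_sum.
Qed.

Lemma dominating_independent_set (T : finType) (g : rel T) (X : {set T}) :
  symmetric g -> irreflexive g -> exists I : {set T},
  [/\ I \subset X, {in I &, forall x y, ~~ g x y} &
      forall x, x \in X -> x \in I \/ exists2 y, y \in I & g y x].
Proof.
move=> gs gi.
pose P (I : {set T}) := (I \subset X) && [forall x in I, forall y in I, ~~ g x y].
have [I maxI _] : {I | maxset P I & set0 \subset I}.
  apply: maxset_exists; rewrite /P sub0set /=.
  by apply/forall_inP => x; rewrite in_set0.
have [/andP[IX /forall_inP indep] mx] := maxsetP maxI.
exists I; split=> // [x y xI yI|x xX]; first by have /forall_inP := indep x xI; apply.
case: (boolP (x \in I)) => [|xI]; first by left.
right; case: (boolP [exists y in I, g y x]) => [/exists_inP//|/exists_inPn none].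
case/negP: xI; rewrite -(mx (x |: I)) ?setU11 ?subsetUr // /P.
rewrite subUset sub1set xX IX /=; apply/forall_inP => a aI.
apply/forall_inP => b bI; move: aI bI; rewrite !in_setU1.
move=> /orP[/eqP->|aI] /orP[/eqP->|bI]; rewrite ?gi //.
- by rewrite gs; apply: none.
- by apply: none.
- by have /forall_inP := indep a aI; apply.
Qed.

Section LowerBound.
Variables (n : nat) (G H : {set 'I_n * 'I_n}) (M s : nat).
Hypothesis sG : G \subset pairs n.
Hypothesis sH : H \subset pairs n.
Hypothesis M4 : 4 <= M.
Hypothesis Gsat : forall x y, adj G x y -> ~~ adj H x y -> spath (adj H) M x y.
Hypothesis Gfor : forall (S : {set 'I_n}) (f : 'I_n -> 'I_n),
  {in S &, forall x y, adj G x y -> y = f x \/ x = f y} -> #|S| < s.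

Local Notation W := (short_cycle_set H (2 * M)).
Local Notation d := (sdist (adj H) W M).
Local Notation par := (sparent (adj H) W M).
Local Notation rt := (sroot (adj H) W M).

Lemma indep_lt (I : {set 'I_n}) : {in I &, forall x y, ~~ adj G x y} -> #|I| < s.
Proof. by move=> iI; apply: (@Gfor I id) => x y xI yI; rewrite (negbTE (iI _ _ xI yI)). Qed.

Lemma Gadj_spath x y : adj G x y -> exists2 l, l = 1 \/ l = M & spath (adj H) l x y.
Proof.
move=> xy; case: (boolP (adj H x y)) => [xyH|/(Gsat xy) sp].
  by exists 1; [left | apply: spath1 => //; apply: adj_neq xyH].
by exists M; [right|].
Qed.

(** Adjacent vertices of [G] are connected in [H], so representatives of the components of [H] are
    independent in [G] and fewer than [s]. Removing [R] splits no component, and a spanning forest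
    bounds what remains. *)
Lemma card_edges_ge (R : {set 'I_n * 'I_n}) : R \subset H ->
  (forall x y, connect (adj H) x y -> connect (adj (H :\: R)) x y) ->
  n + #|R| < #|H| + s.
Proof.
move=> RH cR; pose S := [set fingraph.root (adj H) x | x in 'I_n].
have csym : connect_sym (adj H) by apply: sym_connect_sym; apply: adj_sym.
have Ss : #|S| < s.
  apply: indep_lt => x y /imsetP[a _ ->] /imsetP[b _ ->]; apply/negP => ab.
  have [l _ /spath_walk/walk_connect] := Gadj_spath ab.
  rewrite -(root_connect csym) !(root_root csym) => /eqP E.
  by have := adj_neq sG ab; rewrite E eqxx.
have : n <= #|H :\: R| + #|S|.
  apply: card_vertices_le; first exact: sub_setDD.
  move=> v; exists (fingraph.root (adj H) v); first by apply: imset_f.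
  by apply: cR; rewrite csym connect_root.
by have := subset_leq_card RH; have := cardsD H R; rewrite (setIidPr RH); lia.
Qed.

(** A simple path meets [x] only at its start, so [xz] can only be its first step. *)
Lemma spath_avoid l x y z : spath (adj H) l x y -> x != y ->
  (exists2 l', l = l'.+1 & spath (adj H) l' z y) \/ walk (adj (H :\ epair x z)) l x y.
Proof.
move=> [[|z' t] ps [ls ss us]] xy; first by rewrite -ls eqxx in xy.
case: (eqVneq z' z) => [E|ne]; [left|right].
  exists (size t); first by rewrite -ss.
  rewrite E in ps ls us; exists t; first by case/andP: ps.
  by split=> //; case/andP: us.
exists (z' :: t) => //; move: ps us => /= /andP[xz' pt] /and3P[xt _ _].
rewrite adj_setD1 // xz' /=; apply/andP; split.
  by apply/eqP => /epair_inj[[_ E]|[E1 E2]]; move: ne; rewrite ?E ?E2 -?E1 eqxx.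
apply: (sub_in_path (P := [in z' :: t])) pt; last by apply/allP.
move=> a b az bz ab; rewrite adj_setD1 // ab /=; apply/eqP => /epair_inj[[E _]|[_ E]].
  by rewrite -E az in xt.
by rewrite -E bz in xt.
Qed.

Lemma spath0 x y : spath (adj H) 0 x y -> x = y.
Proof. by move=> [t _ [<- /size0nil-> _]]. Qed.

Lemma spath_loop l x : spath (adj H) l x x -> l = 0.
Proof.
move=> [[|z t] _ [ls <- us]] //; case/andP: us => xt _; case/negP: xt.
by have := mem_last z t; rewrite /= in ls; rewrite ls.
Qed.

(** The edge from [x] to its parent could be used only when climbing from [x] itself, but the climb
    starts at another vertex no deeper than [x] and never gets deeper. *)
Lemma up_walk x v : 0 < d x < M -> d v < M -> v != x -> d v <= d x ->
  walk (adj (H :\ epair x (par x))) (d v) v (rt v).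
Proof.
move=> dx; have [_ pE] := sparentP dx.
have [k] := ubnP (d v); elim: k v => // k IH v; case E : (d v) => [|dv] vk vM vx vdx.
  by rewrite /sroot E; apply: walk0.
have bv : 0 < d v < M by rewrite E.
have [av dE] := sparentP bv.
apply: (@walkS _ _ _ _ (par v)).
  rewrite adj_setD1 // adj_sym av /=; apply/eqP => /epair_inj[[vx' _]|[E1 E2]].
    by rewrite vx' eqxx in vx.
  by rewrite E2 -E1 in dE pE *; lia.
have dp : d (par v) = dv by lia.
rewrite -sroot_sparent // -dp; apply: IH; try lia.
by apply/eqP => pvx; rewrite pvx in dp; lia.
Qed.

(** If the path avoided the edge from [x] to its parent, it could be continued from [y] up to the
    common root and down to the parent of [x]. This walk has length [l + d y + d x - 1 < 2 * M], so
    the edge would lie on a short cycle and [x] in [W], against [0 < d x]. *)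
Lemma first_step l x y : x != y -> d y <= d x -> d x < M -> rt x = rt y ->
  l + d x + d y <= 2 * M -> spath (adj H) l x y ->
  [/\ 0 < d x & exists2 l', l = l'.+1 & spath (adj H) l' (par x) y].
Proof.
move=> xy yx xM rxy lM sp.
have M0 : 0 < M by lia.
have dx0 : 0 < d x.
  rewrite lt0n; apply: contraNneq xy => dx0; move: rxy.
  by rewrite /sroot dx0; have -> : d y = 0 by [lia]; move=> /= ->.
have bx : 0 < d x < M by rewrite dx0.
have [ax dE] := sparentP bx; split=> //.
have [//|w] := spath_avoid (par x) sp xy.
suff xW : x \in W by move: dx0; rewrite lt0n sdist_eq0 // xW.
have px : par x != x by apply/eqP => E; rewrite E in dE; lia.
have yx' : y != x by rewrite eq_sym.
have w2 := up_walk bx (leq_ltn_trans yx xM) yx' yx.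
have w3 : walk (adj (H :\ epair x (par x))) (d (par x)) (par x) (rt x).
  by rewrite -sroot_sparent //; apply: up_walk => //; lia.
have w3' := walk_sym (@adj_sym _ _) w3; rewrite rxy in w3'.
have ww := walk_cat (walk_cat w w2) w3'.
have ax' : adj H x (par x) by rewrite adj_sym.
by have [] := edge_short (N := 2 * M) sH ax' ww _; first lia.
Qed.

(** The path is peeled at its deeper end: by [first_step] each peeling removes one step of the path
    and one level. *)
Lemma tree_path l x y : d x < M -> d y < M -> rt x = rt y ->
  l + d x + d y <= 2 * M -> spath (adj H) l x y -> l <= d x + d y.
Proof.
have [k] := ubnP (d x + d y); elim: k x y l => // k IH x y l dk xM yM rxy lM sp.
case: (eqVneq x y) => [E|ne]; first by rewrite E in sp; rewrite (spath_loop sp).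
wlog yx : x y dk xM yM rxy lM sp ne / d y <= d x.
  case: (leqP (d y) (d x)) => [yx /(_ x y)|/ltnW xy /(_ y x)]; first by apply.
  rewrite addnC; apply=> //; try lia; last by rewrite eq_sym.
  by apply: spath_sym => //; apply: adj_sym.
have [dx0 [l' E sp']] := first_step ne yx xM rxy lM sp.
have [_ dE] := sparentP (introT andP (conj dx0 xM)).
have := IH _ _ _ _ _ _ _ _ sp'; rewrite sroot_sparent ?dx0 //.
by move=> /(_ ltac:(lia) ltac:(lia) yM rxy ltac:(lia)); lia.
Qed.

Definition hanging w : {set 'I_n} := [set v | [&& v \notin W, 2 * d v < M & rt v == w]].

Lemma card_hanging w : #|hanging w| < s.
Proof.
apply: (@Gfor _ par) => x y; rewrite !inE => /and3P[_ dx /eqP rx] /and3P[_ dy /eqP ry] xy.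
have rxy : rt x = rt y by rewrite rx ry.
have xM : d x < M by lia. have yM : d y < M by lia.
(* A path of length [M] contradicts [tree_path], as both depths are below [M / 2]; a direct edge is
   a parent edge by [first_step]. *)
have [l [->|->] sp] := Gadj_spath xy; last first.
  have lM : M + d x + d y <= 2 * M by lia.
  by have := tree_path xM yM rxy lM sp; lia.
have ne := adj_neq sG xy.
case: (leqP (d y) (d x)) => [yx|/ltnW yx].
  have lM : 1 + d x + d y <= 2 * M by lia.
  have [_ [l' [<-] /spath0->]] := first_step ne yx xM rxy lM sp; by left.
have lM : 1 + d y + d x <= 2 * M by lia.
have sp' := spath_sym (@adj_sym _ _) sp; rewrite eq_sym in ne.
have [_ [l' [<-] /spath0->]] := first_step ne yx yM (esym rxy) lM sp'; by right.
Qed.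

(** An edge on a short cycle has both ends in [W], so the edges kept here lie on no short cycle. *)
Definition tree_adj : rel 'I_n := fun a b => adj H a b && ~~ ((a \in W) && (b \in W)).

(** If two such neighbours [y], [y'] were adjacent in [G], an [H]-path of length 1 or [M] between
    them would put [yv] or [y'v] on a short cycle, unless it were [y v y'] itself. That one has
    length 2, which [4 <= M] excludes. *)
Lemma card_tree_adj v : #|[set y | tree_adj v y]| < s.
Proof.
apply: indep_lt => y y'; rewrite !inE => /andP[vy nvy] /andP[vy' nvy']; apply/negP => yy'.
have ne := adj_neq sG yy'.
have [l lM sp] := Gadj_spath yy'.
have lM' : l.+1 < 2 * M by move: lM M4; clear; lia.
have yv : adj H y v by rewrite adj_sym.
have y'v : adj H y' v by rewrite adj_sym.
have [[l' E sp']|w] := spath_avoid v sp ne; last first.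
  have w' : walk (adj (H :\ epair y v)) 1 y' v.
    apply: walk1; rewrite adj_setD1 // y'v /=; apply/eqP => /epair_inj[[E _]|[E1 E2]].
      by rewrite E eqxx in ne.
    by rewrite -E2 adj_irr in yv.
  have := edge_short (N := 2 * M) sH yv (walk_cat w w'); rewrite addn1 => /(_ lM')[yW vW].
  by rewrite yW vW in nvy.
have ne' : y' != v by apply: adj_neq y'v.
have [[l'' E' sp'']|w] := spath_avoid v (spath_sym (@adj_sym _ _) sp') ne'.
  by have l0 := spath_loop sp''; move: l0 lM E E' M4; clear; lia.
have l'M : l' < 2 * M by move: E lM'; clear; lia.
have [y'W vW] := edge_short sH y'v w l'M.
by rewrite y'W vW in nvy'.
Qed.

(** [a] and [b] are the ends of a step inside [W], with [i] steps before it and [j] after it; the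
    step itself makes the inequality strict. *)
Lemma walk_tree_adj l x y : walk (adj H) l x y -> walk tree_adj l x y \/
  exists a b i j, [/\ i + j < l, a \in W, b \in W, walk (adj H) i x a & walk (adj H) j b y].
Proof.
move=> [t]; elim: t x l => [|z t IH] x l /=; first by move=> _ [<- <-]; left; exists [::].
case/andP=> xz pt [lt <-]; have [w|[a [b [i [j [ij aW bW wi wj]]]]]] := IH _ _ pt (conj lt erefl).
  case: (boolP ((x \in W) && (z \in W))) => [/andP[xW zW]|nW].
    right; exists x, z, 0, (size t); split=> //; first exact: walk0.
    by exists t.
  by left; apply: walkS w; rewrite /tree_adj xz.
right; exists a, b, i.+1, j; split=> //; last exact: walkS wi.
Qed.

Definition deep : {set 'I_n} := [set v | M <= 2 * d v].

(** A path with a step inside [W] would give [d x + d y < M], while both depths are at least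
    [M / 2]. *)
Lemma deep_walk x y : x \in deep -> y \in deep -> adj G x y ->
  walk tree_adj 1 x y \/ walk tree_adj M x y.
Proof.
rewrite !inE => dx dy xy; have [l lM sp] := Gadj_spath xy.
have [w|[a [b [i [j [ij aW bW wi wj]]]]]] := walk_tree_adj (spath_walk sp).
  by case: lM w => -> w; [left|right].
have xi : d x <= i := sdist_walk M aW (walk_sym (@adj_sym _ _) wi).
have yj : d y <= j := sdist_walk M bW wj.
by exfalso; case: lM ij => -> ij; lia.
Qed.

Fixpoint reach l x : {set 'I_n} :=
  if l is l'.+1 then \bigcup_(y in [set y | tree_adj x y]) reach l' y else [set x].

Lemma walk_reach l x y : walk tree_adj l x y -> y \in reach l x.
Proof.
move=> [t pt [lt <-]] {l}; elim: t x pt lt => [|z t IH] x /=; first by move=> _ <-; rewrite set11.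
case/andP=> xz pt lt; apply/bigcupP; exists z; first by rewrite inE.
exact: IH.
Qed.

Lemma card_reach l x : #|reach l x| <= s ^ l.
Proof.
elim: l x => [|l IH] x /=; first by rewrite cards1.
apply: leq_trans (card_bigcup_leq (k := s ^ l) _) _; first by move=> y _; apply: IH.
by rewrite expnS leq_mul2r ltnW ?orbT // card_tree_adj.
Qed.

(** Every deep vertex is reached from an independent dominating set by a [tree_adj] walk of length
    0, 1 or [M]; the set and all [tree_adj] degrees are smaller than [s]. *)
Lemma card_deep : #|deep| <= s * (1 + s + s ^ M).
Proof.
have [I [Id indep dom]] := dominating_independent_set deep (@adj_sym _ G) (fun x => adj_irr x sG).
apply: leq_trans (_ : #|I| * (1 + s + s ^ M) <= _); last first.
  by rewrite leq_mul2r ltnW ?orbT // indep_lt.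
apply: leq_trans (card_bigcup_leq (F := fun y => [set y] :|: reach 1 y :|: reach M y) _).
  apply: subset_leq_card; apply/subsetP => x xd; apply/bigcupP.
  have [xI|[y yI yx]] := dom x xd; first by exists x; rewrite // !inE eqxx.
  exists y => //; have yd := subsetP Id _ yI.
  by rewrite !in_setU; have [/walk_reach->|/walk_reach->] := deep_walk yd xd yx; rewrite ?orbT.
move=> y _; apply: leq_trans (leq_card_setU _ _) _; apply: leq_add; last exact: card_reach.
apply: leq_trans (leq_card_setU _ _) _; rewrite cards1 leq_add2l.
by rewrite -[X in _ <= X]expn1 card_reach.
Qed.

Lemma saturated_size_lower :
  exists t, n <= 2 * M * t * s + s * (1 + s + s ^ M) /\ n + t < #|H| + s.
Proof.
have [R [RH cR WR]] := cut_short_cycles (2 * M) sH.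
exists #|R|; split; last exact: card_edges_ge.
have s0 : 0 < s by rewrite -(cards0 'I_n) indep_lt // => x y; rewrite in_set0.
have : #|[set: 'I_n]| <= #|W :|: \bigcup_(w in W) hanging w :|: deep|.
  apply: subset_leq_card; apply/subsetP => v _; rewrite !in_setU.
  case: (boolP (v \in W)) => //= vW; rewrite inE.
  case: (leqP M (2 * d v)) => [|dv]; first by rewrite orbT.
  rewrite orbF; apply/bigcupP; exists (rt v); first by apply: sroot_mem; lia.
  by rewrite inE vW dv eqxx.
rewrite cardsT card_ord => /leq_trans; apply.
apply: leq_trans (leq_card_setU _ _) _; apply: leq_add; last exact: card_deep.
apply: leq_trans (leq_card_setU _ _) _.
apply: leq_trans (leq_add (leqnn _) (card_bigcup_leq (k := s.-1) _)) _.
  by move=> w _; rewrite -ltnS prednK // card_hanging.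
(* A vertex of [W] and the at most [s.-1] vertices hanging from it make at most [s]. *)
by rewrite -mulnS prednK // leq_mul2r WR orbT.
Qed.

End LowerBound.

(** * Saturation in terms of paths with [m.-1] edges *)

Lemma iter_ordS m (i : 'I_m) j : val (iter j (@ordS m) i) = (i + j) %% m.
Proof.
elim: j => [|j IH]; first by rewrite addn0 modn_small.
by rewrite iterS /= IH addnS -addn1 modnDml addn1.
Qed.

Lemma iter_ordS_inj m (i : 'I_m) j k : j < m -> k < m ->
  iter j (@ordS m) i = iter k (@ordS m) i -> j = k.
Proof.
move=> jm km /(congr1 val); rewrite !iter_ordS => /eqP.
by rewrite eqn_modDl !modn_small // => /eqP.
Qed.

Definition has_cycleb n m (E : {set 'I_n * 'I_n}) :=
  [exists f : {ffun 'I_m -> 'I_n}, injectiveb f && [forall i, adj E (f i) (f (ordS i))]].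

Lemma has_cycleP n m (E : {set 'I_n * 'I_n}) : reflect (has_cycle m E) (has_cycleb m E).
Proof.
apply: (iffP existsP) => [[f /andP[/injectiveP fi /forallP fa]]|[f [fi fa]]].
  by exists f.
exists (finfun f); apply/andP; split; first by apply/injectiveP => i j; rewrite !ffunE; apply: fi.
by apply/forallP => i; rewrite !ffunE.
Qed.

Lemma saturated_exists n m (G : {set 'I_n * 'I_n}) : 0 < m -> exists H, saturated m G H.
Proof.
move=> m0; pose P (H : {set 'I_n * 'I_n}) := (H \subset G) && ~~ has_cycleb m H.
have [H maxH _] : {H | maxset P H & set0 \subset H}.
  apply: maxset_exists; rewrite /P sub0set /=; apply/has_cycleP => -[f [_ /(_ (Ordinal m0))]].
  by rewrite /adj !in_set0.
have [/andP[HG /has_cycleP nc] mx] := maxsetP maxH.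
exists H; split=> // e eG eH; case: (has_cycleP m (e |: H)) => // nce; case/negP: eH.
rewrite -(mx (e |: H)) ?setU11 ?subsetUr // /P subUset sub1set eG HG /=.
exact/has_cycleP.
Qed.

Lemma path_map_iota (T : eqType) (r : rel T) (g : nat -> T) a k :
  (forall j, a <= j < a + k -> r (g j) (g j.+1)) ->
  path r (g a) [seq g j | j <- iota a.+1 k].
Proof.
elim: k a => //= k IH a ra; rewrite ra ?leqnn ?addnS ?ltnS ?leq_addr //=.
by apply: IH => j jk; apply: ra; lia.
Qed.

Lemma last_map_iota (T : Type) (g : nat -> T) a k :
  last (g a) [seq g j | j <- iota a.+1 k] = g (a + k).
Proof. by elim: k a => [|k IH] a /=; rewrite ?addn0 // IH addSnnS. Qed.

Lemma epair_id n (e : 'I_n * 'I_n) : e \in pairs n -> epair e.1 e.2 = e.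
Proof. by case: e => a b; rewrite inE /epair => /= ->. Qed.

(** The new edge must be a step of the created cycle; starting just after it, the other [m.-1] steps
    form a path of [H]. *)
Lemma saturated_spath n m (G H : {set 'I_n * 'I_n}) x y : 2 < m -> G \subset pairs n ->
  saturated m G H -> adj G x y -> ~~ adj H x y -> spath (adj H) m.-1 x y.
Proof.
move=> m3 sG [HG nc sat] xyG xyH; have sH := subset_trans HG sG.
rewrite adjE // in xyH; rewrite adjE // in xyG.
have [f [fi fa]] := sat _ xyG xyH.
have pid := epair_id (subsetP sG _ xyG).
have adjf i : adj H (f i) (f (ordS i)) || (epair (f i) (f (ordS i)) == epair x y).
  have := fa i; rewrite adj_set1U => /or3P[->//|/eqP h|/eqP h].
    by move: pid; rewrite h /= => ->; rewrite eqxx orbT.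
  by move: pid; rewrite h /= epairC => ->; rewrite eqxx orbT.
have [i Ei] : exists i, epair (f i) (f (ordS i)) = epair x y.
  case: (boolP [exists i, epair (f i) (f (ordS i)) == epair x y]) => [/existsP[i /eqP]|].
    by exists i.
  move=> /existsPn ne; case: nc; exists f; split=> // j.
  by have := adjf j; rewrite (negbTE (ne j)) orbF.
pose g j := f (iter j (@ordS m) (ordS i)).
have gadj j : j < m.-1 -> adj H (g j) (g j.+1).
  move=> jm; have := adjf (iter j (@ordS m) (ordS i)); case/orP=> // /eqP.
  (* No other step runs over the same edge: in the same direction two indices would coincide, in the
     opposite one the cycle would have length at most 2. *)
  rewrite -Ei => /epair_inj[[/fi h _]|[/fi h /fi h']].
    by rewrite -iterSr in h; have := @iter_ordS_inj _ i j.+1 0 _ _ h; lia.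
  have j0 : j = 0 by apply: (@iter_ordS_inj _ (ordS i) j 0 _ _ h); lia.
  by rewrite j0 in h'; have := @iter_ordS_inj _ i 2 0 _ _ h'; lia.
have sp : spath (adj H) m.-1 (f (ordS i)) (f i).
  exists [seq g j | j <- iota 1 m.-1]; first by apply: (@path_map_iota _ _ g 0) => j /andP[_]; apply: gadj.
  split; [|by rewrite size_map size_iota|].
    rewrite (last_map_iota g 0) add0n /g -iterSr prednK; last by lia.
    by congr f; apply: val_inj; rewrite iter_ordS modnDr modn_small.
  rewrite -[_ :: _]/(map g (iota 0 m.-1.+1)) map_inj_in_uniq ?iota_uniq // => j k.
  rewrite !mem_iota /= !add0n => jm km /fi h; apply: iter_ordS_inj h; lia.
have [[<- <-]|[<- <-]] := epair_inj Ei; last by [].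
by apply: spath_sym => //; apply: adj_sym.
Qed.

Lemma saturated_card_lower n m s (G H : {set 'I_n * 'I_n}) : 5 <= m -> G \subset pairs n ->
  (forall (S : {set 'I_n}) (f : 'I_n -> 'I_n),
     {in S &, forall x y, adj G x y -> y = f x \/ x = f y} -> #|S| < s) ->
  saturated m G H -> exists t,
    n <= 2 * m.-1 * t * s + s * (1 + s + s ^ m.-1) /\ n + t < #|H| + s.
Proof.
move=> m5 sG Gfor sat; have [HG _ _] := sat.
apply: (@saturated_size_lower _ G) => //; [exact: subset_trans sG|lia|].
by move=> x y; apply: saturated_spath => //; lia.
Qed.

(** * Upper bound: the saturated construction *)

Lemma spath_has_cycle n m (H : {set 'I_n * 'I_n}) x y e : 0 < m ->
  spath (adj H) m.-1 x y -> e = (x, y) \/ e = (y, x) -> has_cycle m (e |: H).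
Proof.
move=> m0 [s ps [ls ss us]] exy; exists (fun i => nth x (x :: s) i).
have sz : size (x :: s) = m by rewrite /= ss prednK.
split=> [i j /eqP|i].
  by rewrite nth_uniq ?sz // => /eqP/val_inj.
rewrite adj_set1U; case: (ltnP i.+1 m) => im.
  rewrite [val (ordS i)]/= modn_small //.
  have -> // : adj H (nth x (x :: s) i) (nth x (x :: s) i.+1).
  by move/(pathP x): ps; apply; rewrite ss; lia.
have -> : i = m.-1 :> nat by have := ltn_ord i; lia.
rewrite [val (ordS i)]/=; have -> : i.+1 %% m = 0.
  by have -> : i.+1 = m by [have := ltn_ord i; lia]; rewrite modnn.
have -> : nth x (x :: s) m.-1 = y.
  by rewrite -ss -[size s]/((size (x :: s)).-1) nth_last.
by case: exy => ->; rewrite !eqxx ?orbT.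
Qed.

Section Construction.
Variables (n m : nat) (G : {set 'I_n * 'I_n}) (z1 z2 : 'I_n) (K' : seq 'I_n).
Variables (W : {set 'I_n}) (par : 'I_n -> 'I_n).
Hypothesis m5 : 5 <= m.
Hypothesis sG : G \subset pairs n.
Local Notation K := [:: z1, z2 & K'].
Local Notation Z := [:: z1; z2].
Hypothesis uK : uniq K.
Hypothesis szK : size K = m - 2.
Hypothesis cliqueK : {in K &, forall x y, x != y -> adj G x y}.
Hypothesis disjW : {in W, forall w, w \notin K}.
Hypothesis adjW : {in W, forall w, adj G z1 w /\ adj G z2 w}.
Hypothesis W2 : 1 < #|W|.
Let leaf x := (x \notin K) && (x \notin W).
Hypothesis parW : forall x, leaf x -> par x \in W /\ adj G x (par x).
Hypothesis indep : forall x y, leaf x -> leaf y -> par x = par y -> ~~ adj G x y.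

Definition blowup_rel : rel 'I_n := fun x y =>
  [|| (x \in K) && (y \in K), (x \in Z) && (y \in W), (y \in Z) && (x \in W),
      leaf x && (y == par x) | leaf y && (x == par y)].
Local Notation h := blowup_rel.

Definition blowup_graph : {set 'I_n * 'I_n} := [set e in pairs n | h e.1 e.2].
Local Notation H := blowup_graph.

Lemma hC x y : h x y = h y x.
Proof.
rewrite /h andbC; congr (_ || _).
by rewrite orbCA; congr [|| _, _ | _]; rewrite orbC.
Qed.

Lemma ZK x : x \in Z -> x \in K.
Proof. by rewrite !inE => /orP[] ->; rewrite ?orbT. Qed.

Lemma sHp : H \subset pairs n.
Proof. by apply/subsetP => e; rewrite inE => /andP[]. Qed.

Lemma adjHE x y : adj H x y = (x != y) && h x y.
Proof.
rewrite adjE ?sHp // inE mem_pairs_epair; congr (_ && _).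
by rewrite /epair; case: ifP => //= _; rewrite hC.
Qed.

Lemma leafNW x : leaf x -> x \notin W. Proof. by case/andP. Qed.
Lemma leafNK x : leaf x -> x \notin K. Proof. by case/andP. Qed.

Lemma memW_ne w x : w \in W -> x \in K -> x != w.
Proof. by move=> /disjW wK xK; apply: contraNneq wK => <-. Qed.

Lemma leafW_ne x w : leaf x -> w \in W -> x != w.
Proof. by move=> /leafNW xW wW; apply: contraNneq xW => ->. Qed.

Lemma adjH_K x y : x \in K -> y \in K -> x != y -> adj H x y.
Proof. by move=> xK yK xy; rewrite adjHE xy /h xK yK. Qed.

Lemma adjH_ZW z w : z \in Z -> w \in W -> adj H z w.
Proof.
by move=> zZ wW; rewrite adjHE (memW_ne wW) ?ZK //= /h zZ wW orbT.
Qed.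

Lemma adjH_leaf x : leaf x -> adj H x (par x).
Proof.
move=> lx; have [pW _] := parW lx.
by rewrite adjHE leafW_ne //= /h lx eqxx !orbT.
Qed.

Lemma blowup_sub : H \subset G.
Proof.
apply/subsetP => e; rewrite inE => /andP[ep he].
have ne : e.1 != e.2 by rewrite -mem_pairs_epair epair_id.
suff : adj G e.1 e.2 by rewrite adjE // epair_id.
have ZW z w : z \in Z -> w \in W -> adj G z w.
  by move=> zZ /adjW[a1 a2]; move: zZ; rewrite !inE => /orP[]/eqP->.
case/or4P: he => [/andP[a b]|/andP[a b]|/andP[a b]|/orP[/andP[a /eqP->]|/andP[a /eqP->]]].
- exact: cliqueK.
- exact: ZW.
- by rewrite adj_sym; apply: ZW.
- by have [] := parW a.
- by rewrite adj_sym; have [] := parW a.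
Qed.

Lemma z1Z : z1 \in Z. Proof. by rewrite inE eqxx. Qed.
Lemma z2Z : z2 \in Z. Proof. by rewrite !inE eqxx orbT. Qed.

(* A cycle meets no leaf, so it has at least two vertices in [W]; each of these has
   both [z1] and [z2] as its neighbours on the cycle, which forces length 4. *)
Lemma blowup_acyclic : ~ has_cycle m H.
Proof.
move=> [f [fi fa]].
have S2 i : ordS (ordS i) != i :> 'I_m.
  by apply/eqP => E; have := @iter_ordS_inj _ i 2 0 _ _ E; lia.
have prd i : exists j : 'I_m, ordS j = i by exists (ord_pred i); rewrite ord_predK.
have nbr j i : ordS j = i -> f j != f (ordS i).
  move=> ji; rewrite (inj_eq fi) -ji eq_sym; exact: S2.
have noleaf i : ~~ leaf (f i).
  apply/negP => li; have [j ji] := prd i.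
  have parE y : adj H (f i) y -> y = par (f i).
    rewrite adjHE => /andP[_]; rewrite /h.
    have [/negbTE nK /negbTE nW] := andP li.
    have -> : f i \in Z = false by apply: contraFF nK; apply: ZK.
    rewrite nK nW andbF li /= => /orP[/eqP//|/andP[ly /eqP Ey]].
    by have [] := parW ly; rewrite -Ey nW.
  have := nbr _ _ ji; rewrite (parE _ (fa i)) (parE (f j)) ?eqxx //.
  by rewrite adj_sym -ji fa.
have Wnbr i y : f i \in W -> (exists k, y = f k) -> adj H (f i) y -> y \in Z.
  move=> fW [k ->]; rewrite adjHE => /andP[_]; rewrite /h.
  rewrite (negbTE (disjW fW)) /= fW andbT.
  have -> : f i \in Z = false by apply: contraNF (disjW fW); apply: ZK.
  rewrite (negbTE (noleaf k)) /= orbF => /orP[//|/andP[]].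
  by rewrite /leaf fW andbF.
have [i [j [ij iW jW]]] : exists i j, [/\ i != j, f i \in W & f j \in W].
  have : 1 < #|[set i | f i \in W]|.
    have c : #|[set i | f i \in W]| + #|[set i | f i \in K]| = m.
      rewrite -[RHS](card_ord m) -(cardsC [set i | f i \in W]); congr (_ + _).
      apply: eq_card => i; rewrite !inE -!in_cons; move: (noleaf i); rewrite /leaf negb_and !negbK.
      case/orP=> [iK|iW]; first by rewrite iK; apply/esym; apply/negP => /disjW; rewrite iK.
      by rewrite iW; apply/negbTE/disjW.
    have : #|[set i | f i \in K]| <= m - 2.
      rewrite -szK -(card_imset _ fi); apply: leq_trans (card_size K).
      apply: subset_leq_card; apply/subsetP => y /imsetP[i]; rewrite inE => ik ->.
      by [].
    by lia.
  by case/card_gt1P => i [j []]; rewrite !inE => iW jW ij; exists i, j.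
have [i' Ei] := prd i; have [j' Ej] := prd j.
have Zi : f (ordS i) \in Z by apply: (Wnbr i) => //; exists (ordS i).
have Zj : f (ordS j) \in Z by apply: (Wnbr j) => //; exists (ordS j).
have Zi' : f i' \in Z.
  by apply: (Wnbr i) => //; [exists i' | rewrite adj_sym -Ei].
have Zj' : f j' \in Z.
  by apply: (Wnbr j) => //; [exists j' | rewrite adj_sym -Ej].
have ni := nbr _ _ Ei; have nj := nbr _ _ Ej.
have Sinj : injective (@ordS m) := @ordS_inj m.
have Sij : f (ordS i) != f (ordS j) by rewrite (inj_eq fi) (inj_eq Sinj).
have pij : f i' != f j'.
  by apply: contraNneq ij => /fi E; rewrite -Ei -Ej E.
have E1 : f (ordS i) = f j'.
  by move: Zi Zj Zi' Zj' ni nj Sij pij; rewrite !inE;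
     do 4 ![case/orP=> /eqP->]; rewrite ?eqxx.
have E2 : f (ordS j) = f i'.
  by move: Zi Zj Zi' Zj' ni nj Sij pij; rewrite !inE;
     do 4 ![case/orP=> /eqP->]; rewrite ?eqxx.
move/fi: E1 => E1; move/fi: E2 => E2.
have : iter 4 (@ordS m) i = iter 0 (@ordS m) i by rewrite /= E1 Ej E2 Ei.
have m0 : 0 < m by apply: leq_trans m5.
by move=> E; have := @iter_ordS_inj _ i 4 0 m5 m0 E.
Qed.

(** At most [m ^ 2] edges lie inside the clique, [2 * #|W|] at [z1] and [z2], and one at each leaf;
    there are at most [n - #|W|] leaves. *)
Lemma card_blowup : #|H| <= n + #|W| + m ^ 2.
Proof.
pose A := setX [set x in K] [set x in K].
pose F z := [set epair z w | w in W].
pose P := [set epair x (par x) | x in [set x | leaf x]].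
have sub : H \subset A :|: F z1 :|: F z2 :|: P.
  have ZF z w : z \in Z -> w \in W -> (epair z w \in F z1) || (epair z w \in F z2).
    by rewrite !inE => /orP[]/eqP-> wW; apply/orP; [left|right]; apply: imset_f.
  have PF x : leaf x -> epair x (par x) \in P.
    by move=> lx; apply/imsetP; exists x; rewrite // inE.
  apply/subsetP => e; rewrite inE => /andP[ep he]; rewrite -(epair_id ep) !in_setU.
  case/or4P: he => [ab|/andP[a b]|/andP[a b]|/orP[/andP[a /eqP->]|/andP[a /eqP->]]].
  - by have -> : epair e.1 e.2 \in A by rewrite epair_id // [e]surjective_pairing in_setX !in_set.
  - by have /orP[->|->] := ZF _ _ a b; rewrite ?orbT.
  - by rewrite epairC; have /orP[->|->] := ZF _ _ a b; rewrite ?orbT.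
  - by rewrite PF ?orbT.
  - by rewrite epairC PF ?orbT.
have cF z : #|F z| <= #|W| by apply: leq_imset_card.
have cA : #|A| <= m ^ 2.
  have cK : #|[set x in K]| <= m.
    by rewrite cardsE; apply: leq_trans (card_size _) _; rewrite szK leq_subr.
  by rewrite cardsX expnS expn1; apply: leq_mul.
have cP : #|P| + #|W| <= n.
  rewrite -[X in _ <= X](card_ord n) -(cardsC W) addnC leq_add2l.
  apply: leq_trans (leq_imset_card _ _) _; apply: subset_leq_card.
  by apply/subsetP => x; rewrite !inE => /leafNW.
apply: leq_trans (subset_leq_card sub) _; apply: leq_trans (leq_card_setU _ _) _.
apply: leq_trans (leq_add (leq_trans (leq_card_setU _ _)
  (leq_add (leq_trans (leq_card_setU _ _) (leq_add cA (cF z1))) (cF z2))) (leqnn _)) _.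
by move: cP; move: #|P| #|W| (m ^ 2) => a b c; clear; lia.
Qed.

Lemma clique_path x s : {subset x :: s <= K} -> uniq (x :: s) -> path (adj H) x s.
Proof.
elim: s x => //= y s IH x sub /andP[]; rewrite in_cons negb_or => /andP[xy _] us.
apply/andP; split; first by apply: adjH_K => //; apply: sub; rewrite !inE eqxx ?orbT.
by apply: IH => // z zs; apply: sub; rewrite in_cons zs orbT.
Qed.

Lemma z1K : z1 \in K. Proof. exact: ZK z1Z. Qed.

(** A common shape of the required paths: reach [W] along [L], cross the clique from [z1] to [z2],
    return to [W] at [r0]. Dropping [j] of the [m - 4] other clique vertices makes room for leaves
    at the two ends. *)
Lemma through_core a L r0 R j : path (adj H) a L -> last a L \in W ->
  r0 \in W -> path (adj H) r0 R -> uniq (a :: L ++ r0 :: R) ->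
  {in a :: L ++ r0 :: R, forall v, v \notin K} -> j <= m - 4 ->
  spath (adj H) (size L + (m - 4 - j) + size R + 3) a (last r0 R).
Proof.
move=> pL lL rW pR uLR nK jm; set D := drop j K'.
have szK' : size K' = m - 4.
  by move: szK => /= E; rewrite -[4]/(2 + 2) subnDA -E subn2.
have DK x : x \in D -> x \in K' by apply: mem_drop.
have uD : uniq [:: z1, z2 & D].
  move: uK => /= /and3P[z1n z2n uK'].
  rewrite /D drop_uniq // andbT inE negb_or; move: z1n; rewrite inE negb_or => /andP[-> z1n] /=.
  by apply/andP; split; [apply: contra z1n | apply: contra z2n]; apply: DK.
have sub : {subset z1 :: D ++ [:: z2] <= K}.
  move=> x; rewrite in_cons mem_cat !inE => /or3P[->//|/DK->|->]; by rewrite ?orbT.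
exists (L ++ z1 :: D ++ z2 :: r0 :: R).
  rewrite cat_path pL /= adj_sym adjH_ZW ?z1Z //=.
  rewrite -[z2 :: _]cat1s catA cat_path last_cat /= pR andbT adjH_ZW ?z2Z // andbT.
  apply: clique_path => //.
  suff /perm_uniq -> : perm_eq (z1 :: D ++ [:: z2]) [:: z1, z2 & D] by [].
  by apply/permP => P; rewrite /= count_cat /=; clear; lia.
split.
- by rewrite last_cat /= last_cat.
- by rewrite size_cat /= size_cat /= size_drop szK' -!addnA; clear; lia.
- suff /perm_uniq -> : perm_eq (a :: L ++ z1 :: D ++ z2 :: r0 :: R)
      ((a :: L ++ r0 :: R) ++ [:: z1, z2 & D]).
    rewrite cat_uniq uLR uD andbT; apply/hasPn => x; rewrite !inE => xD.
    apply/negP => /nK; rewrite !inE; case/or3P: xD => [->|->|/DK->]; by rewrite ?orbT.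
  by apply/permP => P; rewrite /= !count_cat /= ?count_cat /= ?count_cat /=; clear; lia.
Qed.

Lemma spath_WW w w' : w \in W -> w' \in W -> w != w' -> spath (adj H) m.-1 w w'.
Proof.
move=> wW wW' ne; have -> : m.-1 = 0 + (m - 4 - 0) + 0 + 3 by move: m5; clear; lia.
apply: (@through_core w [::] w' [::]) => //=; first by rewrite inE ne.
by move=> v; rewrite !inE -!in_cons => /orP[]/eqP->; apply: disjW.
Qed.

Lemma spath_LW x w : leaf x -> w \in W -> par x != w -> spath (adj H) m.-1 x w.
Proof.
move=> lx wW ne; have [pW _] := parW lx.
have -> : m.-1 = 1 + (m - 4 - 1) + 0 + 3 by move: m5; clear; lia.
apply: (@through_core x [:: par x] w [::]) => //=; last by move: m5; clear; lia.
- by rewrite adjH_leaf.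
- by rewrite !inE negb_or !(leafW_ne lx) //= ne.
- move=> v; rewrite 3!in_cons in_nil orbF => /or3P[]/eqP->; try exact: disjW.
  exact: leafNK.
Qed.

Lemma spath_LL x y : leaf x -> leaf y -> par x != par y -> spath (adj H) m.-1 x y.
Proof.
move=> lx ly ne; have [pW _] := parW lx; have [pW' _] := parW ly.
have xy : x != y by apply: contraNneq ne => ->.
have uxy : uniq [:: x; par x; par y; y].
  have e1 := leafW_ne lx pW; have e2 := leafW_ne lx pW'.
  have e3 := leafW_ne ly pW; have e4 := leafW_ne ly pW'.
  by rewrite /= !inE !negb_or e1 e2 xy ne ![_ == y]eq_sym e3 e4.
have nK : {in [:: x; par x; par y; y], forall v, v \notin K}.
  move=> v; rewrite 4!in_cons in_nil orbF => /or4P[]/eqP->; try exact: disjW; exact: leafNK.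
case: (leqP 6 m) => [m6|m6].
  have -> : m.-1 = 1 + (m - 4 - 2) + 1 + 3 by move: m6; clear; lia.
  apply: (@through_core x [:: par x] (par y) [:: y]) => //=; [by rewrite adjH_leaf| |by move: m6; clear; lia].
  by rewrite adj_sym adjH_leaf.
(* For [m = 5] a passage through both [z1] and [z2] is one step too long even without [K']; [z1]
   alone gives the right length. *)
have -> : m.-1 = 4 by move: m5 m6; clear; lia.
exists [:: par x; z1; par y; y]; last first.
  split=> //; suff /perm_uniq -> : perm_eq [:: x; par x; z1; par y; y] (z1 :: [:: x; par x; par y; y]).
    by rewrite cons_uniq uxy andbT; apply: contraTN z1K; apply: nK.
  by apply/permP => P /=; clear; lia.
by rewrite /= adjH_leaf // [adj _ (par x) z1]adj_sym !(adjH_ZW z1Z) //= adj_sym adjH_leaf.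
Qed.

(** All clique vertices in an order that ends at a neighbour of [W], then the parent of [y], then
    [y]: [m - 3] steps plus 2. *)
Lemma spath_KL c C y : perm_eq (c :: C) K -> last c C \in Z -> leaf y ->
  spath (adj H) m.-1 c y.
Proof.
move=> pe lZ ly; have [pW _] := parW ly.
have subK : {subset c :: C <= K} by move=> x; rewrite (perm_mem pe).
exists (C ++ [:: par y; y]).
  rewrite cat_path clique_path //=; last by rewrite -[_ && _]/(uniq (c :: C)) (perm_uniq pe).
  by rewrite adjH_ZW //= adj_sym adjH_leaf.
split; first by rewrite last_cat.
  by have := perm_size pe; rewrite szK /= size_cat /=; move: m5; clear; lia.
rewrite -cat_cons cat_uniq (perm_uniq pe) uK /= andbT mem_seq1 eq_sym (leafW_ne ly pW) andbT orbF.
apply/norP; split; apply/negP => /subK; apply/negP; [exact: disjW | exact: leafNK].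
Qed.

(** A tour of the clique followed by [w] is one step short, so a second vertex [w'] of [W] is
    inserted between [z2] and [z1]. *)
Lemma spath_K'W c w : c \in K' -> w \in W -> spath (adj H) m.-1 c w.
Proof.
move=> cK' wW; have [w' w'W ne] : exists2 w', w' \in W & w' != w.
  case/card_gt1P: W2 => a [b [aW bW ab]]; case: (eqVneq a w) => [E|]; last by exists a.
  by exists b => //; rewrite eq_sym -E.
set D := rem c K'.
have pD : perm_eq K' (c :: D) by apply: perm_to_rem.
have pe : perm_eq (c :: D ++ [:: z2; z1]) K.
  apply/permP => P; move/permP/(_ P): pD => /=; rewrite count_cat /= => ->; clear; lia.
have subK : {subset c :: D ++ [:: z2; z1] <= K} by move=> x; rewrite (perm_mem pe).
exists (D ++ [:: z2; w'; z1; w]).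
  rewrite cat_path /= (adjH_ZW z2Z w'W) [adj _ w' z1]adj_sym !(adjH_ZW z1Z) // !andbT.
  have : path (adj H) c (D ++ [:: z2; z1]).
    by apply: clique_path => //; rewrite (perm_uniq pe).
  by rewrite cat_path /= => /and3P[-> ->].
split; first by rewrite last_cat.
  by have := perm_size pe; rewrite szK /= !size_cat /=; move: m5; clear; lia.
suff /perm_uniq -> : perm_eq (c :: D ++ [:: z2; w'; z1; w]) ([:: w'; w] ++ c :: D ++ [:: z2; z1]).
  rewrite cat_uniq (perm_uniq pe) uK andbT; apply/andP; split; first by rewrite /= mem_seq1 ne.
  apply/hasPn => x /subK xK.
  by rewrite in_cons mem_seq1 negb_or !(memW_ne _ xK).
by apply/permP => P; rewrite /= !count_cat /=; clear; lia.
Qed.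

Lemma blowup_spath x y : adj G x y -> ~~ adj H x y -> spath (adj H) m.-1 x y.
Proof.
have sym u v : spath (adj H) m.-1 u v -> spath (adj H) m.-1 v u.
  by apply: spath_sym; apply: adj_sym.
have KW u v : u \in K -> v \in W -> ~~ adj H u v -> spath (adj H) m.-1 u v.
  move=> uK' vW nuv; apply: spath_K'W => //.
  by move: uK' nuv; rewrite !inE => /or3P[/eqP->|/eqP->|//]; rewrite adjH_ZW ?z1Z ?z2Z.
have KL u v : u \in K -> leaf v -> spath (adj H) m.-1 u v.
  move=> uK' lv; have : [\/ u = z1, u = z2 | u \in K'].
    by move: uK'; rewrite !inE => /or3P[/eqP|/eqP|]; [constructor 1|constructor 2|constructor 3].
  case=> [->|->|uK0].
  - apply: (@spath_KL _ (K' ++ [:: z2])) => //; last by rewrite last_cat z2Z.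
    by apply/permP => P; rewrite /= count_cat /=; clear; lia.
  - apply: (@spath_KL _ (K' ++ [:: z1])) => //; last by rewrite last_cat z1Z.
    by apply/permP => P; rewrite /= count_cat /=; clear; lia.
  - apply: (@spath_KL _ (rem u K' ++ [:: z2; z1])) => //; last by rewrite last_cat z1Z.
    apply/permP => P; move/permP/(_ P): (perm_to_rem uK0) => /=.
    by rewrite count_cat /= => ->; clear; lia.
have LW u v : leaf u -> v \in W -> ~~ adj H u v -> spath (adj H) m.-1 u v.
  move=> lu vW nuv; apply: spath_LW => //; apply: contraNneq nuv => <-.
  exact: adjH_leaf.
have typ u : [\/ u \in K, u \in W | leaf u].
  rewrite /leaf; case: (boolP (u \in K)) => uK'; first by constructor 1.
  by case: (boolP (u \in W)) => uW; [constructor 2 | constructor 3].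
move=> xy nxy; have ne := adj_neq sG xy; have nyx : ~~ adj H y x by rewrite adj_sym.
case: (typ x) => [xK|xW|lx]; case: (typ y) => [yK|yW|ly]; auto.
- by rewrite adjH_K in nxy.
- exact: spath_WW.
- by apply: spath_LL => //; apply: contraTneq xy; apply: indep.
Qed.

Lemma blowup_saturated : saturated m G H.
Proof.
split; [exact: blowup_sub | exact: blowup_acyclic |] => e eG eH.
have ep := subsetP sG _ eG.
have exy : adj G e.1 e.2 by rewrite adjE // epair_id.
have nexy : ~~ adj H e.1 e.2 by rewrite adjE ?sHp // epair_id.
apply: spath_has_cycle (blowup_spath exy nexy) _; first by lia.
by left; case: (e).
Qed.

End Construction.

Lemma subset_of_card (T : finType) (A : {set T}) k : k <= #|A| ->
  exists2 B : {set T}, B \subset A & #|B| = k.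
Proof.
move=> kA; exists [set x in take k (enum A)].
  by apply/subsetP => x; rewrite inE => /mem_take; rewrite mem_enum.
rewrite cardsE; have /card_uniqP -> : uniq (take k (enum A)) by rewrite take_uniq ?enum_uniq.
by rewrite size_takel // -cardE.
Qed.

(** Using a partner costs every other vertex at most one candidate, and [#|U|] drops by one as well,
    so the greedy choice never gets stuck. *)
Lemma greedy_matching (T : finType) (g : rel T) (U Z : {set T}) :
  (forall v, v \in U -> #|U| <= #|[set w in Z | g v w]|) ->
  exists f : T -> T, {in U, forall v, f v \in Z /\ g v (f v)} /\ {in U &, injective f}.
Proof.
have [k] := ubnP #|U|; elim: k U Z => // k IH U Z Uk deg.
case: (set_0Vmem U) => [U0|[v vU]].
  by exists id; rewrite U0; split=> [v|v w]; rewrite in_set0.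
have : 0 < #|[set w in Z | g v w]|.
  by apply: leq_trans (deg v vU); apply/card_gt0P; exists v.
case/card_gt0P => w; rewrite inE => /andP[wZ gvw].
have cU := cardsD1 v U; rewrite vU in cU.
have [||f [fZ fi]] := IH (U :\ v) (Z :\ w); first by lia.
  move=> x; rewrite in_setD1 => /andP[xv xU].
  have -> : [set y in Z :\ w | g x y] = [set y in Z | g x y] :\ w.
    by apply/setP => y; rewrite !inE andbA.
  have := deg x xU; rewrite (cardsD1 w [set y in Z | g x y]).
  by case: (w \in _); lia.
exists (fun x => if x == v then w else f x); split=> [x xU|x y xU yU].
  case: eqVneq => [->//|xv]; have [|fx gx] := fZ x; first by rewrite in_setD1 xv.
  by move: fx; rewrite in_setD1 => /andP[].
have fw z : z \in U -> z != v -> f z != w.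
  move=> zU zv; have [|fz _] := fZ z; first by rewrite in_setD1 zv.
  by move: fz; rewrite in_setD1 => /andP[].
case: eqVneq => [->|xv]; case: eqVneq => [->//|yv].
- by move=> E; have := fw y yU yv; rewrite E eqxx.
- by move=> E; have := fw x xU xv; rewrite E eqxx.
- by apply: fi; rewrite in_setD1 ?xv ?yv.
Qed.

(** * Realising the construction inside a graph with random-like properties *)

Section Assembly.
Variables (n m k s1 u u1 r y0 y1 : nat) (G : {set 'I_n * 'I_n}) (B : {set 'I_n}).
Hypothesis m5 : 5 <= m.
Hypothesis sG : G \subset pairs n.
Hypothesis large_indep : forall U : {set 'I_n}, u1 <= #|U| ->
  exists A : {set 'I_n}, [/\ A \subset U, #|A| = k & {in A &, forall x y, ~~ adj G x y}].
Hypothesis dense_pair : forall S U : {set 'I_n}, [disjoint S & U] -> s1 <= #|S| -> u <= #|U| ->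
  exists2 w, w \in S & u1 <= #|[set x in U | adj G w x]|.
Hypothesis common0 : forall t : 'I_m -> 'I_n,
  y0 <= #|[set v in ~: B | [forall i, adj G v (t i)]]|.
Hypothesis common1 : forall t : 'I_m -> 'I_n,
  y1 <= #|[set v in B | [forall i, adj G v (t i)]]|.
Hypothesis k0 : 0 < k.

(** A vertex of [S] with [u1] neighbours in [U] becomes the parent of an independent [k]-set among
    them. Each round costs [S] one vertex and [U] exactly [k], so the inequality persists and keeps
    [#|S|] at least [s1] until fewer than [u] vertices remain. *)
Lemma extraction (U S : {set 'I_n}) : [disjoint S & U] -> #|U| + s1 * k <= #|S| * k ->
  exists (par : 'I_n -> 'I_n) (U' : {set 'I_n}), [/\ U' \subset U, #|U'| < u \/ U' = set0,
    {in U :\: U', forall x, par x \in S /\ adj G x (par x)} &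
    {in U :\: U' &, forall x y, par x = par y -> ~~ adj G x y}].
Proof.
have [j] := ubnP #|U|; elim: j U S => // j IH U S Uj dis US.
case: (ltnP #|U| u) => [Uu|Uu].
  by exists id, U; split; rewrite ?setDv //; [left | move=> x; rewrite in_set0 | move=> x y; rewrite in_set0].
have s1S : s1 <= #|S| by rewrite -(leq_pmul2r k0); apply: leq_trans US; rewrite leq_addl.
have [w wS wU] := dense_pair dis s1S Uu.
have [A [AU Ak indA]] := large_indep wU.
have AU' : A \subset U by apply: subset_trans AU _; apply/subsetP => x; rewrite inE => /andP[].
have cUA : #|U :\: A| = #|U| - k by rewrite cardsD (setIidPr AU') Ak.
have kU : k <= #|U| by rewrite -Ak subset_leq_card.
have cS : #|S :\ w| = #|S|.-1 by rewrite (cardsD1 w S) wS.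
have S0 : 0 < #|S| by apply/card_gt0P; exists w.
have dis' : [disjoint S :\ w & U :\: A].
  by apply: disjointWl (subD1set _ _) _; apply: disjointWr (subsetDl _ _) dis.
have US' : #|U :\: A| + s1 * k <= #|S :\ w| * k.
  rewrite cUA cS; have -> : #|S|.-1 * k = #|S| * k - k by rewrite -subn1 mulnBl mul1n.
  by lia.
have [|par [U' [U'U Usm parS parI]]] := IH _ _ _ dis' US'; first by rewrite cUA; lia.
exists (fun x => if x \in A then w else par x), U'; split=> //.
- exact: subset_trans U'U (subsetDl _ _).
- move=> x; rewrite in_setD => /andP[xU' xU]; case: ifPn => xA.
    by split=> //; move/subsetP/(_ x xA): AU; rewrite inE adj_sym => /andP[].
  have [|pS px] := parS x; first by rewrite !in_setD xU' xA.
  by split=> //; move: pS; rewrite in_setD1 => /andP[].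
- have pw z : z \notin U' -> z \in U -> z \notin A -> par z != w.
    move=> zU' zU zA; have [|pS _] := parS z; first by rewrite !in_setD zU' zA.
    by move: pS; rewrite in_setD1 => /andP[].
  move=> x y; rewrite !in_setD => /andP[xU' xU] /andP[yU' yU].
  case: ifPn => xA; case: ifPn => yA; first by move=> _; apply: indA.
  + by move=> E; have := pw y yU' yU yA; rewrite E eqxx.
  + by move=> E; have := pw x xU' xU xA; rewrite E eqxx.
  + by apply: parI; rewrite !in_setD ?xU' ?yU' ?xA ?yA.
Qed.

Lemma common_nbrs (C : {set 'I_n}) y (l : seq 'I_n) : 0 < size l <= m ->
  (forall t : 'I_m -> 'I_n, y <= #|[set v in C | [forall i, adj G v (t i)]]|) ->
  y <= #|[set v in C | all (adj G v) l]|.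
Proof.
(* A shorter list is padded with its head, the default of [nth]. *)
case: l => // x l /andP[_ lm] /(_ (fun i => nth x (x :: l) i)) /leq_trans; apply.
apply: subset_leq_card; apply/subsetP => v; rewrite !inE => /andP[-> /forallP al] /=.
apply/(all_nthP x (s := x :: l)) => i il.
by have := al (Ordinal (leq_trans il lm)).
Qed.

Lemma clique_exists j : 0 < y0 -> 0 < n -> j < m -> exists l : seq 'I_n,
  [/\ uniq l, size l = j.+1 & {in l &, forall x y, x != y -> adj G x y}].
Proof.
move=> y00 n0; elim: j => [|j IH] jm.
  exists [:: Ordinal n0]; split=> // x y; rewrite !inE => /eqP-> /eqP->.
  by rewrite eqxx.
have [l [ul sl cl]] := IH (ltnW jm).
have : 0 < #|[set v in ~: B | all (adj G v) l]|.
  by apply: leq_trans y00 _; apply: common_nbrs => //; rewrite sl; lia.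
case/card_gt0P => v; rewrite !inE => /andP[_ /allP av].
exists (v :: l); split; rewrite /= ?sl // ?ul ?andbT.
  by apply/negP => /av; rewrite adj_irr.
move=> x y; rewrite !in_cons => /orP[/eqP->|xl] /orP[/eqP->|yl]; rewrite ?eqxx //.
- by move=> _; apply: av.
- by move=> _; rewrite adj_sym; apply: av.
- exact: cl.
Qed.

(** [Z0] receives the leaves carved in independent [k]-sets; [Z1], inside the reserve [B], receives
    the at most [u] leftover vertices, one per parent. The [m] in [r + m] and [u + m] compensates
    for excluding the clique. *)
Lemma small_saturated : 0 < n -> 1 < r -> r + m <= y0 -> u + m <= y1 -> n + s1 * k <= r * k ->
  exists2 H, saturated m G H & #|H| <= n + (r + #|B|) + m ^ 2.
Proof.
move=> n0 r2 ry0 uy1 nr.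
have [|//||] := @clique_exists (m - 3); [by lia|by lia|] => K [].
have -> : (m - 3).+1 = m - 2 by lia.
case: K => [|z1 [|z2 K']] uK szK clK; rewrite /= in szK; [by lia|by lia|].
set K := [:: z1, z2 & K'] in uK clK.
have szK' : size K = m - 2 by [].
have nbr (C : {set 'I_n}) l y : l != [::] -> size l <= m ->
    (forall t : 'I_m -> 'I_n, y + m <= #|[set v in C | [forall i, adj G v (t i)]]|) ->
    y <= #|[set v in C | (v \notin K) && all (adj G v) l]|.
  move=> l0 lm hy; have := common_nbrs (l := l) _ hy.
  rewrite lm andbT lt0n size_eq0 => /(_ l0) c.
  have -> : [set v in C | (v \notin K) && all (adj G v) l] =
            [set v in C | all (adj G v) l] :\: [set v in K].
    by apply/setP => v; rewrite !in_set; case: (v \in K); rewrite ?andbF ?andbT.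
  have cK : #|[set v in K]| <= m by rewrite cardsE; apply: leq_trans (card_size _) _; rewrite szK' leq_subr.
  rewrite cardsD; apply: leq_trans (leq_sub2l _ (leq_trans (subset_leq_card (subsetIr _ _)) cK)).
  by rewrite -{1}(addnK m y); apply: leq_sub2r c.
pose P (C : {set 'I_n}) := [set v in C | (v \notin K) && all (adj G v) [:: z1; z2]].
have PP (C : {set 'I_n}) v : v \in P C -> [/\ v \in C, v \notin K, adj G z1 v & adj G z2 v].
  by rewrite in_set /= => /and3P[? ? /and3P[? ? _]]; split=> //; rewrite adj_sym.
have rP : r <= #|P (~: B)|.
  apply: nbr => //=; first by lia.
  by move=> t; apply: leq_trans ry0 (common0 t).
have [Z0 Z0P Z0r] := subset_of_card rP.
set Z1 := P B; set W := Z0 :|: Z1.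
have Z01 x : x \in Z0 -> x \notin Z1.
  move=> /(subsetP Z0P)/PP[xB _ _ _]; apply/negP => /PP[xB' _ _ _].
  by rewrite in_setC xB' in xB.
have WP w : w \in W -> [/\ w \notin K, adj G z1 w & adj G z2 w].
  by rewrite in_setU => /orP[/(subsetP Z0P)|] /PP[].
pose U := [set x | (x \notin K) && (x \notin W)].
have dis : [disjoint Z0 & U].
  rewrite disjoint_subset; apply/subsetP => x xZ; apply/negP; rewrite in_set => /andP[_].
  by rewrite in_setU xZ.
have US : #|U| + s1 * k <= #|Z0| * k.
  rewrite Z0r; apply: leq_trans nr; rewrite leq_add2r -[X in _ <= X](card_ord n).
  exact: max_card.
have [par0 [U' [U'U Usm parS parI]]] := extraction dis US.
have U'u : #|U'| <= u by case: Usm => [/ltnW//|->]; rewrite cards0.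
(* The common neighbours in [B] of [z1], [z2] and a leftover [v] are the candidates for [v] in
   [Z1]. *)
have [|par1 [par1Z par1i]] := @greedy_matching _ (adj G) U' Z1.
  move=> v vU'; apply: leq_trans U'u _.
  have := nbr B [:: z1; z2; v] u isT _ _.
  rewrite /= (leq_trans _ m5) // => /(_ isT (fun t => leq_trans uy1 (common1 t))) /leq_trans; apply.
  apply: subset_leq_card; apply/subsetP => w; rewrite !in_set /=.
  by move=> /and3P[-> -> /and4P[-> -> vw _]] /=; rewrite adj_sym.
pose par x := if x \in U' then par1 x else par0 x.
have UE x : (x \notin K) && (x \notin W) = (x \in U) by rewrite [in RHS]in_set.
have UD x : x \in U -> x \notin U' -> x \in U :\: U' by move=> xU xU'; rewrite in_setD xU'.
exists (blowup_graph z1 z2 K' W par).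
  apply: blowup_saturated => //.
  - by move=> w /WP[].
  - by move=> w /WP[].
  - by apply: leq_trans r2 _; rewrite -Z0r subset_leq_card // subsetUl.
  - move=> x; rewrite UE => xU; rewrite /par; case: ifPn => xU'.
      by have [pZ pa] := par1Z x xU'; rewrite in_setU pZ orbT.
    by have [pZ pa] := parS x (UD _ xU xU'); rewrite in_setU pZ.
  - move=> x y; rewrite !UE => xU yU; rewrite /par; case: ifPn => xU'; case: ifPn => yU'.
    + by move=> /par1i -> //; rewrite adj_irr.
    + move=> E; have [p1 _] := par1Z x xU'; have [p0 _] := parS y (UD _ yU yU').
      by have := Z01 _ p0; rewrite -E p1.
    + move=> E; have [p1 _] := par1Z y yU'; have [p0 _] := parS x (UD _ xU xU').
      by have := Z01 _ p0; rewrite E p1.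
    + by apply: parI; apply: UD.
have cW : #|W| <= r + #|B|.
  apply: leq_trans (leq_card_setU _ _) _; rewrite Z0r leq_add2l.
  by apply: subset_leq_card; apply/subsetP => x /PP[].
apply: leq_trans (card_blowup W par szK') _.
by rewrite leq_add2r leq_add2l.
Qed.

End Assembly.

Import Order.TTheory GRing.Theory Num.Theory.

(** * Random subsets *)

Section RandomSubset.
Local Open Scope ring_scope.
Variables (R : realFieldType) (T : finType) (p : R).
Implicit Types (A D E : {set T}) (f g : {set T} -> R).

(* Expectation of [f E], where each element of [D] is put in [E] independently with
   probability [p]. *)
Definition Ex D f : R :=
  \sum_(E : {set T} | E \subset D) p ^+ #|E| * (1 - p) ^+ (#|D| - #|E|) * f E.

Lemma Ex0 f : Ex set0 f = f set0.
Proof.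
rewrite /Ex (eq_bigl (pred1 set0)) => [|E]; last by rewrite subset0.
by rewrite big_pred1_eq cards0 !expr0 !mul1r.
Qed.

(** Conditioning on whether [e] is chosen, which drives the inductions on [D]. *)
Lemma ExU1 e D f : e \notin D ->
  Ex (e |: D) f = p * Ex D (fun E => f (e |: E)) + (1 - p) * Ex D f.
Proof.
move=> eD; rewrite /Ex (bigID (fun E : {set T} => e \in E)) /=; congr (_ + _).
  rewrite (reindex_onto (fun E => e |: E) (fun E => E :\ e)) /=; last first.
    by move=> E /andP[_ eE]; rewrite setD1K.
  rewrite mulr_sumr; apply: eq_big => [E|E].
    rewrite setU11 andbT subUset sub1set setU11 /=; apply/andP/idP => [[sE /eqP <-]|sE].
      apply/subsetP => x; rewrite in_setD1 => /andP[xe xE].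
      by move: (subsetP sE x); rewrite !in_setU1 (negbTE xe) /= in xE *; apply.
    have eE : e \notin E by apply: contra eD; apply: (subsetP sE).
    by rewrite setU1K // eqxx; split=> //; apply: subset_trans sE (subsetUr _ _).
  move=> /andP[_ /eqP <-]; set E' := _ :\ e.
  have eE' : e \notin E' by rewrite setD11.
  by rewrite !cardsU1 eE' eD /= !add1n subSS exprS !mulrA.
rewrite mulr_sumr; apply: eq_big => [E|E].
  apply/andP/idP => [[sE eE]|sE].
    apply/subsetP => x xE; have := subsetP sE x xE; rewrite in_setU1 => /orP[/eqP xe|//].
    by rewrite -xe xE in eE.
  split; first by apply: subset_trans sE (subsetUr _ _).
  by apply: contra eD; apply: (subsetP sE).
move=> /andP[sE eE]; rewrite cardsU1 eD add1n subSn ?exprS; last first.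
  apply: subset_leq_card; apply/subsetP => x xE; have := subsetP sE x xE.
  by rewrite in_setU1 => /orP[/eqP xe|//]; rewrite -xe xE in eE.
by rewrite mulrCA !mulrA.
Qed.

Lemma eq_Ex D f g : (forall E, E \subset D -> f E = g E) -> Ex D f = Ex D g.
Proof. by move=> fg; apply: eq_bigr => E ED; rewrite fg. Qed.

Lemma ExD D f g : Ex D (fun E => f E + g E) = Ex D f + Ex D g.
Proof. by rewrite /Ex -big_split; apply: eq_bigr => E _; rewrite mulrDr. Qed.

Lemma ExZ D a f : Ex D (fun E => a * f E) = a * Ex D f.
Proof. by rewrite /Ex mulr_sumr; apply: eq_bigr => E _; rewrite mulrCA. Qed.

Lemma Ex_sum (I : finType) (P : pred I) D (F : I -> {set T} -> R) :
  Ex D (fun E => \sum_(i | P i) F i E) = \sum_(i | P i) Ex D (F i).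
Proof. by rewrite /Ex exchange_big /=; apply: eq_bigr => E _; rewrite mulr_sumr. Qed.

Lemma Ex_restrict A D f : A \subset D -> (forall E, f E = f (E :&: A)) -> Ex D f = Ex A f.
Proof.
move=> AD fA; have [k] := ubnP #|D :\: A|; elim: k D AD => // k IH D AD Dk.
case: (set_0Vmem (D :\: A)) => [D0|[e]].
  by congr Ex; apply/eqP; rewrite eqEsubset AD andbT -setD_eq0 D0.
rewrite in_setD => /andP[eA eD]; rewrite -(setD1K eD) ExU1 ?setD11 //.
have AD' : A \subset D :\ e by rewrite subsetD1 AD eA.
rewrite (eq_Ex (g := f)) => [|E _]; last first.
  rewrite fA [RHS]fA setIUl; congr f; rewrite (_ : [set e] :&: A = set0) ?set0U //.
  by apply/setP => x; rewrite !inE; case: eqP => // ->; rewrite (negbTE eA).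
rewrite -mulrDl addrC subrK mul1r; apply: IH AD' _.
have sub : D :\ e :\: A \subset (D :\: A) :\ e by apply/subsetP => x; rewrite !inE => /and3P[-> -> ->].
apply: leq_ltn_trans (subset_leq_card sub) _; move: Dk.
by rewrite (cardsD1 e (D :\: A)) in_setD eA eD.
Qed.

Lemma Ex_subset A D : A \subset D -> Ex D (fun E => (A \subset E)%:R) = p ^+ #|A|.
Proof.
move=> AD; rewrite (Ex_restrict AD); last by move=> E; rewrite subsetI subxx andbT.
rewrite /Ex (bigD1 A) //= big1 => [|E /andP[EA nE]].
  by rewrite subxx subnn expr0 !mulr1 addr0.
by rewrite (_ : A \subset E = false) ?mulr0 //; apply: contraNF nE; rewrite eqEsubset EA.
Qed.

Lemma Ex_disjoint A D : A \subset D -> Ex D (fun E => [disjoint A & E]%:R) = (1 - p) ^+ #|A|.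
Proof.
move=> AD; have dE E : [disjoint A & E] = (E :&: A == set0) by rewrite disjoint_sym -setI_eq0.
rewrite (Ex_restrict AD); last by move=> E; rewrite !dE -setIA setIid.
rewrite /Ex (bigD1 set0) ?sub0set //= big1 => [|E /andP[EA nE]].
  by rewrite dE set0I eqxx cards0 subn0 expr0 mul1r mulr1 addr0.
by rewrite dE (setIidPl EA) (negbTE nE) mulr0.
Qed.

Lemma Ex_cst D a : Ex D (fun _ => a) = a.
Proof.
rewrite (eq_Ex (g := fun E => a * (set0 \subset E)%:R)) => [|E _]; last by rewrite sub0set mulr1.
by rewrite ExZ Ex_subset ?sub0set // cards0 mulr1.
Qed.

Hypothesis p01 : 0 <= p <= 1.

Lemma Ex_le D f g : (forall E, E \subset D -> f E <= g E) -> Ex D f <= Ex D g.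
Proof.
move=> fg; apply: ler_sum => E ED; apply: ler_wpM2l; last exact: fg.
by have /andP[p0 p1] := p01; rewrite mulr_ge0 ?exprn_ge0 // subr_ge0.
Qed.

Lemma Ex_ge0 D f : (forall E, E \subset D -> 0 <= f E) -> 0 <= Ex D f.
Proof. by move=> f0; rewrite -(Ex_cst D 0); apply: Ex_le. Qed.

Lemma Ex_union (I : finType) (P : pred I) D (b : I -> {set T} -> bool) (c : {set T} -> bool) a :
  (forall E, E \subset D -> c E -> exists2 i, P i & b i E) ->
  (forall i, P i -> Ex D (fun E => (b i E)%:R) <= a) ->
  Ex D (fun E => (c E)%:R) <= a *+ #|P|.
Proof.
move=> cb ba; apply: le_trans (_ : Ex D (fun E => \sum_(i | P i) (b i E)%:R) <= _).
  apply: Ex_le => E ED; case: (boolP (c E)) => [/(cb _ ED)[i Pi bi]|_]; last exact: sumr_ge0.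
  by rewrite (bigD1 i) //= bi lerDl sumr_ge0.
by rewrite Ex_sum -sumr_const; apply: ler_sum.
Qed.

Lemma Ex_exists_ge D f a : a <= Ex D f -> exists2 E : {set T}, E \subset D & a <= f E.
Proof.
move=> af; case: (boolP [exists E : {set T}, (E \subset D) && (a <= f E)]).
  by move=> /existsP[E /andP[ED aE]]; exists E.
move=> /existsPn none; exfalso.
pose c := \big[Order.max/(a - 1)]_(E : {set T} | E \subset D) f E.
have fc E : E \subset D -> f E <= c by move=> ED; rewrite /c (bigD1 E) //= le_max lexx.
have ca : c < a.
  apply: (big_ind (fun x => x < a)) => [|x y xa ya|E ED]; first by lra.
    by rewrite gt_max xa.
  by move: (none E); rewrite ED /= -ltNge.
have : Ex D f <= Ex D (fun _ => c) by apply: Ex_le.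
by rewrite Ex_cst => /(le_trans af) /(le_lt_trans)/(_ ca); rewrite ltxx.
Qed.

End RandomSubset.

From mathcomp Require Import reals sequences exp.

(** * Concentration *)

Section Concentration.
Local Open Scope ring_scope.
Variables (R : realType) (T : finType) (p : R).
Hypothesis p01 : 0 <= p <= 1.

(** From [1 - x <= expR (- x)] one gets [expR x <= (1 - x)^-1], and the quadratic times [1 - x]
    exceeds 1 by [x ^+ 2 * (1 - 2 * x)]. *)
Lemma expR_le_quadratic (x : R) : x <= 2^-1 -> expR x <= 1 + x + 2 * x ^+ 2.
Proof.
move=> x2; have h := expR_ge1Dx (- x).
have x1 : 0 < 1 - x by lra.
rewrite -[x in expR x]opprK expRN; apply: le_trans (_ : (1 - x)^-1 <= _).
  by rewrite lef_pV2 ?posrE ?expR_gt0.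
rewrite -div1r ler_pdivrMr // -subr_ge0.
have -> : (1 + x + 2 * x ^+ 2) * (1 - x) - 1 = x ^+ 2 * (1 - 2 * x) by ring.
by apply: mulr_ge0; [exact: sqr_ge0 | lra].
Qed.

Lemma Ex_lipschitz (D : {set T}) (f g : {set T} -> R) :
  (forall E, `|f E - g E| <= 1) -> `|Ex p D f - Ex p D g| <= 1.
Proof.
move=> fg.
have -> : Ex p D f - Ex p D g = Ex p D (fun E => f E - g E).
  by rewrite ExD; congr (_ + _); rewrite -mulN1r -ExZ; apply: eq_Ex => E _; rewrite mulN1r.
rewrite ler_norml -{1}(Ex_cst p D (-1)) -{2}(Ex_cst p D 1).
by apply/andP; split; apply: Ex_le => // E _; have := fg E; rewrite ler_norml => /andP[].
Qed.

(** Conditioning on [e] leaves two conditional means at distance at most 1. Their deviations from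
    the overall mean average to zero, so each element contributes only a second-order factor
    [expR (2 * l ^+ 2)]. *)
Lemma Ex_mgf (l : R) (D : {set T}) (f : {set T} -> R) : 0 <= l <= 2^-1 ->
  (forall e E, e \in D -> `|f (e |: E) - f E| <= 1) ->
  Ex p D (fun E => expR (l * (Ex p D f - f E))) <= expR (2 * l ^+ 2 * #|D|%:R).
Proof.
move=> /andP[l0 l2]; have [k] := ubnP #|D|; elim: k D f => // k IH D f Dk lip.
case: (set_0Vmem D) => [->|[e eD]].
  by rewrite !Ex0 subrr cards0 !mulr0.
have eD' : e \notin D :\ e by rewrite setD11.
have Dk' : (#|D :\ e| < k)%N by move: Dk; rewrite (cardsD1 e D) eD.
have cD : #|D|%:R = #|D :\ e|%:R + 1 :> R.
  by rewrite (cardsD1 e D) eD natrD addrC.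
move: Dk lip cD; rewrite -(setD1K eD); move: (D :\ e) eD' Dk' => D' eD' Dk' _ lip cD.
rewrite setU1K // in cD; rewrite cD; clear cD D eD.
pose f1 E := f (e |: E).
have lip1 e' E : e' \in D' -> `|f1 (e' |: E) - f1 E| <= 1.
  by move=> e'D; rewrite /f1 setUCA; apply: lip; rewrite in_setU1 e'D orbT.
have lip0 e' E : e' \in D' -> `|f (e' |: E) - f E| <= 1.
  by move=> e'D; apply: lip; rewrite in_setU1 e'D orbT.
have IH1 := IH D' f1 Dk' lip1; have IH0 := IH D' f Dk' lip0.
have dlt : `|Ex p D' f1 - Ex p D' f| <= 1.
  by apply: Ex_lipschitz => E; apply: lip; rewrite setU11.
rewrite !ExU1 // -/f1; set m1 := Ex p D' f1 in IH1 dlt *; set m0 := Ex p D' f in IH0 dlt *.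
set mu := p * m1 + (1 - p) * m0.
have sp (g : {set T} -> R) m : Ex p D' (fun E => expR (l * (mu - g E))) =
    expR (l * (mu - m)) * Ex p D' (fun E => expR (l * (m - g E))).
  by rewrite -ExZ; apply: eq_Ex => E _; rewrite -expRD; congr expR; ring.
rewrite (sp (fun E => f (e |: E)) m1) (sp f m0).
have -> : 2 * l ^+ 2 * (#|D'|%:R + 1) = 2 * l ^+ 2 * #|D'|%:R + 2 * l ^+ 2 by ring.
rewrite expRD.
set B := expR (2 * l ^+ 2 * #|D'|%:R) in IH1 IH0 *.
have /andP[p0 p1] := p01; have q0 : 0 <= 1 - p by lra.
have B0 : 0 <= B by exact: expR_ge0.
apply: le_trans (_ : B * (p * expR (l * (mu - m1)) + (1 - p) * expR (l * (mu - m0))) <= _).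
  have mono (c a b x : R) : 0 <= c -> 0 <= a -> x <= b -> c * (a * x) <= b * (c * a).
    by move=> c0 a0 xb; rewrite mulrA [b * _]mulrC; apply: ler_wpM2l => //; apply: mulr_ge0.
  by rewrite [B * (_ + _)]mulrDr; apply: lerD; apply: mono => //; apply: expR_ge0.
apply: ler_wpM2l => //.
have {dlt}: `|m1 - m0| <= 1 := dlt; rewrite ler_norml => /andP[d1 d2].
pose d := m1 - m0.
have E1 : mu - m1 = - (1 - p) * d by rewrite /mu /d; ring.
have E0 : mu - m0 = p * d by rewrite /mu /d; ring.
have dd : -1 <= d <= 1 by rewrite /d d1 d2.
have d2' : d ^+ 2 <= 1 by move/andP: dd => [? ?]; nra.
apply: le_trans (_ : 1 + 2 * l ^+ 2 <= _); last first.
  exact: expR_ge1Dx.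
apply: le_trans (lerD (ler_wpM2l p0 (expR_le_quadratic _)) (ler_wpM2l q0 (expR_le_quadratic _))) _.
- rewrite E1; have h : - (1 - p) * d <= 1 by move/andP: dd => [? ?]; nra.
  by apply: le_trans (ler_wpM2l l0 h) _; rewrite mulr1.
- rewrite E0; have h : p * d <= 1 by move/andP: dd => [? ?]; nra.
  by apply: le_trans (ler_wpM2l l0 h) _; rewrite mulr1.
rewrite E1 E0.
(* The terms linear in [l] cancel. *)
have -> : p * (1 + l * (- (1 - p) * d) + 2 * (l * (- (1 - p) * d)) ^+ 2) +
   (1 - p) * (1 + l * (p * d) + 2 * (l * (p * d)) ^+ 2) =
   1 + 2 * l ^+ 2 * (d ^+ 2 * (p * (1 - p))) by ring.
rewrite lerD2l -[X in _ <= X]mulr1; apply: ler_wpM2l.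
  by rewrite mulr_ge0 // sqr_ge0.
apply: le_trans (_ : 1 * 1 <= 1); last by rewrite mulr1.
apply: ler_pM => //; [exact: sqr_ge0|exact: mulr_ge0|nra].
Qed.

(* Optimising the exponential Markov inequality over the rate [l] gives [l = t / (4 N)]. *)
Lemma Ex_lower_tail (A D : {set T}) (f : {set T} -> R) (mu t N : R) :
  A \subset D -> (forall E, f E = f (E :&: A)) ->
  (forall e E, e \in A -> `|f (e |: E) - f E| <= 1) ->
  mu <= Ex p D f -> #|A|%:R <= N -> 0 <= t <= 2 * N ->
  Ex p D (fun E => (f E <= mu - t)%R%:R) <= expR (- (t ^+ 2 / (8 * N))).
Proof.
move=> AD fA lip muf AN /andP[t0 tN].
rewrite (Ex_restrict p AD fA) in muf.
rewrite (Ex_restrict p AD) => [|E]; last by rewrite fA.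
(* For [N = 0] the inverse of 0 is 0, so the claimed bound is 1. *)
have := le_trans (ler0n R _) AN; rewrite le_eqVlt => /orP[/eqP <-|N0].
  rewrite mulr0 invr0 mulr0 oppr0 expR0 -[X in _ <= X](Ex_cst p A).
  by apply: Ex_le => // E _; rewrite lern1 leq_b1.
pose l := t / (4 * N).
have l0 : 0 <= l by rewrite divr_ge0 // mulr_ge0 // ltW.
have l2 : l <= 2^-1.
  by rewrite /l ler_pdivrMr ?mulr_gt0 //; lra.
apply: le_trans (_ : Ex p A (fun E => expR (- (l * t)) * expR (l * (Ex p A f - f E))) <= _).
  apply: Ex_le => // E _; rewrite -expRD; case: (boolP (f E <= _)) => h; last exact: expR_ge0.
  rewrite -[X in X <= _]expR0 ler_expR addrC -mulrN -mulrDr; apply: mulr_ge0 => //.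
  by lra.
rewrite ExZ; apply: le_trans (ler_wpM2l (expR_ge0 _) (Ex_mgf _ lip)) _; first by rewrite l0.
rewrite -expRD ler_expR.
have -> : - (t ^+ 2 / (8 * N)) = - (l * t) + 2 * l ^+ 2 * N.
  by rewrite /l; field; rewrite gt_eqF.
by rewrite lerD2l; apply: ler_wpM2l => //; rewrite mulr_ge0 // sqr_ge0.
Qed.

End Concentration.

(** * Properties of the random graph *)

Lemma card_pairs_ge n : n * n <= 2 * #|pairs n| + n.
Proof.
pose sw (e : 'I_n * 'I_n) := (e.2, e.1).
have sub : [set: 'I_n * 'I_n] \subset pairs n :|: sw @: pairs n :|: [set (x, x) | x in 'I_n].
  apply/subsetP => -[x y] _; rewrite !in_setU; case: (ltngtP x y) => xy.
  - by rewrite [_ \in pairs n]inE xy.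
  - have -> : (x, y) \in sw @: pairs n by apply/imsetP; exists (y, x); rewrite // inE.
    by rewrite orbT.
  - have -> : (x, y) \in [set (x, x) | x in 'I_n]; last by rewrite !orbT.
    by apply/imsetP; exists x; rewrite // (val_inj xy).
have := subset_leq_card sub; rewrite cardsT card_prod card_ord => /leq_trans; apply.
apply: leq_trans (leq_card_setU _ _) _; apply: leq_add; last first.
  by apply: leq_trans (leq_imset_card _ _) _; rewrite card_ord.
apply: leq_trans (leq_card_setU _ _) _; rewrite mul2n -addnn leq_add2l.
exact: leq_imset_card.
Qed.

Section FirstMoment.
Local Open Scope ring_scope.
Variables (R : realType) (p : R) (n s : nat).
Hypothesis p01 : 0 <= p <= 1.

(** A set with its map [f] is encoded by an enumeration and the map induced on indices, so that a
    union bound over [n ^ s * s ^ s] pairs applies. *)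
Definition big_forest (G : {set 'I_n * 'I_n}) := [exists gh : {ffun 'I_s -> 'I_n} * {ffun 'I_s -> 'I_s},
  injectiveb gh.1 && [forall i, forall j, adj G (gh.1 i) (gh.1 j) ==> (j == gh.2 i) || (i == gh.2 j)]].

Lemma no_big_forest G : ~~ big_forest G -> forall (S : {set 'I_n}) (f : 'I_n -> 'I_n),
  {in S &, forall x y, adj G x y -> y = f x \/ x = f y} -> (#|S| < s)%N.
Proof.
move=> nb S f Sf; rewrite ltnNge; apply/negP => sS; case/negP: nb.
pose g (i : 'I_s) := enum_val (widen_ord sS i).
have gS i : g i \in S by apply: enum_valP.
have gi : injective g by move=> i j /enum_val_inj /(congr1 val) /= /val_inj.
(* If [f (g i)] is not of the form [g j], any value of [h i] serves. *)
pose h i := odflt i [pick j | g j == f (g i)].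
apply/existsP; exists ([ffun i => g i], [ffun i => h i]); apply/andP; split.
  by apply/injectiveP => i j; rewrite !ffunE; apply: gi.
have hP i j : g j = f (g i) -> j = h i.
  move=> gj; rewrite /h; case: pickP => [k /eqP gk|/(_ j)] /=; last by rewrite gj eqxx.
  by apply: gi; rewrite gk.
apply/forallP => i; apply/forallP => j; apply/implyP; rewrite !ffunE /= => ij.
by have [/hP->|/hP->] := Sf _ _ (gS i) (gS j) ij; rewrite eqxx ?orbT.
Qed.

(** For a fixed choice, all pairs of indices other than [{i, h i}] must be non-edges; at least
    [s * (s - 1) / 2 - s] pairs are of this kind, hence [3 * s]. *)
Lemma Ex_big_forest e : (2 * e + 3 * s <= s * s)%N ->
  Ex p (pairs n) (fun G => (big_forest G)%:R) <= (n ^ s * s ^ s)%N%:R * (1 - p) ^+ e.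
Proof.
move=> es.
pose P : pred ({ffun 'I_s -> 'I_n} * {ffun 'I_s -> 'I_s}) := fun gh => injectiveb gh.1.
have cU : (#|P| <= n ^ s * s ^ s)%N.
  by apply: leq_trans (max_card _) _; rewrite card_prod !card_ffun !card_ord.
have /andP[p0 p1] := p01.
have q0 : 0 <= (1 - p) ^+ e by apply: exprn_ge0; lra.
apply: le_trans (_ : (1 - p) ^+ e *+ #|P| <= _); last first.
  by rewrite mulr_natl; apply: ler_wpMn2l.
apply: (Ex_union p01 (P := P) (b := fun gh G => [forall i, forall j,
    adj G (gh.1 i) (gh.1 j) ==> (j == gh.2 i) || (i == gh.2 j)])) => //.
  by move=> G _ /existsP[gh /andP[gi b]]; exists gh.
move=> [g h] /injectiveP /= gi.
pose I := pairs s :\: [set epair i (h i) | i in 'I_s].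
pose A := [set epair (g ij.1) (g ij.2) | ij in I].
have AP : A \subset pairs n.
  apply/subsetP => x /imsetP[[i j] ijI ->] {x}; move: ijI; rewrite in_setD inE /= => /andP[_ ij].
  by rewrite mem_pairs_epair (inj_eq gi); apply: contraTneq ij => ->; rewrite ltnn.
have cA : #|A| = #|I|.
  apply: card_in_imset => -[i j] [i' j']; rewrite !in_setD !inE /= => /andP[_ ij] /andP[_ ij'].
  move=> /epair_inj[[/gi-> /gi->]//|[/gi E1 /gi E2]].
  by move: ij ij'; rewrite E1 E2 => /ltn_trans h1 /h1; rewrite ltnn.
have cI : (e <= #|I|)%N.
  have := card_pairs_ge s; have : (#|pairs s| <= #|I| + s)%N.
    rewrite -(cardsID [set epair i (h i) | i in 'I_s] (pairs s)) addnC leq_add2l.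
    apply: leq_trans (subset_leq_card (subsetIr _ _)) _.
    by apply: leq_trans (leq_imset_card _ _) _; rewrite card_ord.
  by move: es; clear; lia.
apply: le_trans (_ : (1 - p) ^+ #|A| <= _); last first.
  by rewrite cA; apply: ler_wiXn2l => //; lra.
rewrite -(Ex_disjoint p AP); apply: Ex_le => // E _; rewrite ler_nat.
case: (boolP [forall i, _]) => // /forallP b; rewrite lt0b.
rewrite disjoint_subset; apply/subsetP => x /imsetP[[i j] ijI ->] {x}; move: ijI; rewrite in_setD inE /= => /andP[nh ij].
rewrite inE; apply/negP => eE; case/negP: nh.
have : adj E (g i) (g j).
  by move: eE; rewrite /adj /epair; case: ifP => _ ->; rewrite ?orbT.
move/forallP/(_ j): (b i) => /implyP h1 /h1 /orP[/eqP E1|/eqP E1].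
  by apply/imsetP; exists i => //; rewrite -E1 /epair ij.
by apply/imsetP; exists j => //; rewrite epairC -E1 /epair ij.
Qed.

End FirstMoment.

(** * Lower tails for counts of disjoint patterns *)

Section DisjointPatterns.
Local Open Scope ring_scope.
Variables (R : realType) (T J : finType) (p : R) (D : {set T}) (I : {set J}) (F : J -> {set T}).
Variable c : nat.
Hypothesis p01 : 0 <= p <= 1.
Hypothesis c0 : (0 < c)%N.
Hypothesis FD : {in I, forall i, F i \subset D}.
Hypothesis Fc : {in I, forall i, #|F i| <= c}%N.
Hypothesis Fdis : {in I &, forall i j e, e \in F i -> e \in F j -> i = j}.

Definition hits (E : {set T}) := #|[set i in I | F i \subset E]|.

(** Patterns are disjoint, so a new element completes at most one of them. *)
Lemma hits_lip e E : `|(hits (e |: E))%:R - (hits E)%:R| <= 1 :> R.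
Proof.
have sub : [set i in I | F i \subset E] \subset [set i in I | F i \subset e |: E].
  apply/subsetP => i; rewrite !in_set => /andP[-> FE] /=.
  exact: subset_trans FE (subsetUr _ _).
have le1 : (hits (e |: E) <= (hits E).+1)%N.
  rewrite /hits; set X := [set i in I | F i \subset E]; set Y := [set i in I | _].
  have Y1 : (#|Y :\: X| <= 1)%N.
    apply/card_le1_eqP => i j; rewrite ![_ \in Y :\: X]in_setD ![_ \in X]in_set ![_ \in Y]in_set.
    have eF k : (k \in I) && (F k \subset e |: E) -> ~~ ((k \in I) && (F k \subset E)) -> e \in F k.
      move=> /andP[-> sU] /= /subsetPn[x xF xE]; have := subsetP sU x xF.
      by rewrite in_setU1 (negbTE xE) orbF => /eqP <-.
    move=> /andP[nX iY] /andP[nX' jY].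
    have ei := eF _ iY nX; have ej := eF _ jY nX'.
    have [iI _] := andP iY; have [jI _] := andP jY.
    exact: Fdis ej ei.
  have := cardsID X Y; rewrite (setIidPr sub) => <-.
  by rewrite -addn1 leq_add2l.
have le0 : (hits E <= hits (e |: E))%N by apply: subset_leq_card.
rewrite ger0_norm; last by rewrite subr_ge0 ler_nat.
by rewrite lerBlDr -[1]/(1%:R) -natrD ler_nat add1n.
Qed.

Lemma Ex_hits : p ^+ c * #|I|%:R <= Ex p D (fun E => (hits E)%:R).
Proof.
have /andP[p0 p1] := p01.
rewrite (eq_Ex p (g := fun E => \sum_(i in I) (F i \subset E)%:R)); last first.
  move=> E _; rewrite /hits -sum1_card natr_sum [RHS](bigID (fun i => F i \subset E)) /=.
  rewrite [X in _ + X]big1 ?addr0; last by move=> i /andP[_ /negbTE->].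
  by apply: eq_big => [i|i]; rewrite in_set // => /andP[_ ->].
rewrite Ex_sum mulr_natr -sumr_const; apply: ler_sum => i iI.
rewrite Ex_subset; last exact: FD.
by apply: ler_wiXn2l => //; exact: Fc.
Qed.

(** The deviation is half of the bound on the mean, and at most [c * #|I|] elements matter;
    [t ^+ 2 / (8 * N)] then becomes the stated exponent. *)
Lemma Ex_hits_tail : Ex p D (fun E => ((hits E)%:R <= p ^+ c * #|I|%:R / 2)%R%:R) <=
  expR (- (p ^+ (2 * c) / (32 * c%:R) * #|I|%:R)).
Proof.
have /andP[p0 p1] := p01.
pose A := \bigcup_(i in I) F i.
have AD : A \subset D by apply/bigcupsP => i iI; apply: FD.
have cA : #|A|%:R <= (c%:R * #|I|%:R) :> R.
  rewrite -natrM ler_nat mulnC; apply: leq_trans (_ : (\sum_(i in I) #|F i| <= _)%N).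
    rewrite /A; elim/big_rec2: _ => [|i k U _ IH]; first by rewrite cards0.
    by apply: leq_trans (leq_card_setU _ _) _; rewrite leq_add2l.
  by rewrite -sum_nat_const; apply: leq_sum => i iI; apply: Fc.
have c1 : 1 <= c%:R :> R by rewrite ler1n.
have pc0 : 0 <= p ^+ c by apply: exprn_ge0.
have pc1 : p ^+ c <= 1 by apply: exprn_ile1.
have I0 : 0 <= #|I|%:R :> R by [].
have fA E : (hits E)%:R = (hits (E :&: A))%:R :> R.
  congr (_%:R); apply: eq_card => i; rewrite !in_set; apply: andb_id2l => iI.
  by rewrite subsetI [F i \subset A]bigcup_sup // andbT.
have t0 : 0 <= p ^+ c * #|I|%:R / 2 <= 2 * (c%:R * #|I|%:R).
  rewrite divr_ge0 ?mulr_ge0 //=; have : p ^+ c * #|I|%:R <= c%:R * #|I|%:R.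
    by apply: ler_wpM2r => //; lra.
  have : 0 <= c%:R * #|I|%:R :> R by apply: mulr_ge0; lra.
  lra.
have := Ex_lower_tail p01 AD fA (fun e E _ => hits_lip e E) Ex_hits cA t0.
have -> : p ^+ c * #|I|%:R - p ^+ c * #|I|%:R / 2 = p ^+ c * #|I|%:R / 2 by field.
move/le_trans; apply; rewrite ler_expR lerN2.
have [->|N0] := eqVneq (#|I|%:R : R) 0; first by rewrite !mulr0 mul0r !expr0n /= mul0r.
rewrite le_eqVlt; apply/orP; left; apply/eqP; rewrite mulnC exprM.
by field; rewrite N0 gt_eqF //=; lra.
Qed.

End DisjointPatterns.

Section NeighbourCounts.
Local Open Scope ring_scope.
Variables (R : realType) (p : R) (n m : nat).
Hypothesis p01 : 0 <= p <= 1.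
Hypothesis m0 : (0 < m)%N.

(** The pattern of [v] is its star to the vertices [t i]. Leaving out the at most [m] vertices that
    occur among the [t i] makes these stars edge-disjoint. *)
Lemma Ex_few_common (B : {set 'I_n}) (t : 'I_m -> 'I_n) y : (m <= #|B|)%N ->
  y%:R <= p ^+ m * (#|B| - m)%:R / 2 ->
  Ex p (pairs n) (fun G => (#|[set v in B | [forall i, adj G v (t i)]]| < y)%N%:R) <=
  expR (- (p ^+ (2 * m) / (32 * m%:R) * (#|B| - m)%:R)).
Proof.
move=> mB yB; have /andP[p0 p1] := p01.
pose C := [set t i | i in 'I_m]; pose I := B :\: C.
pose F v := [set epair v (t i) | i in 'I_m].
have cI : (#|B| - m <= #|I|)%N.
  rewrite leq_subLR -(cardsID C B) leq_add2r; apply: leq_trans (subset_leq_card (subsetIr _ _)) _.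
  by apply: leq_trans (leq_imset_card _ _) _; rewrite card_ord.
have IC v i : v \in I -> v != t i.
  by rewrite in_setD => /andP[vC _]; apply: contraNneq vC => ->; apply: imset_f.
have FD : {in I, forall v, F v \subset pairs n}.
  by move=> v vI; apply/subsetP => x /imsetP[i _ ->]; rewrite mem_pairs_epair IC.
have Fc : {in I, forall v, #|F v| <= m}%N.
  by move=> v _; apply: leq_trans (leq_imset_card _ _) _; rewrite card_ord.
have Fdis : {in I &, forall v w e, e \in F v -> e \in F w -> v = w}.
  move=> v w vI wI e /imsetP[i _ ->] /imsetP[j _ /epair_inj[[]//|[E _]]].
  by have := IC v j vI; rewrite E eqxx.
have cIR : (#|B| - m)%:R <= #|I|%:R :> R by rewrite ler_nat.
apply: le_trans (_ : expR (- (p ^+ (2 * m) / (32 * m%:R) * #|I|%:R)) <= _); last first.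
  rewrite ler_expR lerN2; apply: ler_wpM2l => //.
  by rewrite divr_ge0 ?exprn_ge0 // mulr_ge0.
apply: le_trans (Ex_hits_tail p01 m0 FD Fc Fdis); apply: Ex_le => // G sG.
rewrite ler_nat; case: ltnP => // h; rewrite lt0b.
have hy : (hits I F G <= y)%N.
  apply: leq_trans (ltnW h); apply: subset_leq_card; apply/subsetP => v.
  rewrite !in_set => /andP[/andP[_ ->] FG] /=; apply/forallP => i.
  by rewrite adjE //; apply: (subsetP FG); apply: imset_f.
apply: le_trans (_ : y%:R <= _); first by rewrite ler_nat.
apply: le_trans yB _; apply: ler_wpM2r; first by lra.
by apply: ler_wpM2l => //; exact: exprn_ge0.
Qed.

(** The patterns are single pairs between [S] and [U]. If all degrees into [U] were below [u1], at
    most half of the expected number of edges would be present. *)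
Lemma Ex_sparse_pair (S U : {set 'I_n}) u1 : [disjoint S & U] -> u1%:R <= p * #|U|%:R / 2 ->
  Ex p (pairs n) (fun G => [forall w in S, (#|[set x in U | adj G w x]| < u1)%N]%:R) <=
  expR (- (p ^+ 2 / 32 * (#|S| * #|U|)%N%:R)).
Proof.
move=> dis u1U; have /andP[p0 p1] := p01.
pose I := setX S U; pose F (wx : 'I_n * 'I_n) := [set epair wx.1 wx.2].
have SU w : w \in S -> w \notin U.
  by move: dis; rewrite disjoint_subset => /subsetP h /h.
have FD : {in I, forall v, F v \subset pairs n}.
  move=> [w x]; rewrite in_setX /= => /andP[/SU wU xU].
  by rewrite sub1set mem_pairs_epair /=; apply: contraNneq wU => ->.
have Fc : {in I, forall v, #|F v| <= 1}%N by move=> v _; rewrite cards1.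
have Fdis : {in I &, forall v w e, e \in F v -> e \in F w -> v = w}.
  move=> [w x] [w' x']; rewrite !in_setX /= => /andP[wS xU] /andP[w'S x'U] e.
  rewrite !in_set1 => /eqP-> /eqP/epair_inj[[E1 E2]|[E _]].
    by rewrite /= in E1 E2; rewrite E1 E2.
  by have := SU _ wS; rewrite /= in E; rewrite E x'U.
have := Ex_hits_tail p01 (ltn0Sn 0) FD Fc Fdis.
rewrite muln1 mulr1 cardsX expr1; apply: le_trans; apply: Ex_le => // G sG.
rewrite ler_nat; case: (boolP [forall w in S, _]) => // /forall_inP h; rewrite lt0b.
have hy : (hits I F G <= #|S| * u1)%N.
  have -> : hits I F G = \sum_(w in S) #|[set x in U | adj G w x]|.
    rewrite /hits -sum1_card.
    rewrite (partition_big (fun wx : 'I_n * 'I_n => wx.1) [in S]) /=; last first.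
      by move=> [w x]; rewrite in_set in_setX => /andP[/andP[]].
    apply: eq_bigr => w wS; rewrite -sum1_card.
    rewrite (reindex_onto (fun x => (w, x)) snd) /=; last by move=> [a b] /= /andP[_ /eqP<-].
    by apply: eq_bigl => x; rewrite !eqxx !andbT !in_set /= wS sub1set adjE.
  rewrite -sum_nat_const; apply: leq_sum => w wS; exact: ltnW (h w wS).
apply: le_trans (_ : (#|S| * u1)%N%:R <= _); first by rewrite ler_nat.
rewrite !natrM mulrCA -mulrA; apply: ler_wpM2l => //.
Qed.

End NeighbourCounts.

(** * Large independent sets *)

Section PairsIn.
Variable n : nat.
Implicit Types A B : {set 'I_n}.

Definition pairs_in A : {set 'I_n * 'I_n} := [set e in pairs n | (e.1 \in A) && (e.2 \in A)].

Lemma pairs_inS A B : A \subset B -> pairs_in A \subset pairs_in B.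
Proof.
move=> /subsetP sAB; apply/subsetP => e; rewrite !in_set => /and3P[-> e1 e2].
by rewrite !sAB.
Qed.

Lemma pairs_inI A B : pairs_in A :&: pairs_in B = pairs_in (A :&: B).
Proof.
apply/setP => e; rewrite in_setI !in_set.
by case: (e.1 < e.2) (e.1 \in A) (e.2 \in A) (e.1 \in B) (e.2 \in B) => [] [] [] [] [].
Qed.

Lemma card_pairs_in A : #|pairs_in A| = 'C(#|A|, 2).
Proof.
rewrite -cards_draws; pose h (e : 'I_n * 'I_n) := [set e.1; e.2].
have hi : {in pairs_in A &, injective h}.
  move=> [a b] [a' b']; rewrite !in_set /= => /andP[ab _] /andP[ab' _] /setP E.
  move: (E a) (E b); rewrite !in_set2 !eqxx !orbT /=.
  move=> /esym/orP[]/eqP ea /esym/orP[]/eqP eb; move: ab ab'; rewrite ea eb ?ltnn //.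
  by move=> /ltn_trans h1 /h1; rewrite ltnn.
rewrite -(card_in_imset hi); apply: eq_card => B; rewrite in_set.
apply/imsetP/andP => [[[a b]]|[BA /cards2P[a [b [ab EB]]]]].
  rewrite !in_set /= => /and3P[ab aA bA] ->; split.
    by rewrite /h subUset !sub1set aA bA.
  have ne : a != b by apply: contraTneq ab => ->; rewrite ltnn.
  by rewrite /h cards2 /= ne.
rewrite EB subUset !sub1set in BA; case/andP: BA => aA bA.
exists (epair a b); last by rewrite EB /h /epair; case: ifP => //= _; rewrite setUC.
rewrite in_set mem_pairs_epair ab /epair.
by case: ifP => /= _; rewrite aA bA.
Qed.

End PairsIn.

(** Each induction step multiplies the ratio of the binomials by [(k - j) / (u - j)], which is at
    most [k / u]. *)
Lemma bin_shift_le u k j : j <= k -> k <= u -> 'C(u - j, k - j) * u ^ j <= 'C(u, k) * k ^ j.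
Proof.
move=> jk ku; elim: j jk => [|j IH] jk; first by rewrite !subn0 !expn0.
have := IH (ltnW jk); set C := 'C(u - j, k - j) => IHj.
have Cs : (u - j) * 'C(u - j.+1, k - j.+1) = (k - j) * C.
  rewrite /C !subnS; case E : (u - j) => [|v]; first by move: E; lia.
  case F : (k - j) => [|l]; first by move: F; lia.
  by rewrite /= mul_bin_diag.
have uj : 0 < u - j by lia.
rewrite -(leq_pmul2l uj) mulnA Cs expnS.
have le1 : (k - j) * u <= (u - j) * k.
  by rewrite !mulnBl leq_sub // ?[u * k]mulnC // leq_mul2l ku orbT.
apply: leq_trans (_ : (u - j) * k * (C * u ^ j) <= _).
  by rewrite mulnACA; apply: leq_mul.
rewrite -mulnA leq_mul2l; apply/orP; right.
by rewrite expnS [X in _ <= X]mulnCA leq_mul2l; apply/orP; right.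
Qed.

Section CountSubsets.
Variables (n u k : nat) (U : {set 'I_n}).
Hypothesis cU : #|U| = u.
Hypothesis ku : k <= u.

Definition ksubsets : {set {set 'I_n}} := [set A : {set 'I_n} | A \subset U & #|A| == k].

Lemma card_ksubsets : #|ksubsets| = 'C(u, k).
Proof. by rewrite cards_draws cU. Qed.

(** The intersection is one of at most [k ^ j] subsets of [A], and a given [j]-set lies in at most a
    fraction [(k / u) ^ j] of the [k]-subsets of [U]. *)
Lemma card_ksubsets_meet (A : {set 'I_n}) j : A \in ksubsets -> j <= k ->
  #|[set B in ksubsets | #|A :&: B| == j]| * u ^ j <= #|ksubsets| * (k ^ 2) ^ j.
Proof.
rewrite in_set => /andP[AU /eqP Ak] jk.
pose P (J : {set 'I_n}) := [set B in ksubsets | J \subset B].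
pose Js := [set J : {set 'I_n} | J \subset A & #|J| == j].
have cP J : J \in Js -> #|P J| <= 'C(u - j, k - j).
  rewrite in_set => /andP[JA /eqP Jj].
  have JU : J \subset U by apply: subset_trans AU.
  have <- : #|U :\: J| = u - j by rewrite cardsD (setIidPr JU) cU Jj.
  rewrite -cards_draws -[X in X <= _](card_in_imset (f := fun B => B :\: J)); last first.
    move=> B B'; rewrite !in_set => /andP[_ JB] /andP[_ JB'] E.
    by rewrite -(setID B J) -(setID B' J) (setIidPr JB) (setIidPr JB') E.
  apply: subset_leq_card; apply/subsetP => C /imsetP[B]; rewrite !in_set.
  move=> /andP[/andP[BU /eqP Bk] JB] ->; rewrite setSD //=.
  by rewrite cardsD (setIidPr JB) Bk Jj.
have sub : [set B in ksubsets | #|A :&: B| == j] \subset \bigcup_(J in Js) P J.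
  apply/subsetP => B; rewrite in_set => /andP[BK cAB]; apply/bigcupP; exists (A :&: B).
    by rewrite in_set subsetIl.
  by rewrite in_set BK subsetIr.
have cJ : #|Js| <= k ^ j.
  rewrite cards_draws Ak; apply: leq_trans (_ : k ^_ j <= _).
    by rewrite -bin_ffact leq_pmulr ?fact_gt0.
  elim: (j) => // i IH; rewrite ffactnSr expnSr; apply: leq_mul => //; exact: leq_subr.
have cB : #|[set B in ksubsets | #|A :&: B| == j]| <= k ^ j * 'C(u - j, k - j).
  apply: leq_trans (subset_leq_card sub) _.
  apply: leq_trans (_ : \sum_(J in Js) #|P J| <= _).
    elim/big_rec2: _ => [|J i V _ IH]; first by rewrite cards0.
    by apply: leq_trans (leq_card_setU _ _) _; rewrite leq_add2l.
  apply: leq_trans (_ : \sum_(J in Js) 'C(u - j, k - j) <= _); first exact: leq_sum.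
  by rewrite sum_nat_const; apply: leq_mul.
apply: leq_trans (leq_mul cB (leqnn _)) _.
rewrite -mulnA; apply: leq_trans (leq_mul (leqnn _) (bin_shift_le jk ku)) _.
by rewrite card_ksubsets mulnCA -expnD -expnM mul2n addnn.
Qed.

End CountSubsets.

Section Packing.
Variables (n k : nat) (U : {set 'I_n}).
Implicit Types (A B : {set 'I_n}) (F : {set {set 'I_n}}) (E : {set 'I_n * 'I_n}).
Local Notation K := (ksubsets k U).

Definition indep_in E A := [disjoint pairs_in A & E].
Definition conflict A B := ~~ [disjoint pairs_in A & pairs_in B].

Definition packing E F := [&& F \subset K, [forall A in F, indep_in E A] &
  [forall A in F, forall B in F, (A != B) ==> ~~ conflict A B]].

(** The plain number of independent sets would not concentrate, as one edge can destroy many of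
    them. Members of a packing share no pair of vertices, so one edge destroys at most one. *)
Definition max_packing E := \max_(F : {set {set 'I_n}} | packing E F) #|F|.

Lemma packingP E F : reflect
  [/\ F \subset K, {in F, forall A, indep_in E A} &
      {in F &, forall A B, A != B -> ~~ conflict A B}] (packing E F).
Proof.
apply: (iffP and3P) => [[FK /forall_inP FE FC]|[FK FE FC]]; split=> //.
- move=> A B AF BF ne; move/forall_inP/(_ A AF)/forall_inP/(_ B BF): FC.
  by rewrite ne.
- exact/forall_inP.
- by apply/forall_inP => A AF; apply/forall_inP => B BF; apply/implyP; apply: FC.
Qed.

Lemma packing_le E F : packing E F -> #|F| <= max_packing E.
Proof. by move=> pF; apply: leq_bigmax_cond. Qed.

Lemma packing_max E : exists2 F, packing E F & max_packing E = #|F|.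
Proof.
have P0 : 0 < #|[pred F | packing E F]|.
  apply/card_gt0P; exists set0; rewrite inE; apply/packingP; split; rewrite ?sub0set //.
  - by move=> A; rewrite in_set0.
  - by move=> A B; rewrite in_set0.
have [F pF maxE] := eq_bigmax_cond (fun F : {set {set 'I_n}} => #|F|) P0.
by exists F => //; rewrite -maxE; apply: eq_bigl => F'; rewrite inE.
Qed.

Lemma indep_in_sub E E' A : E \subset E' -> indep_in E' A -> indep_in E A.
Proof. by move=> sE; apply: disjointWr. Qed.

Lemma max_packing_anti e E : max_packing (e |: E) <= max_packing E.
Proof.
have [F /packingP[FK FE FC] ->] := packing_max (e |: E).
apply: packing_le; apply/packingP; split=> // A AF.
exact: indep_in_sub (subsetUr _ _) (FE A AF).
Qed.

Lemma max_packing_lip e E : max_packing E <= (max_packing (e |: E)).+1.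
Proof.
have [F /packingP[FK FE FC] ->] := packing_max E.
pose F' := [set A in F | e \notin pairs_in A].
have F'p : packing (e |: E) F'.
  apply/packingP; split.
  - by apply: subset_trans FK; apply/subsetP => A; rewrite in_set => /andP[].
  - move=> A; rewrite in_set => /andP[AF eA]; rewrite /indep_in disjoints_subset.
    apply/subsetP => x xA; rewrite in_setC in_setU1 negb_or (disjointFr (FE A AF)) // andbT.
    by apply: contraNneq eA => <-.
  - by move=> A B; rewrite !in_set => /andP[AF _] /andP[BF _]; apply: FC.
apply: leq_trans (_ : #|F'|.+1 <= _); last by rewrite ltnS packing_le.
have D1 : #|F :\: F'| <= 1.
  apply/card_le1_eqP => A B; rewrite !in_setD ![_ \in F']in_set => /andP[nA AF] /andP[nB BF].
  rewrite AF /= negbK in nA; rewrite BF /= negbK in nB.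
  apply/eqP; apply/negPn/negP => ne; have := FC B A BF AF ne; rewrite /conflict negbK.
  by rewrite -setI_eq0 => /eqP/setP/(_ e); rewrite in_setI nA nB in_set0.
rewrite -(cardsID F' F) (setIidPr _); last by apply/subsetP => A; rewrite in_set => /andP[].
by rewrite -addn1 leq_add2l.
Qed.

(** Because of this, only the pairs inside [U] enter the concentration bound. *)
Lemma max_packing_restrict E : max_packing E = max_packing (E :&: pairs_in U).
Proof.
apply: eq_bigl => F; apply/packingP/packingP => -[FK FE FC]; split=> // A AF.
  exact: indep_in_sub (subsetIl _ _) (FE A AF).
have AU : A \subset U by have := subsetP FK A AF; rewrite in_set => /andP[].
have := FE A AF; rewrite /indep_in -!setI_eq0 setIA setIAC.
by rewrite (setIidPl (pairs_inS AU)).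
Qed.

Lemma max_packing_gt0 E : E \subset pairs n -> 0 < max_packing E ->
  exists A, [/\ A \subset U, #|A| = k & {in A &, forall x y, ~~ adj E x y}].
Proof.
move=> sE; have [F /packingP[FK FE FC] ->] := packing_max E => /card_gt0P[A AF].
exists A; have := subsetP FK A AF; rewrite in_set => /andP[AU /eqP Ak]; split=> //.
move=> x y xA yA; rewrite adjE //; apply/negP => xyE.
have := FE A AF; rewrite /indep_in -setI_eq0 => /eqP/setP/(_ (epair x y)).
rewrite in_setI xyE in_set0 andbT in_set (subsetP sE _ xyE) /=.
by rewrite /epair; case: ifP => /= _; rewrite xA yA.
Qed.

Definition indep_family E := [set A in K | indep_in E A].

Definition conflicts E := [set AB : {set 'I_n} * {set 'I_n} |
  [&& AB.1 \in indep_family E, AB.2 \in indep_family E, AB.1 != AB.2 & conflict AB.1 AB.2]].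

(** Deleting the first member of every conflicting pair inside [F] leaves a packing. *)
Lemma max_packing_delete E F : F \subset indep_family E ->
  #|F| <= max_packing E + #|[set AB in conflicts E | [set AB.1; AB.2] \subset F]|.
Proof.
move=> FK; set C := [set AB in conflicts E | _]; pose F' := F :\: [set AB.1 | AB in C].
have FP A : A \in F -> A \in K /\ indep_in E A.
  by move/(subsetP FK); rewrite in_set => /andP[].
have : packing E F'.
  apply/packingP; split.
  - by apply/subsetP => A; rewrite in_setD => /andP[_ /FP[]].
  - by move=> A; rewrite in_setD => /andP[_ /FP[]].
  - move=> A B; rewrite !in_setD => /andP[nA AF] /andP[_ BF] ne; apply: contra nA => cAB.
    apply/imsetP; exists (A, B) => //; rewrite in_set subUset !sub1set AF BF !andbT.
    by rewrite in_set /= ne cAB !(subsetP FK).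
move/packing_le => le; rewrite -(cardsID [set AB.1 | AB in C] F) addnC; apply: leq_add => //.
by apply: leq_trans (subset_leq_card (subsetIr _ _)) _; apply: leq_imset_card.
Qed.

End Packing.

Section LargeIndependent.
Local Open Scope ring_scope.
Variables (R : realType) (p : R) (n u k : nat) (U : {set 'I_n}).
Hypothesis p01 : 0 < p < 1.
Hypothesis cU : #|U| = u.
Hypothesis k2 : (1 < k)%N.
Hypothesis ku : (k <= u)%N.
Local Notation K := (ksubsets k U).
Local Notation q := (1 - p).
Local Notation c := 'C(k, 2).

Let p01' : 0 <= p <= 1. Proof. by have /andP[? ?] := p01; rewrite !ltW. Qed.
Let q0 : 0 < q. Proof. by have /andP[? ?] := p01; rewrite subr_gt0. Qed.
Let u0 : 0 < u%:R :> R. Proof. by rewrite ltr0n; apply: leq_trans ku; apply: ltnW. Qed.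

(* The conflict-free subfamily comes from keeping each independent set with probability [rho]. *)
Lemma max_packing_ge (rho : R) E : 0 <= rho <= 1 ->
  rho * #|indep_family k U E|%:R - rho ^+ 2 * #|conflicts k U E|%:R <= (max_packing k U E)%:R.
Proof.
move=> r01; set KE := indep_family k U E; set CE := conflicts k U E.
pose g (F : {set {set 'I_n}}) : R := #|F|%:R - #|[set AB in CE | [set AB.1; AB.2] \subset F]|%:R.
have gE : Ex rho KE g = rho * #|KE|%:R - rho ^+ 2 * #|CE|%:R.
  rewrite (eq_Ex rho (g := fun F => \sum_(A in KE) ([set A] \subset F)%:R +
     -1 * \sum_(AB in CE) ([set AB.1; AB.2] \subset F)%:R)); last first.
    move=> F FK; rewrite /g mulN1r; congr (_ - _).
      rewrite -sum1_card natr_sum [RHS](bigID (fun A => A \in F)) /= [X in _ + X]big1 ?addr0.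
        apply: eq_big => [A|A AF]; last by rewrite sub1set AF.
        by apply/idP/andP => [AF|[]//]; split=> //; apply: (subsetP FK).
      by move=> A /andP[_ /negbTE AF]; rewrite sub1set AF.
    rewrite -sum1_card natr_sum [RHS](bigID (fun AB => [set AB.1; AB.2] \subset F)) /=.
    rewrite [X in _ + X]big1 ?addr0 => [|AB /andP[_ /negbTE->]//].
    by apply: eq_big => [AB|AB]; rewrite in_set // => /andP[_ ->].
  rewrite ExD ExZ !Ex_sum mulN1r; congr (_ - _).
    rewrite (eq_bigr (fun _ => rho)) => [|A AK]; last by rewrite Ex_subset ?sub1set // cards1 expr1.
    by rewrite sumr_const mulr_natr.
  rewrite (eq_bigr (fun _ => rho ^+ 2)) => [|AB]; first by rewrite sumr_const mulr_natr.
  rewrite in_set => /and4P[A1 A2 ne _]; rewrite Ex_subset ?cards2 ?ne //.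
  by rewrite subUset !sub1set A1 A2.
have [|F FK] := @Ex_exists_ge _ _ rho r01 KE g (rho * #|KE|%:R - rho ^+ 2 * #|CE|%:R); first by rewrite gE.
move/le_trans; apply; rewrite /g lerBlDr -natrD ler_nat.
exact: max_packing_delete.
Qed.

Lemma Ex_indep_family : Ex p (pairs n) (fun E => #|indep_family k U E|%:R) = #|K|%:R * q ^+ c.
Proof.
rewrite (eq_Ex p (g := fun E => \sum_(A in K) [disjoint pairs_in A & E]%:R)); last first.
  move=> E _; rewrite -sum1_card natr_sum [RHS](bigID (fun A => indep_in E A)) /=.
  rewrite [X in _ + X]big1 ?addr0 => [|A /andP[_ /negbTE h]]; last by rewrite -/(indep_in E A) h.
  by apply: eq_big => [A|A]; rewrite in_set // => /andP[_]; rewrite /indep_in => ->.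
rewrite Ex_sum (eq_bigr (fun _ => q ^+ c)) => [|A]; first by rewrite sumr_const mulr_natl.
rewrite in_set => /andP[_ /eqP Ak]; rewrite Ex_disjoint ?card_pairs_in ?Ak //.
by apply/subsetP => e; rewrite in_set => /andP[].
Qed.

(** Bounds the expected number of ordered conflicting pairs divided by the square of the expected
    number of independent [k]-sets; the term [j] stands for pairs sharing [j] vertices. *)
Definition overlap_sum : R :=
  \sum_(2 <= j < k.+1) ((k ^ 2)%:R / u%:R) ^+ j / q ^+ 'C(j, 2).

Lemma card_meet_le A j : A \in K -> (j <= k)%N ->
  #|[set B in K | #|A :&: B| == j]|%:R <= #|K|%:R * ((k ^ 2)%:R / u%:R) ^+ j :> R.
Proof.
move=> AK jk; rewrite expr_div_n mulrA ler_pdivlMr ?exprn_gt0 //.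
by rewrite -!natrX -!natrM ler_nat; apply: (card_ksubsets_meet cU).
Qed.

(** Two [k]-sets sharing [j] vertices span [2 * c - 'C(j, 2)] pairs, all of which must be missing,
    and they conflict only if [2 <= j]. *)
Lemma Ex_conflicts : Ex p (pairs n) (fun E => #|conflicts k U E|%:R) <=
  (#|K|%:R * q ^+ c) ^+ 2 * overlap_sum.
Proof.
pose w j : R := q ^+ (2 * c - 'C(j, 2)).
have w0 j : 0 <= w j by apply/exprn_ge0/ltW.
have cK A : A \in K -> #|A| = k by rewrite in_set => /andP[_ /eqP].
apply: le_trans (_ : \sum_(A in K) \sum_(B in K | (1 < #|A :&: B|)%N) w #|A :&: B| <= _).
  rewrite pair_big_dep /=.
  apply: le_trans (_ : Ex p (pairs n) (fun E => \sum_(AB : {set 'I_n} * {set 'I_n} |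
     (AB.1 \in K) && ((AB.2 \in K) && (1 < #|AB.1 :&: AB.2|)%N))
     [disjoint pairs_in AB.1 :|: pairs_in AB.2 & E]%:R) <= _).
    apply: Ex_le => // E _; rewrite -sum1_card natr_sum.
    rewrite [X in _ <= X](bigID [in conflicts k U E]) /=.
    rewrite -[X in X <= _]addr0; apply: lerD; last by apply: sumr_ge0.
    rewrite [X in _ <= X](eq_bigl [in conflicts k U E]) => [|AB]; last first.
      apply: andb_idl; rewrite in_set => /and4P[]; rewrite !in_set -!andbA.
      move=> /and3P[-> -> _] /and3P[-> -> _] _ /=; rewrite /conflict -setI_eq0 pairs_inI -cards_eq0.
      by rewrite card_pairs_in -lt0n bin_gt0.
    apply: ler_sum => AB; rewrite in_set => /and4P[A1 A2 _ _].
    rewrite disjoints_subset subUset -!disjoints_subset.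
    by move: A1 A2; rewrite !in_set => /andP[_ iA] /andP[_ iB]; move: iA iB; rewrite /indep_in => -> ->.
  rewrite Ex_sum; apply: ler_sum => -[A B] /= /and3P[AK BK cAB].
  have sub A' : pairs_in A' \subset pairs n by apply/subsetP => e; rewrite in_set => /andP[].
  rewrite Ex_disjoint ?subUset ?sub // cardsU pairs_inI !card_pairs_in (cK A AK) (cK B BK).
  by rewrite addnn -mul2n.
apply: le_trans (_ : \sum_(A in K) (#|K|%:R * q ^+ (2 * c) * overlap_sum) <= _); last first.
  rewrite sumr_const -mulr_natl (_ : q ^+ (2 * c) = (q ^+ c) ^+ 2); last by rewrite mulnC exprM.
  by rewrite le_eqVlt; apply/orP; left; apply/eqP; ring.
apply: ler_sum => A AK.
apply: le_trans (_ : \sum_(B in K) \sum_(2 <= j < k.+1) w j * (#|A :&: B| == j)%:R <= _).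
  rewrite [X in _ <= X](bigID (fun B => (1 < #|A :&: B|)%N)) /= -[X in X <= _]addr0.
  apply: lerD; last by apply: sumr_ge0 => B _; apply: sumr_ge0 => j _; apply: mulr_ge0.
  apply: ler_sum => B /andP[BK cAB].
  have jk : #|A :&: B| \in index_iota 2 k.+1.
    by rewrite mem_index_iota cAB /= ltnS -(cK A AK) subset_leq_card // subsetIl.
  rewrite (bigD1_seq _ jk) ?iota_uniq //= eqxx mulr1 lerDl.
  by apply: sumr_ge0 => j _; apply: mulr_ge0.
rewrite exchange_big /= /overlap_sum mulr_sumr; apply: ler_sum_nat => j /andP[j2 jk].
rewrite -mulr_sumr -natr_sum.
have -> : (\sum_(B in K) (#|A :&: B| == j))%N = #|[set B in K | #|A :&: B| == j]|.
  rewrite -sum1_card [RHS](eq_bigl (fun B => (B \in K) && (#|A :&: B| == j))) => [|B]; last by rewrite in_set.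
  by rewrite big_mkcondr /=; apply: eq_bigr => B _; case: (_ == _).
apply: le_trans (ler_wpM2l (w0 j) (card_meet_le AK jk)) _.
have -> : w j = q ^+ (2 * c) / q ^+ 'C(j, 2).
  rewrite /w expfB_cond; first by [].
  rewrite gt_eqF // add0n; apply: leq_trans (leq_pmull _ _) => //.
  by rewrite leq_bin2l.
by rewrite le_eqVlt; apply/orP; left; apply/eqP; ring.
Qed.

(** The term [j = k] alone suffices. This makes the density [rho] chosen below at most 1. *)
Lemma overlap_sum_mul_ge1 : 1 <= overlap_sum * (#|K|%:R * q ^+ c).
Proof.
have K0 : (u ^ k <= #|K| * k ^ k)%N.
  by have := bin_shift_le (leqnn k) ku; rewrite subnn bin0 mul1n (card_ksubsets k cU).
apply: le_trans (_ : ((k ^ 2)%:R / u%:R) ^+ k / q ^+ c * (#|K|%:R * q ^+ c) <= _).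
  have -> : ((k ^ 2)%:R / u%:R) ^+ k / q ^+ c * (#|K|%:R * q ^+ c) =
      #|K|%:R * (k ^ k)%N%:R * (k ^ k)%N%:R / (u ^ k)%N%:R :> R.
    rewrite expr_div_n -!natrX -expnM mul2n -addnn expnD natrM.
    by field; rewrite natrX !expf_neq0 ?gt_eqF.
  rewrite ler_pdivlMr ?mul1r ?natrX ?exprn_gt0 // -!natrX -natrM.
  apply: le_trans (_ : (#|K| * k ^ k)%N%:R <= _); first by rewrite ler_nat.
  rewrite ler_peMr // ler1n expn_gt0; apply/orP; left; exact: ltnW.
apply: ler_wpM2r; first by rewrite mulr_ge0 // exprn_ge0 // ltW.
rewrite /overlap_sum big_nat_recr //= lerDr; apply: sumr_ge0 => j _.
by apply: divr_ge0; apply: exprn_ge0; [exact: divr_ge0 | exact: ltW].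
Qed.

(** The expression [rho * mu - rho ^+ 2 * mu ^+ 2 * g] is maximal at [rho = (2 * (g * mu))^-1], with
    value [(4 * g)^-1]. *)
Lemma Ex_max_packing : (4 * overlap_sum)^-1 <= Ex p (pairs n) (fun E => (max_packing k U E)%:R).
Proof.
set g := overlap_sum; set mu := #|K|%:R * q ^+ c.
have gm : 1 <= g * mu := overlap_sum_mul_ge1.
have mu0 : 0 <= mu by rewrite mulr_ge0 // exprn_ge0 // ltW.
have gne : g * mu != 0 by rewrite gt_eqF //; lra.
have [gn0 mn0] : g != 0 /\ mu != 0 by move: gne; rewrite mulf_eq0 negb_or => /andP.
have mup : 0 < mu by rewrite lt_def mn0.
have gp : 0 < g by rewrite -(pmulr_lgt0 _ mup); lra.
pose rho := (2 * (g * mu))^-1.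
have r01 : 0 <= rho <= 1.
  rewrite /rho invr_ge0 invf_le1; first by apply/andP; split; lra.
  by lra.
apply: le_trans (_ : rho * mu - rho ^+ 2 * (mu ^+ 2 * g) <= _).
  rewrite le_eqVlt; apply/orP; left; apply/eqP; rewrite /rho; field.
  by rewrite gn0 mn0.
apply: le_trans (_ : Ex p (pairs n) (fun E => rho * #|indep_family k U E|%:R +
   - rho ^+ 2 * #|conflicts k U E|%:R) <= _).
  rewrite ExD !ExZ Ex_indep_family lerD2l mulNr lerN2; apply: ler_wpM2l; first exact: sqr_ge0.
  exact: Ex_conflicts.
by apply: Ex_le => // E _; rewrite mulNr; apply: max_packing_ge.
Qed.

(** The second hypothesis puts the mean at [t] or above, so an empty maximum packing is a deviation
    by [t]. *)
Lemma Ex_no_indep (t : R) : 0 <= t <= 2 * u%:R ^+ 2 -> 4 * overlap_sum * t <= 1 ->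
  Ex p (pairs n) (fun E => (max_packing k U E == 0)%N%:R) <= expR (- (t ^+ 2 / (8 * u%:R ^+ 2))).
Proof.
move=> t0 gt.
have g0 : 0 < overlap_sum.
  have := overlap_sum_mul_ge1; set mu := _ * q ^+ c => h.
  have mu0 : 0 <= mu by rewrite mulr_ge0 // exprn_ge0 // ltW.
  have mn0 : mu != 0 by apply: contraTneq h => ->; rewrite mulr0 -ltNge.
  by rewrite -(pmulr_lgt0 _ (_ : 0 < mu)) ?lt_def ?mn0 //; lra.
have sU : pairs_in U \subset pairs n by apply/subsetP => e; rewrite in_set => /andP[].
have fU E : (max_packing k U E)%:R = (max_packing k U (E :&: pairs_in U))%:R :> R.
  by rewrite -max_packing_restrict.
have lip e E : e \in pairs_in U -> `|(max_packing k U (e |: E))%:R - (max_packing k U E)%:R| <= 1 :> R.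
  move=> _; have h1 : (max_packing k U (e |: E))%:R <= (max_packing k U E)%:R :> R.
    by rewrite ler_nat max_packing_anti.
  have h2 : (max_packing k U E)%:R <= (max_packing k U (e |: E))%:R + 1 :> R.
    by rewrite natr1 ler_nat max_packing_lip.
  by rewrite ler_norml; apply/andP; split; lra.
have cU2 : #|pairs_in U|%:R <= u%:R ^+ 2 :> R.
  rewrite -natrX ler_nat card_pairs_in cU; apply: leq_trans (_ : u ^_ 2 <= _)%N.
    by rewrite -bin_ffact leq_pmulr ?fact_gt0.
  by rewrite ffactnS ffactn1 expnS expn1 leq_mul2l leq_pred orbT.
apply: le_trans (Ex_lower_tail p01' sU fU lip (_ : t <= _) cU2 t0).
  by apply: Ex_le => // E _; rewrite subrr; case: eqP => // ->; rewrite lexx.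
by apply: le_trans Ex_max_packing; rewrite -div1r ler_pdivlMr ?mulr_gt0 // mulrC.
Qed.

End LargeIndependent.

From mathcomp Require Import boolp topology normedtype.
Import numFieldNormedType.Exports.

(** * Asymptotics *)

Section Growth.
Local Open Scope ring_scope.
Local Open Scope classical_set_scope.
Variable R : realType.

(** The Taylor term of degree [j.+1] alone outgrows the left side. *)
Lemma poly_le_expR (C d : R) j : 0 < d -> \forall l \near +oo, C * l ^+ j <= expR (d * l).
Proof.
move=> d0; pose a := d ^+ j.+1 / (j.+1)`!%:R.
have a0 : 0 < a by rewrite divr_gt0 ?exprn_gt0 // ltr0n fact_gt0.
near=> l.
have l0 : 0 <= l by near: l; apply: nbhs_pinfty_ge; rewrite num_real.
have lC : C / a <= l by near: l; apply: nbhs_pinfty_ge; rewrite num_real.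
have dl : 0 <= d * l by rewrite mulr_ge0 // ltW.
apply: le_trans (expR_ge1Dxn j dl).
apply: le_trans (_ : (d * l) ^+ j.+1 / (j.+1)`!%:R <= _); last by rewrite lerDr ler01.
rewrite exprMn mulrAC -/a exprS mulrA; apply: ler_wpM2r; first exact: exprn_ge0.
by move: lC; rewrite ler_pdivrMr // mulrC.
Unshelve. all: by end_near.
Qed.

Variable p : R.
Hypothesis p01 : 0 < p < 1.
Local Notation q := (1 - p).
Local Notation lam := (ln q^-1).

Let q01 : 0 < q < 1.
Proof. by have /andP[? ?] := p01; apply/andP; split; lra. Qed.

Lemma lam_gt0 : 0 < lam.
Proof. by have /andP[q0 q1] := q01; rewrite ln_gt0 // invf_gt1. Qed.

Lemma expR_lam e : q ^+ e = expR (- (lam * e%:R)).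
Proof.
have /andP[q0 q1] := q01.
rewrite -mulNr expRM_natr; congr (_ ^+ _).
by rewrite expRN lnK ?invrK // posrE invr_gt0.
Qed.

Definition forest_bound (eps l : R) : nat := (Num.truncn ((2 + eps) * l / lam)).+1.

Lemma forest_bound_itv eps l : 0 < eps -> 0 <= l ->
  (2 + eps) * l / lam <= (forest_bound eps l)%:R <= (2 + eps) * l / lam + 1.
Proof.
move=> e0 l0; have x0 : 0 <= (2 + eps) * l / lam.
  by rewrite divr_ge0 ?mulr_ge0 ?(ltW lam_gt0) //; lra.
by have /andP[t1 t2] := truncn_itv x0; rewrite /forest_bound (ltW t2) -natr1 lerD2r t1.
Qed.

(** In the exponent the vertices cost [s * l] and the non-edges gain about [s * (1 + eps / 2) * l],
    since [(2 + eps) * l <= lam * s]. The factor [s ^ s] and the rounding cost at most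
    [s * eps / 8 * l] each, which leaves [s * eps / 4 * l]. *)
Lemma Ex_big_forest_lim (eps : R) : 0 < eps -> \forall l \near +oo, forall n, n%:R = expR l ->
  Ex p (pairs n) (fun G => (big_forest (forest_bound eps l) G)%:R) <= expR (- (eps / 4 * l)).
Proof.
move=> e0; have l0 := lam_gt0.
have e8 : 0 < eps / 8 by lra.
near=> l => n nl; set s := forest_bound eps l.
have lp : 0 <= l by near: l; apply: nbhs_pinfty_ge; rewrite num_real.
have /andP[s1 s2] := forest_bound_itv e0 lp; rewrite -/s in s1 s2.
have s3 : (3 <= s)%N.
  rewrite -(ler_nat R); apply: le_trans s1; rewrite ler_pdivlMr //.
  have : 3 * lam <= l by near: l; apply: nbhs_pinfty_ge; rewrite num_real.
  by nra.
have s1R : 1 <= s%:R :> R by rewrite ler1n; apply: leq_trans s3.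
have sl : s%:R <= expR (eps / 8 * l).
  apply: le_trans s2 _; apply: le_trans (_ : ((2 + eps) / lam + 1) * l ^+ 1 <= _); last first.
    by near: l; apply: poly_le_expR.
  rewrite expr1 [X in _ <= X]mulrDl mul1r mulrAC lerD2l.
  by near: l; apply: nbhs_pinfty_ge; rewrite num_real.
have le : 2 * lam <= eps / 8 * l.
  have : 2 * lam / (eps / 8) <= l by near: l; apply: nbhs_pinfty_ge; rewrite num_real.
  by rewrite ler_pdivrMr // [l * _]mulrC.
pose e := (s * (s - 3))./2.
have es : (2 * e + 3 * s <= s * s)%N.
  rewrite /e mul2n; apply: leq_trans (_ : s * (s - 3) + 3 * s <= _)%N.
    by rewrite leq_add2r -{2}(odd_double_half (s * (s - 3))) leq_addl.
  by rewrite mulnBr [(3 * s)%N]mulnC subnK // leq_mul2l s3 orbT.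
have e2 : s%:R * (s%:R - 3) - 1 <= 2 * e%:R :> R.
  rewrite lerBlDr -natrB // -!natrM natr1 ler_nat /e.
  by rewrite -{1}(odd_double_half (s * (s - 3))) mul2n; case: (odd _); rewrite ?add1n ?add0n ?leqnSn.
have p01' : 0 <= p <= 1 by have /andP[? ?] := p01; rewrite !ltW.
apply: le_trans (Ex_big_forest _ p01' es) _.
rewrite natrM !natrX -exprMn nl expR_lam.
apply: le_trans (_ : expR ((1 + eps / 8) * l) ^+ s * expR (- (lam * e%:R)) <= _).
  apply: ler_wpM2r; first exact: expR_ge0.
  apply: lerXn2r; rewrite ?nnegrE ?mulr_ge0 ?expR_ge0 //.
  by rewrite mulrDl mul1r expRD; apply: ler_wpM2l => //; exact: expR_ge0.
rewrite -expRM_natr -expRD ler_expR.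
have ls : (2 + eps) * l <= lam * s%:R by move: s1; rewrite ler_pdivrMr // [s%:R * _]mulrC.
set S : R := s%:R in s1R e2 ls *; set T : R := e%:R in e2 *.
have h1 : lam * (S * (S - 3) - 1) <= lam * (2 * T) by apply: ler_wpM2l => //; exact: ltW.
have h2 : S * ((2 + eps) * l) <= S * (lam * S) by apply: ler_wpM2l => //; lra.
have h3 : S * (2 * lam) <= S * (eps / 8 * l) by apply: ler_wpM2l => //; lra.
have h4 : lam * 1 <= lam * S by apply: ler_wpM2l => //; exact: ltW.
have h5 : 1 * (eps / 4 * l) <= S * (eps / 4 * l).
  by apply: ler_wpM2r => //; apply: mulr_ge0 => //; lra.
lra.
Unshelve. all: by end_near.
Qed.

(** The first inequality makes [t] at least about [n / (2 * M * s)] with [s <= (2 + eps) * L]; all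
    other terms are polynomial in [l] and vanish against [n * eps / 2]. *)
Lemma lower_size_lim (eps : R) m : 0 < eps <= 1 -> (5 <= m)%N ->
  \forall l \near +oo, forall n N t s, n%:R = expR l ->
  s = forest_bound (eps / 2) l ->
  (n <= 2 * m.-1 * t * s + s * (1 + s + s ^ m.-1))%N -> (n + t < N + s)%N ->
  n%:R + n%:R / (4 * (m%:R - 1) * (l / lam)) * (1 - eps) <= N%:R.
Proof.
move=> /andP[e0 e1] m5; have l0 := lam_gt0; pose M : R := m.-1%:R.
have M1 : 1 <= M by rewrite ler1n; case: m m5 {M} => [|[]].
have mM : m%:R - 1 = M by rewrite /M -[1]/(1%:R) -natrB ?subn1 //; apply: leq_trans m5.
pose C := (2 + eps / 2) / lam + 1.
have C0 : 0 <= C by apply: addr_ge0 => //; apply: divr_ge0; [lra | exact: ltW].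
near=> l => n N t s nl sE h1 h2.
have lp : 1 <= l by near: l; apply: nbhs_pinfty_ge; rewrite num_real.
have e2 : 0 < eps / 2 by lra.
have lp0 : 0 <= l by lra.
have /andP[s1 s2] := forest_bound_itv e2 lp0; rewrite -sE in s1 s2.
have L1 : 1 <= eps / 2 * (l / lam).
  have : lam / (eps / 2) <= l by near: l; apply: nbhs_pinfty_ge; rewrite num_real.
  by rewrite ler_pdivrMr // => h; rewrite mulrA ler_pdivlMr // mul1r mulrC.
pose L := l / lam; pose S : R := s%:R; pose X : R := expR l; pose T : R := t%:R.
have L0 : 0 < L by apply: divr_gt0 => //; lra.
have SL : S <= (2 + eps) * L.
  by move: s2; rewrite -mulrA -/L -/S; move: L1; rewrite -/L; lra.
have S1 : 1 <= S by rewrite ler1n sE.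
have SC : S <= C * l.
  by rewrite /C mulrDl mul1r mulrAC; move: s2; rewrite -/S; lra.
have X0 : 0 < X by exact: expR_gt0.
have h1R : X <= 2 * M * T * S + S * (1 + S + S ^+ m.-1).
  by rewrite /X -nl /M /T /S -natrX -!(natrM, natr1, natrD) -[1]/(1%:R) -!(natrM, natrD) ler_nat.
have h2R : X + T <= N%:R + S.
  by rewrite /X -nl /T /S -!natrD ler_nat ltnW.
(* The summand [2 * M * S ^+ 2] is the loss [s] in [n + t < N + s], multiplied by [2 * M * S]. *)
have Pb : S * (1 + S + S ^+ m.-1) + 2 * M * S ^+ 2 <= X * (eps / 2).
  apply: le_trans (_ : (3 + 2 * M) * S ^+ m <= _).
    have Sm : S * S ^+ m.-1 = S ^+ m by rewrite -exprS prednK //; apply: leq_trans m5.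
    have Sj j : (j <= m)%N -> S ^+ j <= S ^+ m by move=> jm; apply: ler_weXn2l.
    have j1 : S <= S ^+ m by rewrite -{1}[S]expr1 Sj //; apply: leq_trans m5.
    have j2 : S ^+ 2 <= S ^+ m by rewrite Sj //; apply: leq_trans m5.
    have j3 : M * S ^+ 2 <= M * S ^+ m by apply: ler_wpM2l => //; lra.
    rewrite mulrDr Sm mulrDr mulr1 -expr2; lra.
  apply: le_trans (_ : (3 + 2 * M) * (C * l) ^+ m <= _).
    apply: ler_wpM2l; first by lra.
    by apply: lerXn2r; rewrite ?nnegrE ?mulr_ge0 //; lra.
  rewrite -ler_pdivrMr // exprMn mulrA mulrAC /X -[l in expR l]mul1r.
  by near: l; apply: poly_le_expR.
rewrite nl mM -/X -/L.
suff : X / (4 * M * L) * (1 - eps) <= T - S by lra.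
have MS : 0 < 2 * M * S by rewrite !mulr_gt0 //; lra.
rewrite -(ler_pM2l MS).
have -> : 2 * M * S * (X / (4 * M * L) * (1 - eps)) = X * (1 - eps) * (S / (2 * L)).
  by field; rewrite !gt_eqF //; lra.
have SL2 : S / (2 * L) <= 1 + eps / 2.
  by rewrite ler_pdivrMr; [move: SL; lra | lra].
have hX : X * (1 - eps) * (S / (2 * L)) <= X * (1 - eps) * (1 + eps / 2).
  by apply: ler_wpM2l => //; apply: mulr_ge0; lra.
apply: le_trans hX _.
have hX2 : X * (1 - eps) * (1 + eps / 2) <= X * (1 - eps / 2).
  rewrite -mulrA; apply: ler_wpM2l; [exact: ltW | nra].
apply: le_trans hX2 _; move: h1R Pb; rewrite mulrBr mulr1 expr2; lra.
Unshelve. all: by end_near.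
Qed.

End Growth.

(** * Union bound for the properties used in the upper bound *)

Lemma card_sets (T : finType) : #|{set T}| = 2 ^ #|T|.
Proof. by rewrite -[#|T|]cardsT -card_powerset; apply: eq_card => A; rewrite in_set subsetT. Qed.

Section UpperProbability.
Local Open Scope ring_scope.
Variables (R : realType) (p : R) (n m k u u1 r y0 y1 : nat) (B : {set 'I_n}) (t : R).
Hypothesis p01 : 0 < p < 1.
Hypothesis m5 : (5 <= m)%N.
Hypothesis n0 : (0 < n)%N.
Hypothesis k2 : (1 < k)%N.
Hypothesis ku1 : (k <= u1)%N.
Hypothesis t0 : 0 <= t <= 2 * u1%:R ^+ 2.
Hypothesis tg : 4 * overlap_sum p u1 k * t <= 1.
Hypothesis u1u : u1%:R <= p * u%:R / 2.
Hypothesis y0B : y0%:R <= p ^+ m * (#|~: B| - m)%:R / 2.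
Hypothesis y1B : y1%:R <= p ^+ m * (#|B| - m)%:R / 2.
Hypothesis mB : (m <= #|B|)%N.
Hypothesis mB' : (m <= #|~: B|)%N.
Hypothesis r2 : (1 < r)%N.
Hypothesis ry0 : (r + m <= y0)%N.
Hypothesis uy1 : (u + m <= y1)%N.
Hypothesis nr : (n + u * k <= r * k)%N.

Definition has_small_saturated (G : {set 'I_n * 'I_n}) :=
  `[< exists2 H, saturated m G H & (#|H| <= n + (r + #|B|) + m ^ 2)%N >].

Let bad_indep (G : {set 'I_n * 'I_n}) :=
  [exists U : {set 'I_n}, (#|U| == u1) && (max_packing k U G == 0)%N].
Let bad_pair (G : {set 'I_n * 'I_n}) := [exists SU : {set 'I_n} * {set 'I_n},
  [&& [disjoint SU.1 & SU.2], (u <= #|SU.1|)%N, (u <= #|SU.2|)%N &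
      [forall w in SU.1, (#|[set x in SU.2 | adj G w x]| < u1)%N]]].
Let bad_common (C : {set 'I_n}) y (G : {set 'I_n * 'I_n}) := [exists f : {ffun 'I_m -> 'I_n},
  (#|[set v in C | [forall i, adj G v (f i)]]| < y)%N].

Lemma small_saturated_or_bad (G : {set 'I_n * 'I_n}) : G \subset pairs n -> ~~ has_small_saturated G ->
  [|| bad_indep G, bad_pair G, bad_common (~: B) y0 G | bad_common B y1 G].
Proof.
move=> sG; apply: contraR; rewrite !negb_or => /and4P[/existsPn ni /existsPn np nc0 nc1].
have common C y : ~~ bad_common C y G -> forall f : 'I_m -> 'I_n,
    (y <= #|[set v in C | [forall i, adj G v (f i)]]|)%N.
  move=> /existsPn/= h f; have := h (finfun f); rewrite -leqNgt; congr (_ <= _)%N.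
  by apply: eq_card => v; rewrite !in_set; congr (_ && _); apply: eq_forallb => i; rewrite ffunE.
(* Both size thresholds of the density condition are taken to be [u]. *)
apply/asboolP; apply: (@small_saturated n m k u u u1 r y0 y1 G B) => //.
- move=> U /subset_of_card[U' U'U cU'].
  have := ni U'; rewrite cU' eqxx /= -lt0n => /(max_packing_gt0 sG)[A [AU Ak iA]].
  by exists A; split=> //; apply: subset_trans U'U.
- move=> S U dis sS uU; have := np (S, U); rewrite /= dis sS uU /=.
  move=> /forall_inPn[w wS]; rewrite -leqNgt => h; exists w => //.
- exact: common.
- exact: common.
- exact: ltnW.
Qed.

(** The factors count vertex sets ([2 ^+ n]), pairs of vertex sets ([4 ^+ n]) and [m]-tuples, the
    latter once outside and once inside [B]. *)
Lemma Ex_small_saturated : Ex p (pairs n) (fun G => (~~ has_small_saturated G)%:R) <=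
  2 ^+ n * expR (- (t ^+ 2 / (8 * u1%:R ^+ 2))) +
  4 ^+ n * expR (- (p ^+ 2 / 32 * u%:R ^+ 2)) +
  n%:R ^+ m * expR (- (p ^+ (2 * m) / (32 * m%:R) * (#|~: B| - m)%:R)) +
  n%:R ^+ m * expR (- (p ^+ (2 * m) / (32 * m%:R) * (#|B| - m)%:R)).
Proof.
have p01' : 0 <= p <= 1 by have /andP[? ?] := p01; rewrite !ltW.
have m0 : (0 < m)%N by apply: leq_trans m5.
have E1 : Ex p (pairs n) (fun G => (bad_indep G)%:R) <= 2 ^+ n * expR (- (t ^+ 2 / (8 * u1%:R ^+ 2))).
  pose P : pred {set 'I_n} := fun U => #|U| == u1.
  apply: le_trans (Ex_union p01' (P := P) (b := fun U G => (max_packing k U G == 0)%N)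
    (a := expR (- (t ^+ 2 / (8 * u1%:R ^+ 2)))) _ _) _.
  - by move=> G _ /existsP[U /andP[]]; exists U.
  - by move=> U /eqP cU; apply: Ex_no_indep.
  - rewrite -[X in X <= _]mulr_natl; apply: ler_wpM2r; first exact: expR_ge0.
    rewrite -natrX ler_nat; apply: leq_trans (max_card _) _.
    by rewrite card_sets card_ord.
have E2 : Ex p (pairs n) (fun G => (bad_pair G)%:R) <= 4 ^+ n * expR (- (p ^+ 2 / 32 * u%:R ^+ 2)).
  pose P : pred ({set 'I_n} * {set 'I_n}) := fun SU =>
    [&& [disjoint SU.1 & SU.2], (u <= #|SU.1|)%N & (u <= #|SU.2|)%N].
  apply: le_trans (Ex_union p01' (P := P)
    (b := fun SU G => [forall w in SU.1, (#|[set x in SU.2 | adj G w x]| < u1)%N])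
    (a := expR (- (p ^+ 2 / 32 * u%:R ^+ 2))) _ _) _.
  - by move=> G _ /existsP[SU /and4P[? ? ? ?]]; exists SU => //; apply/and3P.
  - move=> [S U] /and3P[/= dis uS uU]; apply: le_trans (Ex_sparse_pair p01' dis _) _.
      apply: le_trans u1u _; apply: ler_wpM2r; first by lra.
      by apply: ler_wpM2l; [lra | rewrite ler_nat].
    rewrite ler_expR lerN2; apply: ler_wpM2l; first by apply: mulr_ge0; [exact: sqr_ge0 | lra].
    by rewrite -natrX ler_nat -mulnn leq_mul.
  - rewrite -[X in X <= _]mulr_natl; apply: ler_wpM2r; first exact: expR_ge0.
    rewrite -natrX ler_nat; apply: leq_trans (max_card _) _.
    by rewrite card_prod !card_sets !card_ord -expnMn.
have E3 (C : {set 'I_n}) y : (m <= #|C|)%N -> y%:R <= p ^+ m * (#|C| - m)%:R / 2 ->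
    Ex p (pairs n) (fun G => (bad_common C y G)%:R) <=
    n%:R ^+ m * expR (- (p ^+ (2 * m) / (32 * m%:R) * (#|C| - m)%:R)).
  move=> mC yC; apply: le_trans (Ex_union p01' (P := xpredT)
    (b := fun (f : {ffun 'I_m -> 'I_n}) G => (#|[set v in C | [forall i, adj G v (f i)]]| < y)%N)
    (a := expR (- (p ^+ (2 * m) / (32 * m%:R) * (#|C| - m)%:R))) _ _) _.
  - by move=> G _ /existsP[f]; exists f.
  - by move=> f _; apply: Ex_few_common.
  - rewrite -[X in X <= _]mulr_natl; apply: ler_wpM2r; first exact: expR_ge0.
    rewrite -natrX ler_nat; apply: leq_trans (max_card _) _.
    by rewrite card_ffun !card_ord.
apply: le_trans (lerD (lerD (lerD E1 E2) (E3 _ _ mB' y0B)) (E3 _ _ mB y1B)).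
rewrite -!ExD; apply: Ex_le => // G sG.
case: (boolP (has_small_saturated G)) => /= [_|/(small_saturated_or_bad sG)]; first by rewrite !addr_ge0.
by case/or4P=> ->; rewrite -!natrD ler_nat !addn_gt0 ?orbT.
Qed.

End UpperProbability.

Lemma divn_bounds (R : realFieldType) n d : (0 < d <= n)%N ->
  (n%:R / (2 * d%:R) <= (n %/ d)%:R :> R)%R /\ ((n %/ d)%:R <= n%:R / d%:R :> R)%R.
Proof.
case/andP=> d0 dn; have dR : (0 < d%:R :> R)%R by rewrite ltr0n.
split; last by rewrite ler_pdivlMr // -natrM ler_nat leq_trunc_div.
rewrite ler_pdivrMr; last by rewrite mulr_gt0.
rewrite -!natrM ler_nat mulnCA mul2n -addnn.
have q0 : 0 < n %/ d by rewrite divn_gt0.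
apply: leq_trans (ltnW (ltn_ceil n d0)) _; rewrite mulSn leq_add2r.
by rewrite leq_pmull.
Qed.

(** * Independent sets of nearly the largest size and their overlaps *)

Section UpperAsymptotics.
Local Open Scope ring_scope.
Local Open Scope classical_set_scope.
Variables (R : realType) (p : R).
Hypothesis p01 : 0 < p < 1.
Local Notation q := (1 - p).
Local Notation lam := (ln q^-1).

Definition indep_size (e l : R) : nat := Num.truncn ((2 - e) * l / lam).

Lemma indep_size_itv e l : 0 < e <= 1 -> 0 <= l ->
  (2 - e) * l / lam - 1 <= (indep_size e l)%:R <= (2 - e) * l / lam.
Proof.
move=> /andP[e0 e1] l0; have lam0 := lam_gt0 p01.
have x0 : 0 <= (2 - e) * l / lam by rewrite divr_ge0 ?mulr_ge0 ?(ltW lam0) //; lra.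
have /andP[t1 t2] := truncn_itv x0; rewrite /indep_size t1 andbT lerBlDr.
by rewrite natr1 ltW.
Qed.

Lemma indep_size_ge (e D : R) : 0 < e <= 1 -> \forall l \near +oo, D <= (indep_size e l)%:R.
Proof.
move=> /[dup] e01 /andP[e0 e1]; have lam0 := lam_gt0 p01; near=> l.
have l0 : 0 <= l by near: l; apply: nbhs_pinfty_ge; rewrite num_real.
have /andP[k1 _] := indep_size_itv e01 l0; apply: le_trans k1.
rewrite lerBrDr; apply: le_trans (_ : l / lam <= _).
  by rewrite ler_pdivlMr //; near: l; apply: nbhs_pinfty_ge; rewrite num_real.
by apply: ler_wpM2r; [rewrite invr_ge0 ltW | nra].
Unshelve. all: by end_near.
Qed.

Lemma indep_size_poly (e D d : R) i j : 0 < e <= 1 -> 0 <= D -> 0 < d ->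
  \forall l \near +oo, D * (indep_size e l)%:R ^+ i * l ^+ j <= expR (d * l).
Proof.
move=> /[dup] e01 /andP[e0 e1] D0 d0; have lam0 := lam_gt0 p01; near=> l.
have l0 : 0 <= l by near: l; apply: nbhs_pinfty_ge; rewrite num_real.
have /andP[_ k2] := indep_size_itv e01 l0; rewrite mulrAC in k2.
have c0 : 0 <= (2 - e) / lam by rewrite divr_ge0 ?(ltW lam0) //; lra.
apply: le_trans (_ : D * ((2 - e) / lam) ^+ i * l ^+ (i + j) <= _); last first.
  by near: l; apply: poly_le_expR.
rewrite exprD mulrA; apply: ler_wpM2r; first exact: exprn_ge0.
rewrite -mulrA; apply: ler_wpM2l => //; rewrite -exprMn.
by apply: lerXn2r k2; rewrite nnegrE; [exact: ler0n | exact: mulr_ge0].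
Unshelve. all: by end_near.
Qed.

Lemma bin2_le j : 'C(j, 2)%:R <= j%:R * (j%:R - 1) / 2 :> R.
Proof.
rewrite ler_pdivlMr //; case: j => [|j]; first by rewrite bin0n mul0r mul0r.
rewrite -[j.+1%:R in X in _ <= _ * X]natr1 addrK -!natrM ler_nat bin2 /= muln2.
by rewrite -{2}(odd_double_half (j.+1 * j)) leq_addl.
Qed.

(** This is the exponent of one overlap term, written as [- J] times a factor. For small [J] the
    factor is at least [7 / 8 * l], and [2 <= J]. For large [J] it is still [e / 4 * l], thanks to
    the [e] in [(2 - e) * l], and [8 <= J * e]. *)
Lemma overlap_term_le (e l J : R) : 0 < e <= 4^-1 -> 0 <= l -> 2 <= J ->
  lam * J <= (2 - e) * l -> 16 * lam <= e ^+ 2 * l ->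
  J * (- ((1 - e / 4) * l)) + lam * (J * (J - 1) / 2) <= - (7 / 4 * l).
Proof.
move=> /andP[e0 e4] l0 J2 lJ el; have lam0 := lam_gt0 p01.
have -> : J * (- ((1 - e / 4) * l)) + lam * (J * (J - 1) / 2) =
   - (J * ((1 - e / 4) * l - lam * (J - 1) / 2)) by field.
rewrite lerN2; case: (leP (lam * (J - 1) / 2) (e / 4 * l)) => h.
  have h1 : 7 / 8 * l <= (1 - e / 4) * l - lam * (J - 1) / 2 by nra.
  have h2 : 2 * (7 / 8 * l) <= J * ((1 - e / 4) * l - lam * (J - 1) / 2).
    by apply: ler_pM => //; lra.
  lra.
have h1 : e / 4 * l <= (1 - e / 4) * l - lam * (J - 1) / 2 by nra.
have h0 : 8 <= J * e.
  rewrite -(ler_pM2l lam0); have : e / 4 * l * 2 <= lam * J by nra.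
  nra.
apply: le_trans (_ : J * (e / 4 * l) <= _); last by apply: ler_wpM2l => //; lra.
nra.
Qed.

(** Fewer than [k] terms of size [expR (- (7 / 4 * l))] meet a factor of at most [expR (3 / 2 * l)];
    the margin [expR (- (4^-1 * l))] absorbs [16 * k]. The 16 is the 4 of [Ex_max_packing] times the
    4 in the deviation [4 * u1 * sqrt n]. *)
Lemma overlap_sum_lim (e : R) : 0 < e <= 4^-1 -> \forall l \near +oo, forall n, n%:R = expR l ->
  let k := indep_size e l in let u1 := (n %/ k ^ 3)%N in
  16 * overlap_sum p u1 k * (u1%:R * expR (2^-1 * l)) <= 1.
Proof.
move=> /[dup] e04 /andP[e0 e4]; have lam0 := lam_gt0 p01.
have e01 : 0 < e <= 1 by rewrite e0; lra.
have d0 : 0 < e / 4 by lra.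
near=> l => n nl.
have l1 : 0 <= l by near: l; apply: nbhs_pinfty_ge; rewrite num_real.
have /andP[_ kl] := indep_size_itv e01 l1.
have k2 : 2 <= (indep_size e l)%:R :> R by near: l; apply: indep_size_ge.
have kpoly : 2 * (indep_size e l)%:R ^+ 5 * l ^+ 0 <= expR (e / 4 * l).
  by near: l; apply: indep_size_poly.
have k16 : 16 * (indep_size e l)%:R ^+ 1 * l ^+ 0 <= expR (4^-1 * l).
  by near: l; apply: indep_size_poly => //; lra.
have el : 16 * lam <= e ^+ 2 * l.
  have : 16 * lam / e ^+ 2 <= l by near: l; apply: nbhs_pinfty_ge; rewrite num_real.
  by rewrite ler_pdivrMr ?exprn_gt0 // [l * _]mulrC.
rewrite !expr0 !mulr1 expr1 in kpoly k16.
set k := indep_size e l in kl k2 kpoly k16 *; set u1 := (n %/ k ^ 3)%N.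
have k0 : (0 < k)%N by rewrite -(ltr0n R); lra.
have kn : (k ^ 3 <= n)%N.
  rewrite -(ler_nat R) nl natrX; apply: le_trans (_ : 2 * k%:R ^+ 5 <= _).
    apply: le_trans (_ : k%:R ^+ 5 <= _); first by apply: ler_weXn2l => //; lra.
    by rewrite ler_peMl ?exprn_ge0 //; lra.
  by apply: le_trans kpoly _; rewrite ler_expR; nra.
have k30 : (0 < k ^ 3)%N by rewrite expn_gt0 k0.
have [u1a u1b] := divn_bounds R (introT andP (conj k30 kn)); rewrite -/u1 in u1a u1b.
have kR : 0 < k%:R :> R by rewrite ltr0n.
have nR : 0 < n%:R :> R by rewrite nl expR_gt0.
have u10 : 0 < u1%:R :> R by apply: lt_le_trans u1a; rewrite divr_gt0 // mulr_gt0 // ltr0n.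
have ratio : (k ^ 2)%:R / u1%:R <= expR (- ((1 - e / 4) * l)).
  rewrite ler_pdivrMr //; apply: le_trans (ler_wpM2l (expR_ge0 _) u1a).
  rewrite mulrA ler_pdivlMr ?mulr_gt0 ?ltr0n // nl -expRD.
  have -> : - ((1 - e / 4) * l) + l = e / 4 * l by ring.
  apply: le_trans kpoly; rewrite !natrX.
  by rewrite le_eqVlt; apply/orP; left; apply/eqP; ring.
have ratio0 : 0 <= (k ^ 2)%:R / u1%:R :> R by rewrite divr_ge0.
have osum : overlap_sum p u1 k <= expR (- (7 / 4 * l)) * k%:R.
  apply: le_trans (_ : \sum_(2 <= j < k.+1) expR (- (7 / 4 * l)) <= _); last first.
    rewrite sumr_const_nat -[X in X <= _]mulr_natr; apply: ler_wpM2l; first exact: expR_ge0.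
    by rewrite ler_nat subSS leq_subr.
  apply: ler_sum_nat => j /andP[j2 jk].
  have jR : 2 <= j%:R :> R by rewrite ler_nat.
  rewrite (expR_lam p01) -expRN opprK.
  apply: le_trans (_ : expR (- ((1 - e / 4) * l)) ^+ j * expR (lam * 'C(j, 2)%:R) <= _).
    by apply: ler_wpM2r; [exact: expR_ge0 | apply: lerXn2r; rewrite ?nnegrE ?expR_ge0].
  rewrite -expRM_natl -expRD ler_expR.
  apply: le_trans (_ : j%:R * (- ((1 - e / 4) * l)) + lam * (j%:R * (j%:R - 1) / 2) <= _).
    by rewrite lerD2l; apply: ler_wpM2l; [exact: ltW | exact: bin2_le].
  apply: overlap_term_le => //.
  apply: le_trans (_ : lam * k%:R <= _).
    by apply: ler_wpM2l; [exact: ltW | rewrite ler_nat].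
  by rewrite mulrC -ler_pdivlMr.
have u1n : u1%:R <= expR l by rewrite -nl ler_nat leq_div.
apply: le_trans (_ : 16 * (expR (- (7 / 4 * l)) * k%:R) * (expR l * expR (2^-1 * l)) <= _).
  apply: ler_pM; rewrite ?mulr_ge0 ?expR_ge0 //.
  - by apply: sumr_ge0 => j _; rewrite divr_ge0 ?exprn_ge0 //; have /andP[? ?] := p01; lra.
  - by apply: ler_wpM2l.
  - by apply: ler_wpM2r => //; exact: expR_ge0.
have -> : 16 * (expR (- (7 / 4 * l)) * k%:R) * (expR l * expR (2^-1 * l)) =
   16 * k%:R * expR (- (4^-1 * l)).
  have -> : - (4^-1 * l) = - (7 / 4 * l) + (l + 2^-1 * l) by field.
  by rewrite !expRD; ring.
by rewrite expRN ler_pdivrMr ?expR_gt0 // mul1r.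
Unshelve. all: by end_near.
Qed.

End UpperAsymptotics.

Lemma card_initial_segment n b : b <= n -> #|[set i : 'I_n | i < b]| = b.
Proof.
move=> bn; have wi : injective (widen_ord bn) by move=> i j /(congr1 val) /= /val_inj.
rewrite -[RHS](card_ord b) -[RHS]cardsT -(card_imset _ wi).
apply: eq_card => i; rewrite in_set; apply/idP/imsetP => [ib|[j _ ->]]; last by rewrite /= ltn_ord.
by exists (Ordinal ib) => //; apply: val_inj.
Qed.

(** * Choice of the parameters and their error terms *)

Section UpperParameters.
Local Open Scope ring_scope.
Variables (R : realType) (p l D : R) (n m k C : nat).
Hypothesis p01 : 0 < p < 1.
Hypothesis m5 : (5 <= m)%N.
Hypothesis l1 : 1 <= l.
Hypothesis nl : n%:R = expR l.
Variables (P c N k' : R) (u u1 r : nat) (B : {set 'I_n}).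
Hypothesis PE : P = p ^+ m.
Hypothesis cE : c = p ^+ (2 * m) / (32 * m%:R).
Hypothesis NE : N = n%:R.
Hypothesis k'E : k' = k%:R.
Hypothesis uE : u = (n %/ k ^ 2)%N.
Hypothesis u1E : u1 = (n %/ k ^ 3)%N.
Hypothesis rE : r = (n %/ k + 1 + u)%N.
Hypothesis BE : B = [set i : 'I_n | (i < C * u)%N].
Hypothesis C8 : 8 <= P * C%:R.
Hypothesis kP : 24 <= P * k'.
Hypothesis kp : 4 <= p * k'.
Hypothesis kC : 2 * C%:R <= k'.
Hypothesis km : m%:R + 2 <= k'.
Hypothesis D1 : 8 * (m%:R + 2) <= D.
Hypothesis D2 : 384 / p ^+ 2 <= D.
Hypothesis D3 : 4 * (m%:R + 1) / c <= D.
Hypothesis ND : D * k' ^+ 5 * l <= N.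
Hypothesis Nk3 : 4 * k' ^+ 3 <= expR (2^-1 * l).
Hypothesis ov : 16 * overlap_sum p u1 k * (u1%:R * expR (2^-1 * l)) <= 1.

Let m5R : 5 <= m%:R :> R. Proof. by rewrite ler_nat. Qed.
Let k7 : 7 <= k'. Proof. by move: km m5R; lra. Qed.
Let k7n : (7 <= k)%N. Proof. by rewrite -(ler_nat R) -k'E. Qed.
Let k0 : (0 < k)%N. Proof. by apply: leq_trans k7n. Qed.
Let D56 : 56 <= D. Proof. by move: D1 m5R; lra. Qed.
Local Ltac blra := move: l1 kP kC km D1 m5R k7 D56; lra.
Let P01 : 0 < P <= 1.
Proof. by have /andP[? ?] := p01; rewrite PE exprn_gt0 //= exprn_ile1 ?ltW. Qed.
Let c0 : 0 < c.
Proof. by have /andP[? ?] := p01; rewrite cE divr_gt0 ?exprn_gt0 // mulr_gt0 //; blra. Qed.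

Let NDj j : (j <= 5)%N -> D * k' ^+ j * l <= N.
Proof.
move=> j5; apply: le_trans ND; apply: ler_wpM2r; first blra.
apply: ler_wpM2l; first blra.
by apply: ler_weXn2l => //; blra.
Qed.

Let ND' a j : (j <= 5)%N -> 0 <= a -> a <= D -> a * k' ^+ j * l <= N.
Proof.
move=> j5 a0 aD; apply: le_trans (NDj j5); apply: ler_wpM2r; first blra.
by apply: ler_wpM2r => //; apply: exprn_ge0; blra.
Qed.

Let ND'' a j : (j <= 5)%N -> 0 <= a -> a <= D -> a * k' ^+ j <= N.
Proof.
move=> j5 a0 aD; apply: le_trans (ND' j5 a0 aD); rewrite ler_peMr //.
by apply: mulr_ge0 => //; apply: exprn_ge0; blra.
Qed.

Let kjn j : (j <= 5)%N -> (0 < k ^ j <= n)%N.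
Proof.
move=> j5; rewrite expn_gt0 k0 /= -(ler_nat R) natrX -k'E -NE.
by have := ND'' j5 ler01; rewrite mul1r; apply; blra.
Qed.

Let kj0 j : 0 < k' ^+ j. Proof. by apply: exprn_gt0; blra. Qed.

Let kj2 j : 0 < 2 * k' ^+ j. Proof. by apply: mulr_gt0. Qed.

Let u_bounds : N <= u%:R * (2 * k' ^+ 2) /\ u%:R * k' ^+ 2 <= N.
Proof.
have [h1 h2] := divn_bounds R (kjn (isT : 2 <= 5)%N); rewrite natrX -uE -k'E -NE in h1 h2.
by split; [rewrite -ler_pdivrMr ?kj2 | rewrite -ler_pdivlMr ?kj0].
Qed.

Let u1_bounds : N <= u1%:R * (2 * k' ^+ 3) /\ u1%:R * k' ^+ 3 <= N.
Proof.
have [h1 h2] := divn_bounds R (kjn (isT : 3 <= 5)%N); rewrite natrX -u1E -k'E -NE in h1 h2.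
by split; [rewrite -ler_pdivrMr ?kj2 | rewrite -ler_pdivlMr ?kj0].
Qed.

Let N0 : 0 < N. Proof. by rewrite NE nl expR_gt0. Qed.
Let um : m%:R <= u%:R :> R.
Proof.
have [h _] := u_bounds; rewrite -(ler_pM2r (_ : 0 < 2 * k' ^+ 2)) ?kj2 //.
apply: le_trans h; rewrite mulrA; apply: ND'' => //; blra.
Qed.
Let C8' : 8 <= C%:R :> R. Proof. by have /andP[_ P1] := P01; apply: le_trans C8 _; rewrite ler_piMl. Qed.

Local Ltac blra ::= move: l1 kP kC km D1 m5R k7 D56 C8' N0 um; lra.

Let b_half : (C * u)%:R <= N / 2.
Proof.
have [_ h] := u_bounds; rewrite natrM ler_pdivlMr //.
have h2 : C%:R * u%:R * 2 <= k' * u%:R by rewrite mulrAC [C%:R * 2]mulrC; apply: ler_wpM2r.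
apply: le_trans h2 _; apply: le_trans h; rewrite mulrC; apply: ler_wpM2l => //.
by rewrite expr2 ler_peMr //; blra.
Qed.

Let bn : (C * u <= n)%N.
Proof. by rewrite -(ler_nat R); apply: le_trans b_half _; rewrite -NE; have := N0; blra. Qed.
Let cB : #|B| = (C * u)%N. Proof. by rewrite BE; apply: card_initial_segment. Qed.
Let cB' : #|~: B| = (n - C * u)%N.
Proof. by have := cardsC B; rewrite cB card_ord => E; rewrite -[in RHS]E addKn. Qed.

Let Nm : 8 * (m%:R + 2) <= N.
Proof. by have := @ND'' (8 * (m%:R + 2)) 0 isT; rewrite expr0 mulr1; apply; blra. Qed.

Let mB : (m <= #|B|)%N.
Proof.
rewrite cB -(ler_nat R) natrM; apply: le_trans um _; rewrite ler_peMl //; blra.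
Qed.

Let cBm : u%:R <= (#|B| - m)%:R :> R.
Proof.
rewrite natrB // cB natrM; have := ler_wpM2r (ler0n R u) C8'; have := um; blra.
Qed.

Let cBm' : N / 4 <= (#|~: B| - m)%:R :> R /\ (m <= #|~: B|)%N.
Proof.
have mB' : (m <= #|~: B|)%N.
  rewrite cB' -(ler_nat R) natrB // -NE; move: b_half Nm; blra.
split=> //; rewrite natrB // cB' natrB // -NE; move: b_half Nm; blra.
Qed.

Let n0 : (0 < n)%N. Proof. by rewrite -(ltr0n R) -NE. Qed.

(** The left side is at most [3 * N / k'] and the right side at least [P * N / 8], whence the 24 in
    [kP]. *)
Let y0B : (r + m)%:R <= P * (#|~: B| - m)%:R / 2.
Proof.
have [h _] := cBm'; have /andP[P0 P1] := P01.
apply: le_trans (_ : P * (N / 4) / 2 <= _); last first.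
  by apply: ler_wpM2r; [blra | apply: ler_wpM2l => //; exact: ltW].
have k'0 : 0 < k' by blra.
have rk : (r + m)%:R * k' <= 3 * N.
  have h1 : (n %/ k)%:R * k' <= N by rewrite k'E NE -natrM ler_nat leq_trunc_div.
  have h2 : u%:R * k' <= N.
    have [_ hu] := u_bounds; apply: le_trans hu; apply: ler_wpM2l => //.
    by rewrite expr2 ler_peMr //; blra.
  have h3 : (m%:R + 1) * k' <= N.
    by have := @ND'' (m%:R + 1) 1 isT; rewrite expr1; apply; blra.
  rewrite rE !natrD; move: h1 h2 h3; set A := (n %/ k)%:R; set U := u%:R; blra.
rewrite -(ler_pM2r k'0); apply: le_trans rk _.
have : 24 * N <= P * k' * N by apply: ler_wpM2r => //; exact: ltW.
blra.
Qed.

Let y1B : (u + m)%:R <= P * (#|B| - m)%:R / 2.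
Proof.
have /andP[P0 P1] := P01; rewrite natrB // cB natrD natrM.
have h1 : 8 * u%:R <= P * C%:R * u%:R by apply: ler_wpM2r.
have h2 : P * m%:R <= 1 * m%:R by apply: ler_wpM2r.
have := um; blra.
Qed.

Let nr : (n + u * k <= r * k)%N.
Proof. by rewrite rE mulnDl leq_add2r addn1 ltnW // ltn_ceil. Qed.

(** Rounding costs [u] at most a factor 2, so [u1] is at most [2 * u / k'], and [4 <= p * k'] does
    the rest. *)
Let u1u : u1%:R <= p * u%:R / 2.
Proof.
have [_ h1] := u1_bounds; have [h2 _] := u_bounds.
rewrite -(ler_pM2r (kj0 3)); apply: le_trans h1 _; apply: le_trans h2 _.
have -> : p * u%:R / 2 * k' ^+ 3 = (p * k') * (u%:R * k' ^+ 2) / 2 by field.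
have : 4 * (u%:R * k' ^+ 2) <= p * k' * (u%:R * k' ^+ 2).
  by apply: ler_wpM2r => //; apply: mulr_ge0 => //; exact: ltW.
blra.
Qed.

(** Chosen so that [t ^+ 2 / (8 * u1%:R ^+ 2)] equals [2 * n], which beats [2 ^ n] vertex sets. *)
Let t := 4 * (u1%:R * expR (2^-1 * l)).

Let u1ge : 2 * expR (2^-1 * l) <= u1%:R.
Proof.
have [h _] := u1_bounds; rewrite -(ler_pM2r (_ : 0 < 2 * k' ^+ 3)) ?kj2 //.
apply: le_trans h; rewrite NE nl.
have -> : expR l = expR (2^-1 * l) * expR (2^-1 * l) :> R by rewrite -expRD; congr expR; field.
have e0 : 0 < expR (2^-1 * l) := expR_gt0 _.
have := ler_wpM2l (ltW e0) Nk3; set E := expR _; blra.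
Qed.

Let u1_gt0 : 0 < u1%:R :> R.
Proof. by apply: lt_le_trans u1ge; rewrite mulr_gt0 ?expR_gt0. Qed.

Let t0 : 0 <= t <= 2 * u1%:R ^+ 2.
Proof.
rewrite /t !mulr_ge0 ?expR_ge0 //=.
have := ler_wpM2l (ltW u1_gt0) u1ge; rewrite expr2; blra.
Qed.

Lemma Ex_small_saturated_le :
  Ex p (pairs n) (fun G => (~~ has_small_saturated m r B G)%:R) <= 4 * expR (- l).
Proof.
have ku1 : (k <= u1)%N by rewrite u1E leq_divRL ?expn_gt0 ?k0 // -expnS; have /andP[] := kjn (isT : 4 <= 5)%N.
have tg : 4 * overlap_sum p u1 k * t <= 1.
  by apply: le_trans ov; rewrite /t le_eqVlt; apply/orP; left; apply/eqP; ring.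
have [_ mB'] := cBm'.
have r2 : (1 < r)%N.
  have : (0 < n %/ k)%N by rewrite divn_gt0 //; have := kjn (isT : 1 <= 5)%N; rewrite expn1 => /andP[].
  by rewrite rE; case: (n %/ k)%N => // j _; rewrite addn1.
have k2 : (1 < k)%N by apply: leq_trans k7n.
have h0 := y0B; have h1 := y1B; rewrite PE in h0 h1.
have := @Ex_small_saturated R p n m k u u1 r (r + m) (u + m) B t p01 m5 n0 k2 ku1 t0 tg u1u h0 h1 mB mB' r2
  (leqnn _) (leqnn _) nr.
rewrite -cE.
move/le_trans; apply.
have lN : l <= N by rewrite NE nl; apply: le_trans (expR_ge1Dx l); blra.
(* Since [l <= N], a surplus of [N] in the exponent already yields [expR (- l)]. *)
have eN (a : nat) b x : a%:R <= expR b -> N + b * N <= x -> a%:R ^+ n * expR (- x) <= expR (- l).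
  move=> ab bx; apply: le_trans (_ : expR b ^+ n * expR (- x) <= _).
    apply: ler_wpM2r; first exact: expR_ge0.
    by apply: lerXn2r; rewrite ?nnegrE ?expR_ge0.
  by rewrite -expRM_natr -expRD ler_expR -NE; blra.
have e1 : 2 <= expR 1 :> R by apply: le_trans (expR_ge1Dx 1); blra.
have T1 : 2 ^+ n * expR (- (t ^+ 2 / (8 * u1%:R ^+ 2))) <= expR (- l).
  apply: (eN 2 1) => //.
  have -> : t ^+ 2 / (8 * u1%:R ^+ 2) = 2 * (expR (2^-1 * l) * expR (2^-1 * l)).
    by rewrite /t; field; rewrite gt_eqF.
  have -> : expR (2^-1 * l) * expR (2^-1 * l) = N.
    by rewrite NE nl -expRD; congr expR; field.
  blra.
(* The exponent must reach [3 * N]; with [u] at least [N / (2 * k' ^+ 2)] this requires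
   [384 = 3 * 128] in [D2]. *)
have T2 : 4 ^+ n * expR (- (p ^+ 2 / 32 * u%:R ^+ 2)) <= expR (- l).
  apply: (eN 4 2).
    have -> : 2 = 1 + 1 :> R by ring.
    rewrite expRD; apply: le_trans (_ : 2 * 2 <= _); first by rewrite -natrM.
    by apply: ler_pM.
  have [h _] := u_bounds.
  have hN : 384 / p ^+ 2 * k' ^+ 4 <= N by apply: ND'' => //; rewrite divr_ge0 ?sqr_ge0.
  have p0 : 0 < p by case/andP: p01.
  have hN' : 384 * k' ^+ 4 <= N * p ^+ 2.
    by move: hN; rewrite mulrAC ler_pdivrMr ?exprn_gt0.
  have h2 : N ^+ 2 <= (u%:R * (2 * k' ^+ 2)) ^+ 2.
    by apply: lerXn2r h; rewrite nnegrE; [exact: ltW | apply: mulr_ge0 => //; exact: ltW (kj2 _)].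
  rewrite -(ler_pM2r (kj0 4)).
  have -> : p ^+ 2 / 32 * u%:R ^+ 2 * k' ^+ 4 = p ^+ 2 / 128 * (u%:R * (2 * k' ^+ 2)) ^+ 2 by field.
  apply: le_trans (ler_wpM2l _ h2); last by rewrite divr_ge0 ?sqr_ge0.
  have := ler_wpM2l (ltW N0) hN'; rewrite expr2; set A := k' ^+ 4; blra.
(* A factor [n ^ m] is beaten once [(m + 1) * l <= c * x], which [D3] ensures for [x] of order
   [N / k' ^+ 2]. *)
have T3 x : 2 * (m%:R + 1) / c * k' ^+ 2 * l <= 2 * k' ^+ 2 * x ->
    n%:R ^+ m * expR (- (c * x)) <= expR (- l).
  move=> h; rewrite nl -expRM_natr -expRD ler_expR.
  have : (m%:R + 1) * l <= c * x; last by blra.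
  have k20 : 0 < 2 * k' ^+ 2 / c by rewrite divr_gt0 // kj2.
  rewrite -(ler_pM2l k20).
  have -> : 2 * k' ^+ 2 / c * ((m%:R + 1) * l) = 2 * (m%:R + 1) / c * k' ^+ 2 * l by ring.
  have -> : 2 * k' ^+ 2 / c * (c * x) = 2 * k' ^+ 2 * x by field; rewrite gt_eqF.
  exact: h.
have hc : 4 * (m%:R + 1) / c * k' ^+ 2 * l <= N.
  by apply: ND' => //; rewrite divr_ge0 ?(ltW c0) // mulr_ge0 //; blra.
have hc0 : 0 <= (m%:R + 1) / c * k' ^+ 2 * l.
  by apply: mulr_ge0; [apply: mulr_ge0; [apply: divr_ge0; [blra | exact: ltW] | exact: ltW (kj0 _)] | blra].
have U3 := T3 (#|~: B| - m)%:R _; have U4 := T3 (#|B| - m)%:R _.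
apply: le_trans (lerD (lerD (lerD T1 T2) (U3 _)) (U4 _)) _; last by blra.
- have [h _] := cBm'; have k1 : 1 <= k' ^+ 2 by rewrite expr_ge1 //; blra.
  apply: le_trans (_ : 2 * k' ^+ 2 * (N / 4) <= _); last first.
    by apply: ler_wpM2l => //; exact: ltW (kj2 _).
  have : 1 * N <= k' ^+ 2 * N by apply: ler_wpM2r => //; exact: ltW.
  move: hc hc0; set A := (m%:R + 1) / c * k' ^+ 2 * l.
  have -> : 4 * (m%:R + 1) / c * k' ^+ 2 * l = 4 * A by rewrite /A; ring.
  have -> : 2 * (m%:R + 1) / c * k' ^+ 2 * l = 2 * A by rewrite /A; ring.
  blra.
- have [h _] := u_bounds; apply: le_trans (_ : 2 * k' ^+ 2 * u%:R <= _); last first.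
    by apply: ler_wpM2l => //; exact: ltW (kj2 _).
  move: hc hc0; set A := (m%:R + 1) / c * k' ^+ 2 * l.
  have -> : 4 * (m%:R + 1) / c * k' ^+ 2 * l = 4 * A by rewrite /A; ring.
  have -> : 2 * (m%:R + 1) / c * k' ^+ 2 * l = 2 * A by rewrite /A; ring.
  by rewrite [2 * k' ^+ 2 * _]mulrC; move: h; set V := _ * (2 * _); blra.
Qed.

(** The main term is [n / k]; all others are of order [n / k ^ 2] and fit into [e * n / k]. The
    factor [1 + 4 * e] covers this and the gap between [k] and [2 * L]. *)
Lemma small_saturated_size (H : {set 'I_n * 'I_n}) (e L : R) : 0 < e <= 4^-1 -> 0 < L ->
  (2 - e) * L - 1 <= k' -> 1 <= 2 * e * L -> C%:R + 2 <= e * k' -> m%:R ^+ 2 + 1 <= D ->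
  (#|H| <= n + (r + #|B|) + m ^ 2)%N -> #|H|%:R <= N + N / (2 * L) * (1 + 4 * e).
Proof.
move=> /andP[e0 e4] L0 kL eL Ck mD; rewrite -(ler_nat R) => /le_trans; apply.
rewrite cB rE !natrD natrM natrX -NE -addrA lerD2l.
have k'0 : 0 < k' by blra.
have [_ hu] := u_bounds.
have h1 : (n %/ k)%:R * k' <= N by rewrite k'E NE -natrM ler_nat leq_trunc_div.
have h3 : (m%:R ^+ 2 + 1) * k' ^+ 2 <= N.
  by apply: ND'' => //; apply: addr_ge0 => //; exact: sqr_ge0.
set A := (n %/ k)%:R in h1 *; set U := u%:R in hu *; set M2 := m%:R ^+ 2 in h3 *.
have tot : (A + 1 + U + C%:R * U + M2) * k' <= N * (1 + e).
  rewrite -(ler_pM2r k'0).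
  have hCU : C%:R * (U * k' ^+ 2) <= C%:R * N by apply: ler_wpM2l.
  have hA : A * k' * k' <= N * k' by apply: ler_wpM2r => //; exact: ltW.
  have hC : (C%:R + 2) * N <= e * k' * N by apply: ler_wpM2r => //; exact: ltW.
  have -> : (A + 1 + U + C%:R * U + M2) * k' * k' =
    A * k' * k' + (M2 + 1) * k' ^+ 2 + U * k' ^+ 2 + C%:R * (U * k' ^+ 2) by ring.
  move: hCU hA hC h3 hu; set X := A * k' * k'; set Y := (M2 + 1) * k' ^+ 2; set Z := U * k' ^+ 2.
  blra.
rewrite -(ler_pM2r k'0); apply: le_trans tot _.
have -> : N / (2 * L) * (1 + 4 * e) * k' = N * ((1 + 4 * e) * k' / (2 * L)).
  by field; rewrite gt_eqF.
apply: ler_wpM2l; first exact: ltW.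
rewrite ler_pdivlMr; last by blra.
have h5 : (1 + 4 * e) * ((2 - e) * L - 1) <= (1 + 4 * e) * k' by apply: ler_wpM2l => //; blra.
apply: le_trans h5; nra.
Qed.

End UpperParameters.

Section Limits.
Local Open Scope ring_scope.
Local Open Scope classical_set_scope.
Variables (R : realType) (p : R) (m : nat).
Hypothesis p01 : 0 < p < 1.
Hypothesis m5 : (5 <= m)%N.
Local Notation lam := (ln (1 - p)^-1).

Lemma upper_size_lim (eps : R) : 0 < eps <= 1 -> \forall l \near +oo, forall n, n%:R = expR l ->
  Ex p (pairs n) (fun G => (~~ `[< exists2 H, saturated m G H &
    #|H|%:R <= n%:R + n%:R / (2 * (l / lam)) * (1 + eps) >])%:R) <= 4 * expR (- l).
Proof.
move=> /andP[eps0 eps1]; have lam0 := lam_gt0 p01; have /andP[p0 p1] := p01.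
pose e := eps / 4; have e04 : 0 < e <= 4^-1 by rewrite /e; apply/andP; split; lra.
have e01 : 0 < e <= 1 by rewrite /e; apply/andP; split; lra.
have P0 : 0 < p ^+ m by apply: exprn_gt0.
have m0R : 0 < m%:R :> R by rewrite ltr0n; apply: leq_trans m5.
pose c := p ^+ (2 * m) / (32 * m%:R).
have c0 : 0 < c by rewrite divr_gt0 ?exprn_gt0 // mulr_gt0.
pose C := (Num.truncn (8 / p ^+ m)).+1.
have C8 : 8 <= p ^+ m * C%:R.
  have x0 : 0 <= 8 / p ^+ m by rewrite divr_ge0 // ltW.
  by have /andP[_ /ltW] := truncn_itv x0; rewrite ler_pdivrMr // mulrC.
(* The sum of all lower bounds that will be imposed on [D]. *)
pose D := 8 * (m%:R + 2) + 384 / p ^+ 2 + 4 * (m%:R + 1) / c + (m%:R ^+ 2 + 1).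
have d1 : 0 <= 8 * (m%:R + 2) :> R by apply: mulr_ge0 => //; lra.
have d2 : 0 <= 384 / p ^+ 2 by rewrite divr_ge0 ?sqr_ge0.
have d3 : 0 <= 4 * (m%:R + 1) / c by apply: divr_ge0; [lra | exact: ltW].
have d4 : 0 <= m%:R ^+ 2 + 1 :> R by apply: addr_ge0 => //; exact: sqr_ge0.
have D0 : 0 <= D by rewrite /D; lra.
have D1 : 8 * (m%:R + 2) <= D by rewrite /D; lra.
have D2 : 384 / p ^+ 2 <= D by rewrite /D; lra.
have D3 : 4 * (m%:R + 1) / c <= D by rewrite /D; lra.
have D4 : m%:R ^+ 2 + 1 <= D by rewrite /D; lra.
have e2 : 0 < 2 * e by have /andP[? _] := e04; lra.
near=> l => n nl.
have l1 : 1 <= l by near: l; apply: nbhs_pinfty_ge; rewrite num_real.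
have l0 : 0 <= l by lra.
have /andP[kl _] := indep_size_itv p01 e01 l0.
have kP : 24 / p ^+ m <= (indep_size p e l)%:R by near: l; apply: indep_size_ge.
have kp : 4 / p <= (indep_size p e l)%:R by near: l; apply: indep_size_ge.
have kC : 2 * C%:R <= (indep_size p e l)%:R :> R by near: l; apply: indep_size_ge.
have km : m%:R + 2 <= (indep_size p e l)%:R :> R by near: l; apply: indep_size_ge.
have ke : (C%:R + 2) / e <= (indep_size p e l)%:R :> R by near: l; apply: indep_size_ge.
have ND : D * (indep_size p e l)%:R ^+ 5 * l ^+ 1 <= expR (1 * l).
  by near: l; apply: indep_size_poly.
have Nk3 : 4 * (indep_size p e l)%:R ^+ 3 * l ^+ 0 <= expR (2^-1 * l).
  by near: l; apply: indep_size_poly => //; lra.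
have ov : forall n, n%:R = expR l -> let k := indep_size p e l in let u1 := (n %/ k ^ 3)%N in
    16 * overlap_sum p u1 k * (u1%:R * expR (2^-1 * l)) <= 1.
  by near: l; apply: overlap_sum_lim.
have eL : 1 <= 2 * e * (l / lam).
  have : lam / (2 * e) <= l by near: l; apply: nbhs_pinfty_ge; rewrite num_real.
  rewrite ler_pdivrMr // => h.
  by rewrite mulrA ler_pdivlMr // mul1r mulrC.
have {ov} ov := ov n nl.
rewrite expr1 mul1r in ND; rewrite expr0 mulr1 in Nk3.
move: kl kP kp kC km ke ND Nk3 ov; set k := indep_size p e l => kl kP kp kC km ke ND Nk3 /= ov.
set u1 := (n %/ k ^ 3)%N in ov *; pose u := (n %/ k ^ 2)%N.
pose r := (n %/ k + 1 + u)%N; pose B := [set i : 'I_n | (i < C * u)%N].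
have kP' : 24 <= p ^+ m * k%:R by move: kP; rewrite ler_pdivrMr // mulrC.
have kp' : 4 <= p * k%:R by move: kp; rewrite ler_pdivrMr // mulrC.
have ke' : C%:R + 2 <= e * k%:R.
  by have /andP[e0 _] := e04; move: ke; rewrite ler_pdivrMr // mulrC.
have ND' : D * k%:R ^+ 5 * l <= n%:R by rewrite nl.
have p01' : 0 <= p <= 1 by rewrite !ltW.
apply: le_trans (@Ex_small_saturated_le R p l D n m k C p01 m5 l1 nl (p ^+ m) c n%:R k%:R u u1 r B
  erefl erefl erefl erefl erefl erefl erefl erefl C8 kP' kp' kC km D1 D2 D3 ND' Nk3 ov).
apply: Ex_le => // G _; rewrite ler_nat.
case: (boolP (has_small_saturated m r B G)) => [/asboolP[H sat cH]|_]; last exact: leq_b1.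
rewrite leqn0 eqb0 negbK; apply/asboolP; exists H => //.
have L0 : 0 < l / lam by apply: divr_gt0 => //; lra.
have -> : eps = 4 * e by rewrite /e; field.
have kl' : (2 - e) * (l / lam) - 1 <= k%:R by rewrite mulrA.
exact: (@small_saturated_size R p l D n m k C p01 m5 l1 nl (p ^+ m) n%:R k%:R u r B
  erefl erefl erefl erefl erefl erefl C8 kP' kC km D1 ND' H e).
Unshelve. all: by end_near.
Qed.

End Limits.

(** * The theorem *)

Section SaturationNumber.
Variables (n m : nat) (G : {set 'I_n * 'I_n}).

Lemma satn_le H : saturated m G H -> satn m G <= #|H|.
Proof.
move=> /asboolP sat; rewrite /satn; have := mem_index_enum H.
elim: (index_enum _) => // H' s IH; rewrite in_cons big_cons => /orP[/eqP<-|/IH le].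
  by rewrite sat geq_minl.
by case: ifP => // _; apply: leq_trans (geq_minr _ _) le.
Qed.

(** The default [#|G|] of the minimum is harmless: some saturated graph exists, and being inside [G]
    it has at most that many edges. *)
Lemma satn_attained : 0 < m -> exists2 H, saturated m G H & #|H| <= satn m G.
Proof.
move=> m0; rewrite /satn; apply: (big_ind (fun x => exists2 H, saturated m G H & #|H| <= x)).
- have [H sat] := saturated_exists G m0; exists H => //.
  by case: sat => HG _ _; apply: subset_leq_card.
- by move=> x y Hx Hy; rewrite /minn; case: ifP.
- by move=> H /asboolP sat; exists H.
Qed.

End SaturationNumber.

(** * From a fixed error [eps] to convergence in probability *)

Section WithHighProbability.
Local Open Scope ring_scope.
Local Open Scope classical_set_scope.
Variables (R : realType) (p : R) (m : nat).
Hypothesis p01 : 0 < p < 1.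
Hypothesis m5 : (5 <= m)%N.

Let p01' : 0 <= p <= 1. Proof. by have /andP[? ?] := p01; rewrite !ltW. Qed.

Lemma Gnp_probE n (P : {set 'I_n * 'I_n} -> Prop) :
  Gnp_prob p P = Ex p (pairs n) (fun G => `[< P G >]%:R).
Proof.
rewrite /Gnp_prob /Ex big_mkcondr; apply: eq_bigr => G _.
by case: asboolP => _; rewrite ?mulr1 ?mulr0.
Qed.

Lemma Gnp_prob_le1 n (P : {set 'I_n * 'I_n} -> Prop) : Gnp_prob p P <= 1.
Proof.
rewrite Gnp_probE -[X in _ <= X](Ex_cst p (pairs n)); apply: Ex_le => // G _.
by rewrite lern1 leq_b1.
Qed.

Lemma Gnp_prob_ge0 n (P : {set 'I_n * 'I_n} -> Prop) : 0 <= Gnp_prob p P.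
Proof. by rewrite Gnp_probE; apply: Ex_ge0. Qed.

Definition satn_bounds (eps : R) n (G : {set 'I_n * 'I_n}) :=
  let L := ln (n%:R) / ln ((1 - p)^-1) in
  n%:R + n%:R / (4 * (m%:R - 1) * L) * (1 - eps) <= (satn m G)%:R
  /\ (satn m G)%:R <= n%:R + n%:R / (2 * L) * (1 + eps).

Lemma near_ln (Q : R -> Prop) : (\forall l \near +oo, Q l) ->
  \forall n \near \oo, (0 < n)%N /\ Q (ln n%:R).
Proof.
move=> [M [_ HM]]; near=> n.
have n0 : (0 < n)%N by near: n; exists 1%N.
split=> //; apply: HM; rewrite -(expRK M) ltr_ln ?posrE ?expR_gt0 ?ltr0n //.
apply: lt_le_trans (_ : expR M + 1 <= _); first by rewrite ltrDl.
by near: n; apply: nbhs_infty_ger.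
Unshelve. all: by end_near.
Qed.

Lemma satn_bounds_lim (eps : R) : 0 < eps <= 1 -> \forall l \near +oo, forall n, n%:R = expR l :> R ->
  1 - eps <= Gnp_prob p (@satn_bounds eps n).
Proof.
move=> /[dup] e01 /andP[e0 e1]; have e2 : 0 < eps / 2 by lra.
near=> l => n nl.
have lln : ln n%:R = l by rewrite nl expRK.
have forest : forall n, n%:R = expR l :> R ->
    Ex p (pairs n) (fun G => (big_forest (forest_bound p (eps / 2) l) G)%:R) <= expR (- (eps / 2 / 4 * l)).
  by near: l; apply: Ex_big_forest_lim.
have low : forall n N t s, n%:R = expR l -> s = forest_bound p (eps / 2) l ->
    (n <= 2 * m.-1 * t * s + s * (1 + s + s ^ m.-1))%N -> (n + t < N + s)%N ->
    n%:R + n%:R / (4 * (m%:R - 1) * (l / ln (1 - p)^-1)) * (1 - eps) <= N%:R.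
  by near: l; apply: lower_size_lim.
have upp : forall n, n%:R = expR l -> Ex p (pairs n) (fun G => (~~ `[< exists2 H, saturated m G H &
    #|H|%:R <= n%:R + n%:R / (2 * (l / ln (1 - p)^-1)) * (1 + eps) >])%:R) <= 4 * expR (- l).
  by near: l; apply: upper_size_lim.
have small1 : 2 / eps * l ^+ 0 <= expR (eps / 2 / 4 * l) by near: l; apply: poly_le_expR; lra.
have small2 : 8 / eps * l ^+ 0 <= expR (1 * l) by near: l; apply: poly_le_expR.
rewrite expr0 mulr1 in small1; rewrite expr0 mulr1 mul1r in small2.
have r2 : 0 < 2 :> R by []. have r8 : 0 < 8 :> R by [].
have inv_small (a x : R) : 0 < a -> a / eps <= expR x -> expR (- x) <= eps / a.
  by move=> a0 ax; rewrite expRN -[X in _ <= X]invf_div lef_pV2 ?posrE ?expR_gt0 ?divr_gt0.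
have b1 := le_trans (forest n nl) (inv_small _ _ r2 small1).
have b2 := upp n nl; have b2' := inv_small _ _ r8 small2.
(* Every graph satisfies the bounds, contains a large forest-like set, or has no small saturated
   graph; the last two events have probability at most [eps / 2] each. *)
have tot : 1 <= Gnp_prob p (@satn_bounds eps n) +
   Ex p (pairs n) (fun G => (big_forest (forest_bound p (eps / 2) l) G)%:R) +
   Ex p (pairs n) (fun G => (~~ `[< exists2 H, saturated m G H &
    #|H|%:R <= n%:R + n%:R / (2 * (l / ln (1 - p)^-1)) * (1 + eps) >])%:R).
  rewrite Gnp_probE -!ExD -[X in X <= _](Ex_cst p (pairs n)); apply: Ex_le => // G sG.
  case: (boolP (big_forest _ G)) => [_|/no_big_forest nbf].
    by rewrite addrAC lerDr addr_ge0.
  case: asboolP => [_|nsb]; first by rewrite -addrA lerDl addr_ge0.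
  case: asboolP => [[H sat Hs]|_]; last by rewrite lerDr addr_ge0.
  case: nsb; rewrite /satn_bounds lln; split; last first.
    by apply: le_trans Hs; rewrite ler_nat satn_le.
  have [|H' sat' H'le] := @satn_attained n m G; first by apply: leq_trans m5.
  apply: le_trans (_ : #|H'|%:R <= _); last by rewrite ler_nat.
  have [t [h1 h2]] := saturated_card_lower m5 sG nbf sat'.
  exact: low h1 h2.
move: tot b1 b2 b2'; lra.
Unshelve. all: by end_near.
Qed.

Lemma satn_bounds_whp (eps : R) : 0 < eps <= 1 ->
  \forall n \near \oo, 1 - eps <= Gnp_prob p (@satn_bounds eps n).
Proof.
move=> e01; apply: filterS (near_ln (satn_bounds_lim e01)) => n [n0]; apply.
by rewrite lnK // posrE ltr0n.
Qed.

(* Diagonalisation: the error term at [n] is [1 / (k + 1)] for the largest admissible [k <= n]. *)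
Let admissible n k := 1 - k.+1%:R^-1 <= Gnp_prob p (@satn_bounds k.+1%:R^-1 n).
Let best n := (\max_(k < n.+1 | admissible n k) k)%N.

Let best_admissible n : admissible n (best n).
Proof.
have P0 : (0 < #|[pred k : 'I_n.+1 | admissible n k]|)%N.
  (* The index 0 is always admissible, as its bound is [1 - 1 = 0]. *)
  apply/card_gt0P; exists ord0; rewrite inE /admissible invr1 subrr.
  exact: Gnp_prob_ge0.
have [k ak E] := eq_bigmax_cond (fun k : 'I_n.+1 => nat_of_ord k) P0.
have -> : best n = k by rewrite -E /best; apply: eq_bigl => i; rewrite inE.
by move: ak; rewrite inE.
Qed.

Let best_ge K : \forall n \near \oo, (K <= best n)%N.
Proof.
have K01 : 0 < (K.+1%:R^-1 : R) <= 1 by rewrite invr_gt0 ltr0n /= invf_le1 ?ltr0n // ler1n.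
near=> n.
have aK : admissible n K by near: n; apply: satn_bounds_whp.
have Kn : (K < n.+1)%N by near: n; exists K.
exact: (@leq_bigmax_cond _ (fun k : 'I_n.+1 => admissible n k) (fun k => nat_of_ord k) (Ordinal Kn)).
Unshelve. all: by end_near.
Qed.

Lemma whp_diagonal : exists a : nat -> R, a @ \oo --> (0 : R) /\
  (fun n => Gnp_prob p (@satn_bounds (a n) n)) @ \oo --> (1 : R).
Proof.
pose a n : R := (best n).+1%:R^-1.
have a0 : a @ \oo --> (0 : R).
  apply/cvgr0Pnorm_le => e e0; pose K := Num.truncn e^-1.
  near=> n; rewrite ger0_norm ?invr_ge0 ?ler0n // /a.
  have Kb : (K <= best n)%N by near: n; apply: best_ge.
  have e0' : 0 <= e^-1 by rewrite invr_ge0 ltW.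
  have /andP[_ h] := truncn_itv e0'.
  rewrite -[X in _ <= X]invrK lef_pV2 ?posrE ?invr_gt0 ?ltr0n //.
  by apply: le_trans (ltW h) _; rewrite ler_nat ltnS.
exists a; split=> //.
apply: (@squeeze_cvgr _ _ _ _ (fun n => 1 - a n) (fun=> 1)).
- by near=> n; rewrite Gnp_prob_le1 andbT; apply: best_admissible.
- by rewrite -[X in _ --> X](subr0 (1 : R)); apply: cvgB => //; apply: cvg_cst.
- exact: cvg_cst.
Unshelve. all: by end_near.
Qed.

End WithHighProbability.

Local Open Scope classical_set_scope.
Local Open Scope ring_scope.

Theorem theorem1 (R : realType) (p : R) (m : nat) :
  0 < p < 1 -> (5 <= m)%N ->
  exists a b : nat -> R,
    a @ \oo --> (0 : R) /\ b @ \oo --> (0 : R) /\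
    (fun n : nat =>
       Gnp_prob p (fun G : {set 'I_n * 'I_n} =>
         let L := ln (n%:R) / ln ((1 - p)^-1) in
         n%:R + n%:R / (4 * (m%:R - 1) * L) * (1 - a n) <= (satn m G)%:R
         /\ (satn m G)%:R <= n%:R + n%:R / (2 * L) * (1 + b n)))
      @ \oo --> (1 : R).
Proof.
move=> p01 m5; have [a [a0 a1]] := whp_diagonal p01 m5.
by exists a, a.
Qed.
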